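(* Let $T>0$ and consider the setting of the context: flow $\Phi^t$, invariant ergodic measure $\mu$, Koopman operators $U^t$ with generator $V$, and kernel integral operator $K_T$ on $L^2(\mu)$. Let $\phi$ and $\psi$ be mutually orthogonal, unit-norm, real eigenfunctions of $K_T$ corresponding to nonzero eigenvalues $\lambda_T$ and $\nu_T$, respectively, with $\lambda_T\le\nu_T$. Assume that $\lambda_T,\nu_T$ are simple eigenvalues if they are distinct, and that the common value is an eigenvalue of multiplicity exactly two if they are equal. Define $$z=\frac{1}{\sqrt2}(\phi+i\psi),\qquad \omega=\frac1i\langle z,Vz\rangle=\langle\phi,V\psi\rangle=-\langle\psi,V\phi\rangle\in\mathbb R,$$ $$\gamma_T=\min_{u\in\sigma_p(K_T)\setminus\{\lambda_T,\nu_T\}}\min\{|\lambda_T-u|,|\nu_T-u|\},\qquad \delta_T=\frac{1}{\sqrt2}(\nu_T-\lambda_T),\qquad \tilde\delta_T=\frac{\delta_T}{\nu_T},$$ $$C_1=2\|h\|_{C^1(\mathbb R_+)}\|d^2\|_{C(X\times X)},\qquad C_2=2\|h\|_{C^1(\mathbb R_+)}\|d^2\|_{C^1(M\times M)},$$ $$s_t=\frac{1}{\gamma_T}\left(\frac{C_1t}{T}+3\delta_T\right),\qquad S_t=\frac{C_2\|\mathcal V\|(1+\tilde\delta_T)}{\lambda_T}\int_0^ts_u\,du,\qquad \epsilon_t=s_t+3\sqrt{S_t}.$$ Then, for every $t\ge0$, the phase factor $e^{i\omega t}$ lies in the $\epsilon_t$-approximate point spectrum of $U^t$, and $z$ is a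 corresponding $\epsilon_t$-approximate eigenfunction. Moreover, for every $\tau\ge0$, $(e^{i\omega t},z)$ is an $\epsilon_\tau$-approximate eigenpair of $U^t$ for all $t\in[0,\tau]$, i.e. $\|U^tz-e^{i\omega t}z\|_{L^2(\mu)}\le\epsilon_\tau\|z\|_{L^2(\mu)}$. Furthermore, $z$ has the continuous representative $\zeta\in C(\Omega)$ given by $$\zeta=\frac{1}{\sqrt2}\int_\Omega k_T(\cdot,x)\left(\frac{\phi(x)}{\lambda_T}+i\frac{\psi(x)}{\nu_T}\right)d\mu(x).$$
   Context: Dynamical system. $\Phi^t:\Omega\to\Omega$, $t\in\mathbb R$, is a continuous-time, continuous flow on a metric space $\Omega$ with an invariant, ergodic Borel probability measure $\mu$ whose support is a compact set $X\subseteq\Omega$. $X$ is contained in a forward-invariant compact $C^1$ manifold $M\subseteq\Omega$ (i.e. $\Phi^t(M)\subseteq M$ for $t\ge0$) such that $\Phi^t|_M$ is $C^1$ (jointly in $(t,x)$, $t\ge 0$); $X$ need not have any differentiable structure. The system is observed through a continuous function $F:\Omega\to Y$, $Y$ a Banach space, with $F|_M$ of class $C^1$. Operators. $\langle f,g\rangle=\int_\Omega f^*g\,d\mu$ is the inner product of (complex) $L^2(\mu)$, conjugate-linear in the first argument. The Koopman operators $U^tf=f\circ\Phi^t$ form a strongly continuous unitary group on $L^2(\mu)$ with skew-adjoint generator $V:D(V)\to L^2(\mu)$, so $\frac{d}{dt}U^tf=VU^tf=U^tVf$ for $f\in D(V)$. $\mathcal V:C^1(M)\to C(M)$ is the directional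 derivative along the vector field $\vec V$ generating the dynamics, $\mathcal Vf=\vec V\cdot\nabla f$, i.e. $\mathcal V f(x)=\lim_{t\to0^+}(f(\Phi^t(x))-f(x))/t$; it is bounded with operator norm $\|\mathcal V\|$, and $V$ extends it: the class in $L^2(\mu)$ of $f\in C^1(M)$ lies in $D(V)$ and $Vf=\mathcal Vf$ $\mu$-a.e. Kernel. $d(x,x')=\|F(x)-F(x')\|_Y$; for $T>0$, $d_T^2(x,x')=\frac1T\int_0^Td^2(\Phi^t(x),\Phi^t(x'))\,dt$. The function $d^2$ restricted to $M\times M$ is assumed to be $C^1$. $h:\mathbb R_+\to\mathbb R_+$ is a positive, bounded, $C^1$ function with bounded derivative. $k_T(x,x')=h(d_T^2(x,x'))$, and $K_T:L^2(\mu)\to L^2(\mu)$, $K_Tf=\int_\Omega k_T(\cdot,x)f(x)\,d\mu(x)$, is self-adjoint and Hilbert-Schmidt; it is assumed to be positive (all its eigenvalues are $\ge0$). $\sigma_p(K_T)$ is its set of eigenvalues. Elements of the range of $K_T$ (in particular eigenfunctions with nonzero eigenvalue) have representatives that are $C^1$ on $M$, hence lie in $D(V)$. Norms. $C(\cdot)$ carries the sup norm where finite. $\|h\|_{C^1(\mathbb R_+)}=\sup|h|+\sup|h'|$. $C^1(M)$ and $C^1(M\times M)$ carry the standard norms (sup norm of the function plus sup norm of its differential, with respect to a fixed continuous Riemannian metric on $M$ and the product metric on $M\times M$). Approximate spectrum. For $\epsilon\ge0$, a nonzero $z\in L^2(\mu)$ is an $\epsilon$-approximate eigenfunction of $U^t$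 corresponding to $a\in\mathbb C$, $a$ lies in the $\epsilon$-approximate point spectrum of $U^t$, and $(a,z)$ is an $\epsilon$-approximate eigenpair of $U^t$, if $\|U^tz-az\|_{L^2(\mu)}\le\epsilon\|z\|_{L^2(\mu)}$. A continuous representative of $z$ is a continuous function on $\Omega$ equal to $z$ $\mu$-a.e. *)

(* Defs.v *)
From HB Require Import structures.
From mathcomp Require Import all_boot all_order all_algebra.
From mathcomp Require Import all_classical all_reals all_analysis.
From mathcomp Require Import complex.
Set Implicit Arguments.
Unset Strict Implicit.
Unset Printing Implicit Defensive.

Import Order.TTheory GRing.Theory Num.Theory.
Import numFieldNormedType.Exports.
Local Open Scope classical_set_scope.
Local Open Scope ring_scope.
Local Open Scope complex_scope.

(* The sigma-algebra is not tied to the topology here: that it is the Borel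
   one is a separate hypothesis, see [borel]. *)
#[short(type="measurableMetricType")]
HB.structure Definition MeasurableMetric (R : realType) (d : measure_display) :=
  {T of Metric R T & Measurable d T}.

Definition borel (R : realType) (d : measure_display)
    (Omega : measurableMetricType R d) :=
  @measurable d Omega = <<s @open Omega >>.

Section C1_maps.
Context {R : realType}.

Definition lincomb (n : nat) (W : normedModType R) (J : 'I_n -> W)
    (v : 'rV[R]_n) : W :=
  \sum_(j < n) v ord0 j *: J j.

(* v |-> lincomb J v is the differential at u of f restricted to A; the J j
   are the partial derivatives.  A need not be open, so that one-sided
   derivatives at t = 0 and at boundary points are covered. *)
Definition is_diff_within (n : nat) (W : normedModType R) (A : set 'rV[R]_n)
    (f : 'rV[R]_n -> W) (u : 'rV[R]_n) (J : 'I_n -> W) :=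
  forall e : R, 0 < e ->
    \forall v \near within A (nbhs u),
      `|f v - f u - lincomb J (v - u)| <= e * `|v - u|.

Definition C1_on (n : nat) (W : normedModType R) (A : set 'rV[R]_n)
    (f : 'rV[R]_n -> W) :=
  exists J : 'rV[R]_n -> 'I_n -> W,
    (forall u, A u -> is_diff_within A f u (J u)) /\
    (forall j, {within A, continuous (fun u => J u j)}).

(* S is covered by local parametrizations p i : A i -> S. *)
Definition C1_fun (n : nat) (W : normedModType R) (S I : Type)
    (A : I -> set 'rV[R]_n) (p : I -> 'rV[R]_n -> S) (f : S -> W) :=
  forall i, C1_on (A i) (f \o p i).

(* q i u is the squared length of tangent vectors at p i u, expressed in the
   i-th chart, so the second term is the sup over D of the operator norm of
   the differential. *)
Definition C1_norm (n : nat) (W : normedModType R) (S I : Type) (D : set S)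
    (A : I -> set 'rV[R]_n) (p : I -> 'rV[R]_n -> S)
    (q : I -> 'rV[R]_n -> 'rV[R]_n -> R) (f : S -> W) : R :=
  sup [set `|f x| | x in D] +
  sup [set r | exists i u v J, [/\ A i u, q i u v <= 1,
         is_diff_within (A i) (f \o p i) u J & r = `|lincomb J v| ] ].

End C1_maps.

Section manifolds.
Context {R : realType}.

(* For n = 0 this is the one-point space 'rV_0. *)
Definition half_space (n : nat) : set 'rV[R]_n :=
  [set u | forall i : 'I_n, val i = 0%N -> 0 <= u ord0 i].

(* C^1 atlas on a subset M of a topological space, for the subspace topology.
   M may have a boundary; charts of a manifold without boundary are those
   taking values in the interior of the half-space (up to shrinking and
   translating, every Euclidean chart is of this form). *)
Record c1_atlas (Omega : topologicalType) (M : set Omega) (n : nat) :=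
  C1Atlas {
    idx : Type ;
    dom : idx -> set Omega ;
    img : idx -> set 'rV[R]_n ;
    chart : idx -> Omega -> 'rV[R]_n ;
    param : idx -> 'rV[R]_n -> Omega ;
    dom_open : forall i, exists2 U, open U & dom i = U `&` M ;
    img_open : forall i, exists2 U, open U & img i = U `&` @half_space n ;
    dom_cover : M `<=` \bigcup_i dom i ;
    chart_img : forall i x, dom i x -> img i (chart i x) ;
    param_dom : forall i u, img i u -> dom i (param i u) ;
    chartK : forall i x, dom i x -> param i (chart i x) = x ;
    paramK : forall i u, img i u -> chart i (param i u) = u ;
    chart_continuous : forall i, {within dom i, continuous (chart i)} ;
    param_continuous : forall i, {within img i, continuous (param i)} ;
    transition_C1 : forall i j,
      C1_on (img i `&` param i @^-1` dom j) (chart j \o param i)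
  }.

Definition qform (n : nat) (G : 'M[R]_n) (v : 'rV[R]_n) : R :=
  (v *m G *m v^T) ord0 ord0.

Record riemannian_metric (Omega : topologicalType) (M : set Omega) (n : nat)
    (a : c1_atlas M n) := RiemannianMetric {
  gram : idx a -> 'rV[R]_n -> 'M[R]_n ;
  gram_sym : forall i u, img i u -> (gram i u)^T = gram i u ;
  gram_pos : forall i u v, img i u -> v != 0 -> 0 < qform (gram i u) v ;
  gram_continuous : forall i k l,
    {within img i, continuous (fun u => gram i u k l)} ;
  gram_transition : forall i j u J v, img i u -> dom j (param i u) ->
    is_diff_within (img i `&` param i @^-1` dom j) (chart j \o param i) u J ->
    qform (gram i u) v = qform (gram j (chart j (param i u))) (lincomb J v)
}.

Context {Omega : topologicalType} {M : set Omega} {n : nat}.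
Variables (a : c1_atlas M n).

Definition C1_M (W : normedModType R) (f : Omega -> W) :=
  C1_fun (@img _ _ _ a) (@param _ _ _ a) f.

Definition prod_img (ij : idx a * idx a) : set 'rV[R]_(n + n) :=
  [set w | img ij.1 (lsubmx w) /\ img ij.2 (rsubmx w)].

Definition prod_param (ij : idx a * idx a) (w : 'rV[R]_(n + n)) :
    Omega * Omega :=
  (param ij.1 (lsubmx w), param ij.2 (rsubmx w)).

Definition C1_MM (f : Omega * Omega -> R) := C1_fun prod_img prod_param f.

(* (t, x) |-> Phi t x is C^1 on [0, +oo[ x M, as a map into M; the first
   coordinate of w : 'rV_(1 + n) is the time. *)
Definition C1_flow (Phi : R -> Omega -> Omega) :=
  forall i j : idx a,
    C1_on [set w : 'rV[R]_(1 + n) | [/\ 0 <= lsubmx w ord0 ord0,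
             img i (rsubmx w) &
             dom j (Phi (lsubmx w ord0 ord0) (param i (rsubmx w)))] ]
          (fun w => chart j (Phi (lsubmx w ord0 ord0) (param i (rsubmx w)))).

Variable g : riemannian_metric a.

Definition normC1_M (f : Omega -> R) : R :=
  C1_norm M (@img _ _ _ a) (@param _ _ _ a) (fun i u => qform (gram g i u)) f.

Definition normC1_MM (f : Omega * Omega -> R) : R :=
  C1_norm (M `*` M) prod_img prod_param
    (fun ij w v => qform (gram g ij.1 (lsubmx w)) (lsubmx v) +
                   qform (gram g ij.2 (rsubmx w)) (rsubmx v)) f.

Definition dirder (Phi : R -> Omega -> Omega) (f : Omega -> R)
    (x : Omega) : R :=
  lim ((f (Phi t x) - f x) / t @[t --> 0^'+]).

(* Norm of dirder as an operator C^1(M) -> C(M).  Real functions suffice: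
   multiplying by a phase and taking the real part shows that the norm on
   complex C^1 functions is the same. *)
Definition dirder_norm (Phi : R -> Omega -> Omega) : R :=
  sup [set r | exists f x, [/\ C1_M f, normC1_M f <= 1, M x &
                               r = `|dirder Phi f x| ] ].

End manifolds.

Section dynamics.
Context {R : realType}.

Definition continuous_flow (Omega : topologicalType)
    (Phi : R -> Omega -> Omega) :=
  [/\ forall x, Phi 0 x = x,
      forall s t x, Phi (s + t) x = Phi s (Phi t x) &
      continuous (fun p : R * Omega => Phi p.1 p.2)].

Context {d : measure_display} {Omega : measurableMetricType R d}.
Variable mu : {measure set Omega -> \bar R}.

Definition invariant_measure (Phi : R -> Omega -> Omega) :=
  forall t A, measurable A -> mu (Phi t @^-1` A) = mu A.

Definition ergodic_measure (Phi : R -> Omega -> Omega) :=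
  forall A, measurable A -> (forall t, Phi t @^-1` A = A) ->
    mu A = 0%E \/ mu (~` A) = 0%E.

(* the smallest closed set of full measure *)
Definition is_support (X : set Omega) :=
  [/\ closed X, mu (~` X) = 0%E &
      forall C, closed C -> mu (~` C) = 0%E -> X `<=` C].

End dynamics.

Section L2.
Context {R : realType} {d : measure_display} {Omega : measurableMetricType R d}.
Variable mu : {measure set Omega -> \bar R}.
Implicit Types f g z : Omega -> R[i].

(* Elements of L^2(mu) are handled through representatives. *)
Definition aeq f g := {ae mu, forall x, f x = g x}.

Definition L2 f :=
  [/\ measurable_fun setT (fun x => complex.Re (f x)),
      measurable_fun setT (fun x => complex.Im (f x)) &
      (\int[mu]_x ((Normc.normc (f x) ^+ 2)%:E) < +oo)%E].

Definition cintegral f : R[i] :=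
  (\int[mu]_x complex.Re (f x)) +i* (\int[mu]_x complex.Im (f x)).

Definition inner f g : R[i] := cintegral (fun x => conjc (f x) * g x).

Definition L2norm f : R := Num.sqrt (\int[mu]_x (Normc.normc (f x) ^+ 2)).

Definition koopman (Phi : R -> Omega -> Omega) (t : R) f : Omega -> R[i] :=
  f \o Phi t.

(* f is in D(V) and V f = g *)
Definition generator_graph (Phi : R -> Omega -> Omega) f g :=
  [/\ L2 f, L2 g &
      L2norm (fun x => (t^-1)%:C * (koopman Phi t f x - f x) - g x)
        @[t --> 0^'] --> (0 : R)].

Definition approx_eigenpair (Phi : R -> Omega -> Omega) (t eps : R)
    (a : R[i]) z :=
  [/\ L2 z, ~ aeq z (cst 0) &
      L2norm (fun x => koopman Phi t z x - a * z x) <= eps * L2norm z].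

Definition approx_point_spectrum (Phi : R -> Omega -> Omega) (t eps : R) :
    set R[i] :=
  [set a | exists z, approx_eigenpair Phi t eps a z].

Definition integral_op (k : Omega -> Omega -> R) f : Omega -> R[i] :=
  fun y => cintegral (fun x => (k y x)%:C * f x).

Definition L2_eigenspace (k : Omega -> Omega -> R) (u : R[i]) :
    set (Omega -> R[i]) :=
  [set f | L2 f /\ aeq (integral_op k f) (fun x => u * f x)].

Definition point_spectrum (k : Omega -> Omega -> R) : set R[i] :=
  [set u | exists2 f, L2_eigenspace k u f & ~ aeq f (cst 0)].

(* the eigenspace of u, modulo a.e. equality, has dimension m *)
Definition has_multiplicity (k : Omega -> Omega -> R) (u : R[i]) (m : nat) :=
  exists e : 'I_m -> Omega -> R[i],
    [/\ forall i, L2_eigenspace k u (e i),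
        forall c : 'I_m -> R[i],
          aeq (fun x => \sum_(i < m) c i * e i x) (cst 0) ->
          forall i, c i = 0 &
        forall f, L2_eigenspace k u f ->
          exists c : 'I_m -> R[i], aeq f (fun x => \sum_(i < m) c i * e i x)].

End L2.

Section kernels.
Context {R : realType}.

Definition obs_dist2 (Omega : Type) (Y : normedModType R) (F : Omega -> Y)
    (p : Omega * Omega) : R :=
  `|F p.1 - F p.2| ^+ 2.

Definition delay_dist2 (Omega : Type) (Y : normedModType R) (F : Omega -> Y)
    (Phi : R -> Omega -> Omega) (T : R) (x y : Omega) : R :=
  T^-1 * \int[lebesgue_measure]_(t in `[0, T])
           obs_dist2 F (Phi t x, Phi t y).

Definition delay_kernel (Omega : Type) (Y : normedModType R) (F : Omega -> Y)
    (Phi : R -> Omega -> Omega) (h : R -> R) (T : R) (x y : Omega) : R :=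
  h (delay_dist2 F Phi T x y).

(* h is a positive, bounded C^1 function on [0, +oo[ with bounded derivative
   h'; the values of h and h' on negative reals are irrelevant. *)
Definition kernel_shape (h h' : R -> R) :=
  [/\ forall r : R, 0 <= r -> 0 < h r,
      exists B : R, forall r : R, 0 <= r -> `|h r| <= B,
      forall r : R, 0 <= r ->
        (h s - h r) / (s - r)
          @[s --> within (`[0, +oo[ `\ r) (nbhs r)] --> h' r,
      {within `[0, +oo[, continuous h'} &
      exists B : R, forall r : R, 0 <= r -> `|h' r| <= B].

Definition normC1_halfline (h h' : R -> R) : R :=
  sup [set `|h r| | r in `[0, +oo[] + sup [set `|h' r| | r in `[0, +oo[].

Definition sup_norm (S : Type) (D : set S) (f : S -> R) : R :=
  sup [set `|f x| | x in D].

Definition is_minimum (S : set R) (m : R) := S m /\ lbound S m.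

Definition expi (t : R) : R[i] := cos t +i* sin t.

End kernels.

(* Main.v *)
(* Let b(t) be the real part of e^(-i omega t) <z, U^t z>, so that
   |U^t z - e^(i omega t) z|^2 = 2 - 2 b(t) and b(0) = 1.  Splitting U^t phi and
   U^t psi into components along phi and psi and residuals orthogonal to both,
   skew-adjointness of V leaves in b' only inner products of V phi and V psi
   with the residuals.  A residual r satisfies gamma |r| <= |(K_T - nu) r| by the
   spectral gap, and K_T nearly commutes with U^t because
   |k_T(Phi^t x, Phi^t y) - k_T(x, y)| is of order t / T; the norms of V phi and
   V psi are controlled by writing phi = K_T phi / lambda with a C^1 kernel.
   Integrating b' gives 2 - 2 b(t) <= S_t.  All of this takes place in the real
   Hilbert space, and the gap inequality needs no spectral theorem: eigenvectors
   come from power iteration on the kernel sections, and Bessel's inequality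
   bounds the number of them above a given level. *)
Require Import Defs.
From HB Require Import structures.
From mathcomp Require Import all_boot all_order all_algebra.
From mathcomp Require Import all_classical all_reals all_analysis.
From mathcomp Require Import complex ring lra measurable_realfun.
Set Implicit Arguments.
Unset Strict Implicit.
Unset Printing Implicit Defensive.

Import Order.TTheory GRing.Theory Num.Theory.
Import numFieldNormedType.Exports.
Local Open Scope classical_set_scope.
Local Open Scope ring_scope.
Local Open Scope complex_scope.

(** * Semi-inner products *)

(** The gap is measured from nu alone. By the multiplicity hypotheses phi and psi exhaust the
    eigenspaces of lambda and nu, so every eigenvector orthogonal to both has an eigenvalue at
    distance at least gamma from nu. Treating phi as if its eigenvalue were nu costs nu - lambda,
    once; each of the two residuals costs one commutator term c t with c = |h| |d^2| / T, and 2 c is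
    C_1 / T.

    Two features of the setting shape the analytic part. M is only forward invariant and may have a
    boundary, so derivatives along the flow are taken from the right, and Lipschitz bounds have to
    be drawn from right derivatives. Omega is not assumed separable, so a continuous kernel need not
    be measurable for the product sigma-algebra; compactness of X repairs this before Fubini's
    theorem is applied.

    Completeness of L^2 is avoided: the only limits that are formed are limits of images under K,
    and these converge uniformly. *)

Record semi_inner (R : realType) (V : lmodType R) := SemiInner {
  ip :> V -> V -> R ;
  ipDl : forall x y z, ip (x + y) z = ip x z + ip y z ;
  ipZl : forall c x z, ip (c *: x) z = c * ip x z ;
  ipC : forall x y, ip x y = ip y x ;
  ip_ge0 : forall x, 0 <= ip x x
}.

Section semi_inner_theory.
Context {R : realType} {V : lmodType R} (ip : semi_inner V).
Implicit Types (x y z : V) (c : R).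

Lemma ipDr x y z : ip x (y + z) = ip x y + ip x z.
Proof. by rewrite ipC ipDl !(ipC _ x). Qed.

Lemma ipZr c x y : ip x (c *: y) = c * ip x y.
Proof. by rewrite ipC ipZl ipC. Qed.

Lemma ip0l x : ip 0 x = 0.
Proof. by rewrite -(scale0r 0) ipZl mul0r. Qed.

Lemma ip0r x : ip x 0 = 0.
Proof. by rewrite ipC ip0l. Qed.

Lemma ipNl x y : ip (- x) y = - ip x y.
Proof. by rewrite -scaleN1r ipZl mulN1r. Qed.

Lemma ipNr x y : ip x (- y) = - ip x y.
Proof. by rewrite ipC ipNl ipC. Qed.

Lemma ipBl x y z : ip (x - y) z = ip x z - ip y z.
Proof. by rewrite ipDl ipNl. Qed.

Lemma ipBr x y z : ip x (y - z) = ip x y - ip x z.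
Proof. by rewrite ipDr ipNr. Qed.

Lemma ip_suml (I : Type) (r : seq I) (P : pred I) (F : I -> V) y :
  ip (\sum_(i <- r | P i) F i) y = \sum_(i <- r | P i) ip (F i) y.
Proof.
by elim/big_rec2: _ => [|i a b _ <-]; rewrite ?ip0l// ipDl.
Qed.

Lemma ip_CS x y : ip x y ^+ 2 <= ip x x * ip y y.
Proof.
have [y0|y0] := eqVneq (ip y y) 0.
  rewrite y0 mulr0; suff -> : ip x y = 0 by rewrite expr0n.
  (* For null y the usual quadratic in t degenerates to an affine function. Being nonnegative on the
     whole line it has slope zero: at the point substituted below it would equal -1. *)
  have H t : 0 <= ip x x + t * ip x y.
    have := ip_ge0 ip (x + (t / 2) *: y).
    by rewrite !(ipDl, ipDr, ipZl, ipZr) y0 (ipC ip y x); lra.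
  apply/eqP/negPn/negP => xy.
  have := H (- (ip x x + 1) / ip x y).
  by rewrite divfK//; lra.
have yp : 0 < ip y y by rewrite lt_neqAle eq_sym y0 ip_ge0.
have := ip_ge0 ip (ip y y *: x - ip x y *: y).
rewrite !(ipBl, ipBr, ipZl, ipZr) (ipC ip y x).
rewrite (_ : _ - _ = ip y y * (ip x x * ip y y - ip x y ^+ 2)); last by ring.
by rewrite pmulr_rge0// subr_ge0.
Qed.

Lemma ip_null x y : ip x x = 0 -> ip x y = 0.
Proof.
move=> x0; have := ip_CS x y; rewrite x0 mul0r => h.
by apply/eqP; rewrite -sqrf_eq0 eq_le h sqr_ge0.
Qed.

Definition ipnorm x := Num.sqrt (ip x x).

Lemma ipnorm_ge0 x : 0 <= ipnorm x.
Proof. exact: sqrtr_ge0. Qed.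

Lemma sqr_ipnorm x : ipnorm x ^+ 2 = ip x x.
Proof. by rewrite sqr_sqrtr// ip_ge0. Qed.

Lemma ipnorm_CS x y : `|ip x y| <= ipnorm x * ipnorm y.
Proof.
rewrite -ler_sqr ?nnegrE ?mulr_ge0 ?ipnorm_ge0//.
by rewrite real_normK ?num_real// exprMn !sqr_ipnorm ip_CS.
Qed.

Lemma ipnormZ c x : ipnorm (c *: x) = `|c| * ipnorm x.
Proof.
rewrite /ipnorm ipZl ipZr mulrA -expr2 sqrtrM ?sqr_ge0//.
by rewrite sqrtr_sqr.
Qed.

Lemma ipnormN x : ipnorm (- x) = ipnorm x.
Proof. by rewrite -scaleN1r ipnormZ normrN1 mul1r. Qed.

Lemma ipnormD x y : ipnorm (x + y) <= ipnorm x + ipnorm y.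
Proof.
rewrite -ler_sqr ?nnegrE ?addr_ge0 ?ipnorm_ge0//.
rewrite sqr_ipnorm !(ipDl, ipDr) (ipC ip y x) -!sqr_ipnorm.
have := le_trans (ler_norm _) (ipnorm_CS x y); nra.
Qed.

Lemma ipnormB x y : ipnorm (x - y) <= ipnorm x + ipnorm y.
Proof. by rewrite -(ipnormN y) ipnormD. Qed.

Lemma cvg_ipl (x_ : nat -> V) x y :
  ip (x_ n - x) (x_ n - x) @[n --> \oo] --> (0 : R) ->
  ip (x_ n) y @[n --> \oo] --> ip x y.
Proof.
move=> h.
have h2 : ipnorm (x_ n - x) * ipnorm y @[n --> \oo] --> (0 : R).
  rewrite -[X in _ --> X](mul0r (ipnorm y)); apply: cvgMl.
  rewrite -(sqrtr0 R).
  apply: continuous_cvg => //; exact: sqrt_continuous.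
apply/cvgrPdist_le => /= e e0.
move/cvgrPdist_le : h2 => /(_ _ e0) [N _ hN]; exists N => // n /hN /=.
rewrite sub0r normrN => h3.
rewrite -normrN opprB -ipBl (le_trans (ipnorm_CS _ _))//.
by rewrite (le_trans _ h3)// ler_norm.
Qed.

Lemma cvg_ip_sqr (x_ : nat -> V) x :
  ip (x_ n - x) (x_ n - x) @[n --> \oo] --> (0 : R) ->
  ip (x_ n) (x_ n) @[n --> \oo] --> ip x x.
Proof.
move=> h.
have -> : (fun n => ip (x_ n) (x_ n)) =
    (fun n => ip (x_ n - x) (x_ n - x) + 2 * ip (x_ n) x - ip x x).
  apply/funext => n; rewrite !(ipBl, ipBr) (ipC ip x (x_ n)); ring.
rewrite [X in _ --> X](_ : _ = 0 + 2 * ip x x - ip x x); last by ring.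
apply: cvgB; last exact: cvg_cst.
by apply: cvgD => //; apply: cvgMr; exact: cvg_ipl.
Qed.

(* equality of the classes modulo null vectors *)
Definition ipeq x y := forall z, ip x z = ip y z.

Definition orthonormal (m : nat) (e : nat -> V) :=
  forall i j, (i < m)%N -> (j < m)%N -> ip (e i) (e j) = (i == j)%:R.

Definition ortho (m : nat) (e : nat -> V) x :=
  forall i, (i < m)%N -> ip x (e i) = 0.

Definition oproj (m : nat) (e : nat -> V) x :=
  \sum_(i < m) ip x (e i) *: e i.

Lemma ip_sum_orthonormal m e (c : 'I_m -> R) j (jm : (j < m)%N) :
  orthonormal m e -> ip (\sum_(i < m) c i *: e i) (e j) = c (Ordinal jm).
Proof.
move=> oe; rewrite ip_suml (bigD1 (Ordinal jm))//= big1 ?addr0.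
  by rewrite ipZl oe// eqxx mulr1.
move=> i ij; rewrite ipZl oe//.
by rewrite (_ : (i == j :> nat) = false) ?mulr0//; apply/negbTE.
Qed.

Lemma ortho_sub_oproj m e x : orthonormal m e -> ortho m e (x - oproj m e x).
Proof.
by move=> oe i im; rewrite ipBl (ip_sum_orthonormal _ im)//= subrr.
Qed.

Lemma ip_oprojr m e x y : ip x (oproj m e y) = \sum_(i < m) ip x (e i) * ip y (e i).
Proof.
by rewrite ipC ip_suml; apply: eq_bigr => i _; rewrite ipZl mulrC (ipC ip _ x).
Qed.

Lemma ip_ortho_oproj m e x y : ortho m e x -> ip x (oproj m e y) = 0.
Proof. by move=> ox; rewrite ip_oprojr big1// => i _; rewrite ox// mul0r. Qed.

Lemma bessel m e x : orthonormal m e ->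
  \sum_(i < m) ip x (e i) ^+ 2 <= ip x x.
Proof.
move=> oe; have := ip_ge0 ip (x - oproj m e x).
rewrite ipBr ip_ortho_oproj; last exact: ortho_sub_oproj.
rewrite subr0 ipBl (ipC ip _ x) ip_oprojr subr_ge0.
by under eq_bigr do rewrite -expr2.
Qed.

End semi_inner_theory.

(** * Eigenvectors and spectral gap of an abstract kernel operator *)

Lemma cvgn_real_unique (R : realType) (v : nat -> R) (a b : R) :
  v n @[n --> \oo] --> a -> v n @[n --> \oo] --> b -> a = b.
Proof. by move=> va vb; rewrite -(cvg_lim _ va)// -(cvg_lim _ vb). Qed.

Section kernel_operator.
Context {R : realType} {V : lmodType R} (ip : semi_inner V).
Context {d : measure_display} {T : measurableType d} (mu : probability T R).
Variables (K : V -> V) (kappa : T -> V) (B : R).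
(** Symmetry also supplies linearity of K up to null vectors: moving K to the other factor exposes
    sums and scalars. Many rewrites below use [Ksym] back and forth for this purpose. *)
Hypothesis Ksym : forall x y, ip (K x) y = ip x (K y).
(** The abstract form of (K f)(y) = <kappa y, f>: [kappa y] stands for the kernel section k(y, .),
    while V need not consist of functions. *)
Hypothesis Kint : forall f,
  (ip (K f) (K f))%:E = (\int[mu]_y (ip (kappa y) f ^+ 2)%:E)%E.
Hypothesis kappa_le : forall y, ip (kappa y) (kappa y) <= B.
Hypothesis mkappa : forall f, measurable_fun setT (fun y => ip (kappa y) f).
Hypothesis mkappaK : forall n,
  measurable_fun setT (fun y => ip (kappa y) (iter n K (kappa y))).
(** Stands in for completeness of V: only images under K of Cauchy sequences need limits. *)
Hypothesis Kcomplete : forall g : nat -> V,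
  (forall e : R, 0 < e -> exists N, forall n m, (N <= n)%N -> (N <= m)%N ->
     ip (g n - g m) (g n - g m) <= e) ->
  exists G, ip (K (g n) - G) (K (g n) - G) @[n --> \oo] --> (0 : R).

Lemma kappa_bound_ge0 : 0 <= B.
Proof.
have [[y _]|h] := pselect ([set: T] !=set0).
  exact: le_trans (ip_ge0 ip _) (kappa_le y).
have := @probability_setT _ _ _ mu; suff -> : [set: T] = set0.
  by rewrite measure0 => /eqP; rewrite eqe eq_sym oner_eq0.
by rewrite -subset0 => y _; apply: h; exists y.
Qed.

Lemma K_bound f : ip (K f) (K f) <= B * ip f f.
Proof.
rewrite -lee_fin Kint.
apply: (@le_trans _ _ (\int[mu]_y (B * ip f f)%:E)%E).
  apply: ge0_le_integral => //=.
  - by move=> y _; rewrite lee_fin sqr_ge0.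
  - by apply/measurable_EFinP; apply: measurable_funX; exact: mkappa.
  - move=> y _; rewrite lee_fin (le_trans (ip_CS ip _ _))//.
    by rewrite ler_wpM2r// ip_ge0.
by rewrite integral_cst//= probability_setT mule1.
Qed.

Let Kn n := iter n K.

Lemma iterK_sym n x y : ip (Kn n x) y = ip x (Kn n y).
Proof.
elim: n x y => [//|n IH] x y; rewrite /Kn iterS Ksym -/(Kn n x) IH.
by rewrite /Kn -iterSr.
Qed.

Lemma iterK_ip i j x y : ip (Kn i x) (Kn j y) = ip x (Kn (i + j) y).
Proof. by rewrite iterK_sym /Kn -iterD. Qed.

(* Power iteration: with [f_y] the projection of [kappa y] to [W] and [rho] the
   sup of [|K f|^2] over the unit sphere of [W], the sequence
   [|K^n f_y|^2 / rho^n] decreases, to a positive limit for some [y] since its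
   integral stays above [rho].  Then [K^(2n) f_y / rho^n] is Cauchy and its
   image under [K] converges to an eigenvector of [K^2]. *)
Section complement.
Variables (m : nat) (e : nat -> V) (u : nat -> R).
Hypothesis oe : orthonormal ip m e.
Hypothesis Ke : forall i, (i < m)%N -> ipeq ip (K (e i)) (u i *: e i).

Lemma ortho_K f : ortho ip m e f -> ortho ip m e (K f).
Proof. by move=> of_ i im; rewrite Ksym ipC Ke// ipZl ipC of_// mulr0. Qed.

Lemma ortho_iterK n f : ortho ip m e f -> ortho ip m e (Kn n f).
Proof. by move=> of_; elim: n => [//|n IH]; rewrite /Kn iterS; exact: ortho_K. Qed.

Let W := ortho ip m e.
Let q f := ip (K f) (K f).
Let c n f := ip (Kn n f) (Kn n f).

Let unitq := [set r | exists2 f, W f /\ ip f f = 1 & r = q f].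
Let rho := sup unitq.

Hypothesis W_nontriv : exists2 f, W f & 0 < q f.

Let WZ a f : W f -> W (a *: f).
Proof. by move=> Wf i im; rewrite ipZl Wf// mulr0. Qed.

Let qZ a f : q (a *: f) = a ^+ 2 * q f.
Proof.
rewrite /q Ksym ipZl -Ksym ipC Ksym ipZl -Ksym -/(q f).
by rewrite mulrA expr2.
Qed.

Let has_sup_unitq : has_sup unitq.
Proof.
split; last first.
  exists B => _ [f [_ f1] ->]; rewrite (le_trans (K_bound f))// f1; lra.
have [f Wf qf] := W_nontriv.
have f0 : 0 < ip f f.
  rewrite lt_neqAle ip_ge0 andbT eq_sym; apply/negP => /eqP f0.
  by have := lt_le_trans qf (K_bound f); rewrite f0 mulr0 ltxx.
exists (q ((ipnorm ip f)^-1 *: f)), ((ipnorm ip f)^-1 *: f) => //; split.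
  exact: WZ.
rewrite ipZl ipZr -sqr_ipnorm mulrA -expr2 exprVn mulVf//.
by rewrite sqrf_eq0 sqrtr_eq0 -ltNge.
Qed.

Let q_le f : W f -> q f <= rho * ip f f.
Proof.
move=> Wf; have := ip_ge0 ip f; rewrite le_eqVlt => /orP[/eqP f0|f0].
  by rewrite -f0 mulr0; apply: le_trans (K_bound f) _; rewrite -f0 mulr0.
have n0 : ipnorm ip f ^+ 2 != 0 by rewrite sqr_ipnorm gt_eqF.
have -> : q f = ipnorm ip f ^+ 2 * q ((ipnorm ip f)^-1 *: f).
  by rewrite qZ mulrA exprVn mulfV// mul1r.
rewrite sqr_ipnorm mulrC ler_wpM2r// ?ip_ge0//.
apply: sup_upper_bound => //; exists ((ipnorm ip f)^-1 *: f) => //; split.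
  exact: WZ.
by rewrite ipZl ipZr -sqr_ipnorm mulrA -expr2 exprVn mulVf.
Qed.

Let rho_gt0 : 0 < rho.
Proof.
have [f Wf qf] := W_nontriv.
have := lt_le_trans qf (q_le Wf).
by apply: contraTT; rewrite -!leNgt => r0; rewrite mulr_le0_ge0// ip_ge0.
Qed.

Let cS n f : W f -> c n.+1 f <= rho * c n f.
Proof. by move=> Wf; apply: q_le; exact: ortho_iterK. Qed.

(** The sequence c is log-convex: Cauchy-Schwarz for K^k f and K^(k+2) f gives c_(k+1)^2 <= c_k
    c_(k+2). So the ratios c_(k+1) / c_k never fall below the first one, which is q f. *)
Let c_ge n f : ip f f = 1 -> q f ^+ n <= c n f.
Proof.
move=> f1; have c0 : 0 <= q f by exact: ip_ge0.
suff H k : q f * c k f <= c k.+1 f.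
  elim: n => [|n IH]; first by rewrite expr0 /c /= f1.
  by rewrite exprS (le_trans _ (H n))// ler_wpM2l.
have cge k' : 0 <= c k' f by exact: ip_ge0.
elim: k => [|k IH]; first by rewrite /c /= f1 mulr1.
have CS : c k.+1 f ^+ 2 <= c k f * c k.+2 f.
  have := ip_CS ip (Kn k f) (Kn k.+2 f).
  by rewrite iterK_ip addnS -addSn -iterK_ip.
have := cge k.+1; rewrite le_eqVlt => /orP[/eqP <-|ck]; first by rewrite mulr0.
have := cge k; rewrite le_eqVlt => /orP[/eqP k0|k0].
  by have := exprn_gt0 2 ck; rewrite ltNge (le_trans CS)// -k0 mul0r.
rewrite -(ler_pM2l k0); apply: le_trans CS.
by rewrite expr2 mulrA ler_wpM2r// mulrC.
Qed.

Let fy y := kappa y - oproj ip m e (kappa y).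
Let Wfy y : W (fy y). Proof. exact: ortho_sub_oproj. Qed.

Let fyE f y : W f -> ip (kappa y) f = ip (fy y) f.
Proof. by move=> Wf; rewrite ipBl (ipC ip (oproj _ _ _ _)) ip_ortho_oproj// subr0. Qed.

Let fy_le y : ip (fy y) (fy y) <= B.
Proof.
rewrite {2}/fy ipBr ip_ortho_oproj ?subr0; last exact: Wfy.
rewrite ipBl (ipC ip (oproj _ _ _ _)) ip_oprojr (le_trans _ (kappa_le y))//.
by rewrite gerBl sumr_ge0// => i _; rewrite -expr2 sqr_ge0.
Qed.

Let iterK_e n i : (i < m)%N -> ipeq ip (Kn n (e i)) (u i ^+ n *: e i).
Proof.
move=> im; elim: n => [z|n IH z]; first by rewrite expr0 scale1r.
rewrite /Kn iterS Ksym IH ipZl -Ksym Ke// !ipZl exprS; ring.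
Qed.

(** K^(2n) preserves W, so |K^n f_y|^2 = <kappa y, K^(2n) f_y>. Expanding f_y leaves <kappa y,
    K^(2n) kappa y>, measurable by [mkappaK], minus finitely many terms u_i^(2n) <kappa y,
    e_i>^2. *)
Let mc n : measurable_fun setT (fun y => c n (fy y)).
Proof.
have -> : (fun y => c n (fy y)) = (fun y =>
  ip (kappa y) (Kn (n + n) (kappa y)) -
  \sum_(i < m) u i ^+ (n + n) * ip (kappa y) (e i) ^+ 2).
  apply/funext => y; rewrite /c iterK_ip.
  rewrite -fyE; last exact/ortho_iterK/Wfy.
  rewrite -iterK_sym {1}/fy ipBr; congr (_ - _).
    by rewrite iterK_sym.
  rewrite ip_oprojr; apply: eq_bigr => i _.
  by rewrite iterK_sym ipC iterK_e// ipZl expr2 mulrA (ipC ip (e i)).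
apply: measurable_funB; first exact: mkappaK.
apply: measurable_sum => i; apply: measurable_funM => //.
by apply: measurable_funX; exact: mkappa.
Qed.

Let a n y := c n (fy y) / rho ^+ n.

Let a_ge0 n y : 0 <= a n y.
Proof. by rewrite divr_ge0 ?ip_ge0// exprn_ge0// ltW. Qed.

Let aS n y : a n.+1 y <= a n y.
Proof.
rewrite /a ler_pdivrMr ?exprn_gt0// exprS mulrCA divfK; last first.
  by rewrite expf_eq0 gt_eqF// andbF.
by rewrite cS//; exact: Wfy.
Qed.

Let a_noninc y : nonincreasing_seq (a ^~ y).
Proof. by apply/nonincreasing_seqP => n; exact: aS. Qed.

Let a_le n y : a n y <= B.
Proof.
apply: le_trans (a_noninc y (leq0n n)) _.
by rewrite /a expr0 divr1 /c /= fy_le.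
Qed.

(** For a unit vector f of W, |K^(n+1) f|^2 is the integral of <kappa y, K^n f>^2 = <K^n f_y, f>^2,
    hence at most that of |K^n f_y|^2; by [c_ge] it is at least (q f)^(n+1). Then q f approaches
    rho. *)
Let int_c n : ((rho ^+ n.+1)%:E <= \int[mu]_y (c n (fy y))%:E)%E.
Proof.
have ifin : (\int[mu]_y (c n (fy y))%:E \is a fin_num)%E.
  rewrite ge0_fin_numE; last by apply: integral_ge0 => y _; rewrite lee_fin ip_ge0.
  apply: (@le_lt_trans _ _ (\int[mu]_y (rho ^+ n * B)%:E)%E); last first.
    by rewrite integral_cst//= probability_setT mule1 ltry.
  apply: ge0_le_integral => //=.
  - by move=> y _; rewrite lee_fin ip_ge0.
  - by apply/measurable_EFinP; exact: mc.
  - move=> y _; rewrite lee_fin -ler_pdivrMl ?exprn_gt0// mulrC.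
    exact: a_le.
rewrite -(fineK ifin) lee_fin leNgt; apply/negP => hlt.
(* Continuity of r^(n+1) carries the assumed strict inequality from rho to q f for some unit f of
   W. *)
have [e' e0 he] : exists2 e', 0 < e' & forall r, `|rho - r| < e' ->
    fine (\int[mu]_y (c n (fy y))%:E) < r ^+ n.+1.
  have : \forall r \near rho, fine (\int[mu]_y (c n (fy y))%:E) < r ^+ n.+1.
    have /cvgr_gt := @exprn_continuous R n.+1 rho.
    exact.
  by move=> /nbhs_ballP[e' /= e0 he]; exists e' => // r hr; exact: he.
have [_ [f [Wf f1] ->] hr] := sup_adherent e0 has_sup_unitq.
have qr : q f <= rho by have := q_le Wf; rewrite f1 mulr1.
have : fine (\int[mu]_y (c n (fy y))%:E) < q f ^+ n.+1.
  by apply: he; rewrite ger0_norm ?subr_ge0// ltrBlDr -ltrBlDl.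
apply/negP; rewrite -leNgt -lee_fin fineK//.
apply: (@le_trans _ _ (c n.+1 f)%:E); first by rewrite lee_fin c_ge.
rewrite /c /Kn iterS Kint; apply: ge0_le_integral => //=.
- by move=> y _; rewrite lee_fin sqr_ge0.
- by apply/measurable_EFinP; apply: measurable_funX; exact: mkappa.
- by apply/measurable_EFinP; exact: mc.
- move=> y _; rewrite lee_fin fyE; last exact: ortho_iterK.
  rewrite -(iterK_sym n) (le_trans (ip_CS ip _ _))// f1 mulr1.
  exact: lexx.
Qed.

Let exists_mode : exists y, exists2 l : R, 0 < l & a n y @[n --> \oo] --> l.
Proof.
have acvg y : cvg (a n y @[n --> \oo]).
  apply: nonincreasing_is_cvgn; first exact: a_noninc.
  by exists 0 => _ [n _ <-]; exact: a_ge0.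
have lim_ge0 y : 0 <= limn (a ^~ y).
  by apply: limr_ge => //; apply: nearW => n; exact: a_ge0.
apply: contrapT => hno.
have a0 y : a n y @[n --> \oo] --> (0 : R).
  suff <- : limn (a ^~ y) = 0 by exact: acvg.
  apply/eqP/negPn/negP => l0; apply: hno; exists y, (limn (a ^~ y)).
    by rewrite lt_neqAle eq_sym l0 lim_ge0.
  exact: acvg.
have : (\int[mu]_y (a n y)%:E @[n --> \oo] --> \int[mu]_y (cst 0%E y))%E.
  apply: (@dominated_cvg _ _ _ mu setT measurableT
    (fun n y => (a n y)%:E) (cst 0%E) (cst B%:E)) => //=.
  - move=> n; apply/measurable_EFinP.
    by apply: measurable_funM; [exact: mc|exact: measurable_cst].
  - move=> y _; apply/fine_cvgP; by split; [by apply: nearW|exact: a0].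
  - by apply: finite_measure_integrable_cst.
  - by move=> n y _; rewrite lee_fin ger0_norm ?a_ge0// a_le.
rewrite integral_cst//= mul0e => hc.
have : (rho%:E <= 0)%E.
  apply: (cvge_to_ge hc); apply: nearW => n.
  rewrite (_ : rho = (rho ^+ n)^-1 * rho ^+ n.+1); last first.
    by rewrite exprSr mulrA mulVf ?mul1r// expf_eq0 gt_eqF// andbF.
  rewrite EFinM; apply: (@le_trans _ _
    ((rho ^+ n)^-1%:E * \int[mu]_y (c n (fy y))%:E)%E).
    by rewrite lee_wpmul2l ?int_c// lee_fin invr_ge0 exprn_ge0// ltW.
  rewrite -ge0_integralZl//=.
  - by under eq_integral do rewrite -EFinM mulrC.
  - by apply/measurable_EFinP; exact: mc.
  - by move=> y _; rewrite lee_fin ip_ge0.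
  - by rewrite lee_fin invr_ge0 exprn_ge0// ltW.
by rewrite lee_fin leNgt rho_gt0.
Qed.

Lemma exists_eigenvector : exists x v,
  [/\ ortho ip m e x, ip x x = 1, ipeq ip (K x) (v *: x), 0 < v ^+ 2 &
      forall f, ortho ip m e f -> ip (K f) (K f) <= v ^+ 2 * ip f f].
Proof.
have [y [l l0 al]] := exists_mode.
pose g n := (rho ^+ n)^-1 *: Kn (n + n) (fy y).
have r0 n : rho ^+ n != 0 by rewrite expf_eq0 gt_eqF// andbF.
have E n : rho * (rho ^+ n.+1)^-1 = (rho ^+ n)^-1.
  by apply: (mulIf (r0 n.+1)); rewrite mulfVK// exprS mulrCA mulVf ?mulr1.
(* The Gram matrix of g depends on i + j only, so |g n - g k|^2 = a (2n) + a (2k) - 2 a (n + k).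
   These are four deviations from l, whence eps / 4 below. *)
have gg i j : ip (g i) (g j) = a (i + j) y.
  rewrite ipZl ipZr iterK_ip addnACA -iterK_ip -/(c _ _) /a exprD invfM.
  ring.
have gcauchy eps : 0 < eps -> exists N, forall n k, (N <= n)%N -> (N <= k)%N ->
    ip (g n - g k) (g n - g k) <= eps.
  move=> eps0; have e2 : 0 < eps / 4 by rewrite divr_gt0.
  move/cvgrPdist_le : al => /(_ _ e2)[N _ hN]; exists N => n k Nn Nk.
  rewrite !(ipBl, ipBr) !gg (addnC k n).
  have h i : (N <= i)%N -> l - a i y <= eps / 4 /\ a i y - l <= eps / 4.
    by move=> /hN /=; rewrite ler_norml => /andP[h1 h2]; split; lra.
  have [h1 h2] := h _ (leq_trans Nn (leq_addr n n)).
  have [h3 h4] := h _ (leq_trans Nk (leq_addr k k)).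
  have [h5 h6] := h _ (leq_trans Nn (leq_addr k n)).
  lra.
have [G GG] := Kcomplete gcauchy.
(* The shift K^2 (g n) = rho g (n + 1) becomes K^2 G = rho G in the limit. *)
have KGG z : ip (K (K G)) z = rho * ip G z.
  rewrite Ksym Ksym.
  apply: (@cvgn_real_unique _ (fun n => ip (K (g n)) (K (K z)))).
    exact: cvg_ipl.
  have -> : (fun n => ip (K (g n)) (K (K z))) =
     (fun n => rho * ip (K (g n.+1)) z).
    apply/funext => n; rewrite Ksym ipZl -2!Ksym [in RHS]Ksym ipZl -Ksym.
    rewrite mulrA E addSn addnS /Kn !iterS.
    by rewrite -!Ksym.
  apply: cvgMr.
  by rewrite (cvg_shiftS (fun n => ip (K (g n)) z)); exact: cvg_ipl.
have WG : W G.
  move=> i im; apply: (@cvgn_real_unique _ (fun n => ip (K (g n)) (e i))).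
    exact: cvg_ipl.
  rewrite (_ : (fun _ => _) = cst 0); first exact: cvg_cst.
  by apply/funext => n; apply: ortho_K => //; apply: WZ; apply: ortho_iterK; exact: Wfy.
(* |K (g n)|^2 = rho a (2n + 1) tends to rho l, which is positive. *)
have Gpos : 0 < ip G G.
  have h1 := cvg_ip_sqr GG.
  suff h2 : ip (K (g n)) (K (g n)) @[n --> \oo] --> rho * l.
    by rewrite (cvgn_real_unique h1 h2)// mulr_gt0.
  have -> : (fun n => ip (K (g n)) (K (g n))) = (fun n => rho * a (n + n).+1 y).
    apply/funext => n; rewrite -/(q _) qZ /q -/(Kn (n + n).+1 (fy y)) -/(c _ _) /a.
    by rewrite [in RHS]mulrCA E exprD invfM -expr2 mulrC.
  apply: cvgMr; have := al; rewrite -(cvg_shiftS (a ^~ y)) => al'.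
  apply: (cvg_comp (fun n => n + n)%N _ _ al').
  move=> A [N _ NA]; exists N => // n Nn; apply: NA => /=.
  exact: leq_trans Nn (leq_addr _ _).
have [s s0 s2] : exists2 s, 0 < s & s ^+ 2 = rho.
  by exists (Num.sqrt rho); rewrite ?sqrtr_gt0// sqr_sqrtr// ltW.
have finish x v : W x -> 0 < ip x x -> v ^+ 2 = rho -> ipeq ip (K x) (v *: x) ->
    exists x v, [/\ ortho ip m e x, ip x x = 1, ipeq ip (K x) (v *: x), 0 < v ^+ 2 &
      forall f, ortho ip m e f -> ip (K f) (K f) <= v ^+ 2 * ip f f].
  move=> Wx x0 v2 Kx; exists ((ipnorm ip x)^-1 *: x), v; split.
  - exact: WZ.
  - rewrite ipZl ipZr -sqr_ipnorm mulrA -expr2 exprVn mulVf//.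
    by rewrite sqrf_eq0 sqrtr_eq0 -ltNge.
  - by move=> z; rewrite Ksym [in LHS]ipZl -Ksym Kx !ipZl; ring.
  - by rewrite v2.
  - by rewrite v2; exact: q_le.
(* Factor K^2 - rho = (K - t)(K + t) with t = s or t = - s. The vectors s G + K G and - s G + K G
   differ by 2 s G, so they are not both null, and one of them is an eigenvector. *)
have sG t : t ^+ 2 = rho -> ipeq ip (K (t *: G + K G)) (t *: (t *: G + K G)).
  move=> t2 z; rewrite Ksym [in LHS]ipDl [in LHS]ipZl -!Ksym KGG -t2 ipZl ipDl ipZl; ring.
have Wt t : W (t *: G + K G).
  by move=> i im; rewrite ipDl ipZl WG// ortho_K// mulr0 addr0.
have [h|h] := ltP 0 (ip (s *: G + K G) (s *: G + K G)).
  exact: (finish _ s (Wt s) h s2 (sG _ s2)).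
apply: (finish _ (- s) (Wt (- s))); rewrite ?sqrrN//; last by apply: sG; rewrite sqrrN.
rewrite lt_neqAle ip_ge0 andbT eq_sym; apply/negP => /eqP h0.
have h1 : ip (s *: G + K G) (s *: G + K G) = 0.
  by apply/eqP; rewrite eq_le h ip_ge0.
have := ip_null G h1; have := ip_null G h0; rewrite !(ipDl, ipZl) => H1 H2.
have : s * ip G G = 0 by lra.
by apply/eqP; rewrite gt_eqF// mulr_gt0.
Qed.

End complement.

(** * Splitting off eigenvectors, and the gap inequality *)

Lemma K_scale_sum m e (c u : nat -> R) z :
  (forall i, (i < m)%N -> ipeq ip (K (e i)) (u i *: e i)) ->
  ip (K (\sum_(i < m) c i *: e i)) z = ip (\sum_(i < m) (c i * u i) *: e i) z.
Proof.
move=> Ke; rewrite Ksym !ip_suml; apply: eq_bigr => i _.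
by rewrite !ipZl -Ksym Ke// ipZl mulrA.
Qed.

(** The Hilbert-Schmidt bound: u_i^2 = |K e_i|^2 is the integral of <kappa y, e_i>^2, and Bessel's
    inequality for [kappa y] bounds the sum of the integrands by B. *)
Lemma sum_eigenvalue_sqr m e u : orthonormal ip m e ->
  (forall i, (i < m)%N -> ipeq ip (K (e i)) (u i *: e i)) ->
  \sum_(i < m) u i ^+ 2 <= B.
Proof.
move=> oe Ke; rewrite -lee_fin -sumEFin.
have -> : (\sum_(i < m) (u i ^+ 2)%:E =
    \sum_(i < m) \int[mu]_y (ip (kappa y) (e i) ^+ 2)%:E)%E.
  apply: eq_bigr => i _; rewrite -Kint; congr EFin.
  by rewrite Ke// ipZl ipC Ke// ipZl oe// eqxx mulr1 expr2.
rewrite -ge0_integral_sum//=; last 2 first.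
- by move=> i; apply/measurable_EFinP; apply: measurable_funX; exact: mkappa.
- by move=> i y _; rewrite lee_fin sqr_ge0.
apply: (@le_trans _ _ (\int[mu]_y B%:E)%E).
  apply: ge0_le_integral => //=.
  - by move=> y _; apply: sume_ge0 => i _; rewrite lee_fin sqr_ge0.
  - apply: emeasurable_sum => i.
    by apply/measurable_EFinP; apply: measurable_funX; exact: mkappa.
  - move=> y _; rewrite sumEFin lee_fin (le_trans (bessel (kappa y) oe))//.
by rewrite integral_cst//= probability_setT mule1.
Qed.

(** While some f in the complement has |K f|^2 > eta |f|^2, [exists_eigenvector] yields one more
    eigenvector. Its v^2 is maximal on the complement, hence at least eta; this is the count that
    the next lemma exploits. *)
Lemma eigenfamily_extension m e u (eta : R) N : 0 < eta -> orthonormal ip m e ->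
  (forall i, (i < m)%N -> ipeq ip (K (e i)) (u i *: e i)) ->
  exists k e' u', [/\ (m <= k)%N, orthonormal ip k e',
    forall i, (i < k)%N -> ipeq ip (K (e' i)) (u' i *: e' i),
    forall i, (i < m)%N -> e' i = e i &
    (k = (m + N)%N /\ forall i, (m <= i < k)%N -> eta <= u' i ^+ 2) \/
    forall f, ortho ip k e' f -> ip (K f) (K f) <= eta * ip f f].
Proof.
move=> eta0 oe Ke; elim: N => [|N [k [e' [u' [mk oe' Ke' e'e [[kN ue]|h]]]]]].
- exists m, e, u; split => //; left; rewrite addn0; split => // i.
  by case/andP => mi /(leq_ltn_trans mi); rewrite ltnn.
- have [h|] := pselect (forall f, ortho ip k e' f -> ip (K f) (K f) <= eta * ip f f).
    by exists k, e', u'; split => //; right.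
  move=> /existsNP[f /not_implyP[of_ /negP]]; rewrite -ltNge => hf.
  have qf : 0 < ip (K f) (K f).
    by apply: le_lt_trans hf; rewrite mulr_ge0 ?ip_ge0// ltW.
  have [x [v [ox x1 Kx v0 vmax]]] := exists_eigenvector oe' Ke' (ex_intro2 _ _ f of_ qf).
  pose e2 i := if i == k then x else e' i.
  pose u2 i := if i == k then v else u' i.
  have lt_or i : (i < k.+1)%N -> i = k \/ (i < k)%N /\ (i == k) = false.
    rewrite ltnS leq_eqVlt => /orP[/eqP ->|ik]; first by left.
    by right; rewrite ltn_eqF.
  exists k.+1, e2, u2; split.
  + exact: leqW.
  + move=> i j /lt_or[->|[ik ik']] /lt_or[->|[jk jk']]; rewrite /e2 ?eqxx ?ik' ?jk'//.
    * by rewrite ox// eq_sym jk'.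
    * by rewrite ipC ox.
    * exact: oe'.
  + move=> i /lt_or[->|[ik ik']]; rewrite /e2 /u2 ?eqxx ?ik'//.
    exact: Ke'.
  + by move=> i im; rewrite /e2 ltn_eqF ?e'e// (leq_trans im mk).
  + left; rewrite kN addnS; split=> // i /andP[mi].
    rewrite -kN => /lt_or[->|[ik ik']]; rewrite /u2 ?eqxx ?ik'; last first.
      by apply: ue; rewrite mi.
    have f0 : 0 < ip f f.
      rewrite lt_neqAle ip_ge0 andbT eq_sym; apply/negP => /eqP f0.
      by have := lt_le_trans qf (K_bound f); rewrite f0 mulr0 ltxx.
    by rewrite -(ler_pM2r f0); apply: ltW; apply: lt_le_trans hf _; exact: vmax.
- by exists k, e', u'; split => //; right.
Qed.

Lemma eigenfamily_complete m e u (eta : R) : 0 < eta -> orthonormal ip m e ->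
  (forall i, (i < m)%N -> ipeq ip (K (e i)) (u i *: e i)) ->
  exists k e' u', [/\ (m <= k)%N, orthonormal ip k e',
    forall i, (i < k)%N -> ipeq ip (K (e' i)) (u' i *: e' i),
    forall i, (i < m)%N -> e' i = e i &
    forall f, ortho ip k e' f -> ip (K f) (K f) <= eta * ip f f].
Proof.
move=> eta0 oe Ke.
(* N exceeds B / eta, so N further eigenvalues with squares at least eta would violate
   [sum_eigenvalue_sqr]. *)
have /archimedean.Num.Theory.archi_boundP := divr_ge0 kappa_bound_ge0 (ltW eta0).
set N := (X in _ < X%:R) => hN.
have [k [e' [u' [mk oe' Ke' e'e [[kN ue]|h]]]]] := eigenfamily_extension N eta0 oe Ke;
  last by exists k, e', u'; split.
exfalso; have := sum_eigenvalue_sqr oe' Ke'; apply/negP; rewrite -ltNge.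
move: hN; rewrite ltr_pdivrMr// => /lt_le_trans; apply.
rewrite mulr_natl kN big_split_ord/= -[leLHS]add0r lerD//.
  by apply: sumr_ge0 => i _; exact: sqr_ge0.
rewrite -[X in _ *+ X](card_ord N) -sumr_const ler_sum// => i _.
by apply: ue; rewrite leq_addr kN ltn_add2l/=.
Qed.

(* Eigenvectors are split off until [|K f|^2 <= eta^2 |f|^2] on the complement,
   which happens after finitely many steps by Bessel's inequality; then [eta]
   tends to 0. *)
Lemma spectral_gap m e u (nu gamma : R) : 0 < nu -> 0 <= gamma ->
  orthonormal ip m e ->
  (forall i, (i < m)%N -> ipeq ip (K (e i)) (u i *: e i)) ->
  (forall x v, ip x x = 1 -> ortho ip m e x -> ipeq ip (K x) (v *: x) ->
     0 <= v /\ gamma <= `|v - nu|) ->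
  forall f, ortho ip m e f ->
    gamma ^+ 2 * ip f f <= ip (K f - nu *: f) (K f - nu *: f).
Proof.
move=> nu0 gam0 oe Ke P f of_.
suff H eta : 0 < eta -> eta < nu ->
    (gamma ^+ 2 - 2 * nu * eta) * ip f f <= ip (K f - nu *: f) (K f - nu *: f).
  apply/ler_addgt0Pr => eps eps0.
  have den : 0 < 2 * nu * (ip f f + 1).
    by rewrite mulr_gt0 ?mulr_gt0// ltr_wpDl// ip_ge0.
  (* The second entry makes the loss 2 nu eta |f|^2 at most eps; the + 1 covers null f. *)
  pose eta := Num.min (nu / 2) (eps / (2 * nu * (ip f f + 1))).
  have eta0 : 0 < eta by rewrite lt_min !divr_gt0.
  have etanu : eta < nu by rewrite gt_min; apply/orP; left; lra.
  have := H _ eta0 etanu; rewrite mulrBl lerBlDr => /le_trans; apply.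
  rewrite lerD2l (@le_trans _ _ (2 * nu * eta * (ip f f + 1)))//.
    by rewrite ler_wpM2l ?lerDl// !mulr_ge0// ltW.
  have : eta <= eps / (2 * nu * (ip f f + 1)) by rewrite ge_min lexx orbT.
  by rewrite ler_pdivlMr//; apply: le_trans; rewrite le_eqVlt; apply/orP; left; apply/eqP; ring.
move=> eta0 etanu.
have [k [e' [u' [mk oe' Ke' e'e small]]]] :=
  eigenfamily_complete (exprn_gt0 2 eta0) oe Ke.
pose c (i : nat) := ip f (e' i).
pose p := oproj ip k e' f.
pose r := f - p.
have or : ortho ip k e' r by exact: ortho_sub_oproj.
pose Q := \sum_(i < k) (c i * (u' i - nu)) *: e' i.
have Dp z : ip (K p - nu *: p) z = ip Q z.
  rewrite ipBl (K_scale_sum c z Ke') ipZl !ip_suml mulr_sumr -sumrB.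
  by apply: eq_bigr => i _; rewrite !ipZl -/(c i); ring.
have DfE z : ip (K f - nu *: f) z = ip (Q + (K r - nu *: r)) z.
  have KrE : ip (K r) z = ip (K f) z - ip (K p) z by rewrite Ksym ipBl -!Ksym.
  have rE : ip r z = ip f z - ip p z by rewrite ipBl.
  rewrite [in RHS]ipDl -Dp; move: (K r) (K p) KrE => Kr Kp KrE.
  rewrite ![ip (_ - _) z]ipBl !ipZl KrE rE; ring.
have Qr : ip Q (K r - nu *: r) = 0.
  rewrite /Q ip_suml big1// => i _; rewrite ipZl ipBr ipZr (ipC ip _ r) or//.
  by rewrite ipC (ortho_K Ke' or)// mulr0 subr0 mulr0.
(* For i < m the coefficient vanishes because f is orthogonal to the given family; the later e' i
   are orthogonal to it too, so P applies to them. *)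
have gi i : (i < k)%N -> c i ^+ 2 * gamma ^+ 2 <= c i ^+ 2 * (u' i - nu) ^+ 2.
  move=> ik; have [im|mi] := ltnP i m.
    by rewrite /c e'e// of_// expr0n/= !mul0r.
  rewrite ler_wpM2l ?sqr_ge0// -(@real_normK _ (u' i - nu)) ?num_real//.
  rewrite ler_sqr ?nnegrE//.
  apply: (P (e' i) (u' i) _ _ (Ke' _ ik)).2; first by rewrite oe'// eqxx.
  move=> j jm; rewrite -(e'e _ jm) oe'//; last exact: leq_trans mk.
  by rewrite gtn_eqF// (leq_trans jm mi).
rewrite DfE ipC DfE ipDl [ip Q _]ipDr [ip (K r - _) _]ipDr Qr (ipC ip _ Q) Qr addr0 add0r.
have QQ : ip Q Q = \sum_(i < k) c i ^+ 2 * (u' i - nu) ^+ 2.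
  rewrite {1}/Q ip_suml; apply: eq_bigr => i _.
  rewrite ipZl ipC (ip_sum_orthonormal _ (ltn_ord i) oe')/=; ring.
have ffE : ip f f = \sum_(i < k) c i ^+ 2 + ip r r.
  have <- : ip f p = \sum_(i < k) c i ^+ 2.
    by rewrite ip_oprojr; apply: eq_bigr => i _; rewrite expr2.
  rewrite {2}/r ipBr (ip_ortho_oproj _ or) subr0 /r ipBl (ipC ip p f).
  by rewrite addrC subrK.
have Qge : gamma ^+ 2 * \sum_(i < k) c i ^+ 2 <= ip Q Q.
  by rewrite QQ mulr_sumr ler_sum// => i _; rewrite mulrC gi.
have cge : 0 <= \sum_(i < k) c i ^+ 2 by apply: sumr_ge0 => i _; exact: sqr_ge0.
suff rge : (gamma ^+ 2 - 2 * nu * eta) * ip r r <= ip (K r - nu *: r) (K r - nu *: r).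
  rewrite ffE mulrDr lerD// (le_trans _ Qge)// ler_wpM2r// gerBl.
  by rewrite !mulr_ge0// ltW.
clear Dp DfE Qr ffE; clearbody r.
have orm x : ortho ip k e' x -> ortho ip m e x.
  by move=> ox i im; rewrite -(e'e _ im) ox// (leq_trans im mk).
have := ip_ge0 ip r; rewrite le_eqVlt => /orP[/eqP <-|r0].
  by rewrite mulr0 ip_ge0.
(* Here the nonnegativity of eigenvalues enters. If K is not zero on the complement, it has an
   eigenvalue v there with 0 <= v <= eta < nu, and gamma <= |v - nu| <= nu. If it is zero, the
   normalized r is an eigenvector for 0, and gamma <= |0 - nu|. *)
have gamnu : gamma <= nu.
  have [[x ox Kx]|noK] := pselect (exists2 x, ortho ip k e' x & 0 < ip (K x) (K x)).
    have [y [v [oy y1 Ky v0 vmax]]] := exists_eigenvector oe' Ke' (ex_intro2 _ _ x ox Kx).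
    have [vge gv] := P _ _ y1 (orm _ oy) Ky.
    have veta : v <= eta.
      rewrite -ler_sqr ?nnegrE ?(ltW eta0)//.
      have := small _ oy; rewrite y1 mulr1; apply: le_trans.
      by rewrite Ky ipZl ipC Ky ipZl y1 mulr1 expr2.
    by apply: le_trans gv _; rewrite ler_norml; apply/andP; split; lra.
  pose y := (ipnorm ip r)^-1 *: r.
  have y1 : ip y y = 1.
    rewrite ipZl ipZr -sqr_ipnorm mulrA -expr2 exprVn mulVf//.
    by rewrite sqrf_eq0 sqrtr_eq0 -ltNge.
  have oy : ortho ip k e' y by move=> i ik; rewrite ipZl or// mulr0.
  have Ky : ipeq ip (K y) (0 *: y).
    move=> z; rewrite ipZl mul0r; apply: ip_null; apply/eqP.
    rewrite eq_le ip_ge0 andbT leNgt; apply/negP => h; apply: noK; exists y => //.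
  have [_] := P _ _ y1 (orm _ oy) Ky.
  by rewrite sub0r normrN gtr0_norm.
have Kr := small _ or.
(* Expand |K r - eta r|^2 >= 0 and use |K r| <= eta |r|. In |K r - nu r|^2 the cross term then costs
   at most 2 nu eta |r|^2, while nu^2 >= gamma^2. *)
have Krr : ip (K r) r <= eta * ip r r.
  have := ip_ge0 ip (K r - eta *: r).
  rewrite !(ipBl, ipBr, ipZl, ipZr) (ipC ip r) => h.
  rewrite -(ler_pM2l eta0); move: h Kr; rewrite expr2 -mulrA; lra.
rewrite !(ipBl, ipBr, ipZl, ipZr) (ipC ip r).
have h1 : nu * ip (K r) r <= nu * (eta * ip r r) by rewrite ler_pM2l.
have h2 : gamma ^+ 2 * ip r r <= nu ^+ 2 * ip r r.
  by rewrite ler_wpM2r ?ip_ge0// ler_sqr ?nnegrE ?(ltW nu0).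
have h3 := ip_ge0 ip (K r).
move: h1 h2; rewrite expr2 (expr2 nu); lra.
Qed.
End kernel_operator.

(** * Real square-integrable functions *)

Section square_integrable.
Context {d : measure_display} {T : measurableType d} {R : realType}.
Variable mu : probability T R.
Local Notation intg f := (mu.-integrable setT (EFin \o f)).
Implicit Types f g : T -> R.

Lemma EFin_integrableZl c f : intg f -> intg (fun x => c * f x).
Proof.
move=> fi; rewrite (_ : _ \o _ = (fun x => c%:E * (EFin \o f) x)%E)//.
exact: integrableZl.
Qed.

Lemma EFin_integrableD f g : intg f -> intg g -> intg (fun x => f x + g x).
Proof.
move=> fi gi; rewrite (_ : _ \o _ = ((EFin \o f) \+ (EFin \o g))%E)//.
exact: integrableD.
Qed.

Definition sqint : {pred T -> R} :=
  mem [set f : T -> R | measurable_fun setT f /\ intg (fun x => f x ^+ 2)].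

Lemma sqintP f : (f \in sqint) <->
  (measurable_fun setT f /\ intg (fun x => f x ^+ 2)).
Proof. by rewrite inE. Qed.

Lemma sqint_measurable f : f \in sqint -> measurable_fun setT f.
Proof. by move=> /sqintP[]. Qed.

Lemma integrable_bounded f B : measurable_fun setT f ->
  (forall x, `|f x| <= B) -> intg f.
Proof.
move=> mf fB; apply: (@le_integrable _ _ _ mu setT measurableT _ (cst B%:E)).
- exact/measurable_EFinP.
- by move=> x _ /=; rewrite lee_fin (le_trans (fB x))// ler_norm.
- exact: finite_measure_integrable_cst.
Qed.

Lemma sqint_mul f g : f \in sqint -> g \in sqint -> intg (fun x => f x * g x).
Proof.
move=> /sqintP[mf f2] /sqintP[mg g2].
apply: (@le_integrable _ _ _ mu setT measurableT _
  (EFin \o (fun x => f x ^+ 2 + g x ^+ 2))).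
- by apply/measurable_EFinP; exact: measurable_funM.
- move=> x _ /=; rewrite lee_fin normrM [leRHS]ger0_norm ?addr_ge0 ?sqr_ge0//.
  have -> : f x ^+ 2 = `|f x| ^+ 2 by rewrite real_normK ?num_real.
  have -> : g x ^+ 2 = `|g x| ^+ 2 by rewrite real_normK ?num_real.
  have := sqr_ge0 (`|f x| - `|g x|); have := mulr_ge0 (normr_ge0 (f x)) (normr_ge0 (g x)); nra.
- exact: EFin_integrableD.
Qed.

Lemma sqint_bounded f B : measurable_fun setT f ->
  (forall x, `|f x| <= B) -> f \in sqint.
Proof.
move=> mf fB; apply/sqintP; split => //; apply: (@integrable_bounded _ (B ^+ 2)).
  exact: measurable_funX.
move=> x; rewrite normrX ler_sqr ?nnegrE//.
by rewrite (le_trans _ (fB x)).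
Qed.

Lemma sqint_integrable f : f \in sqint -> intg f.
Proof.
move=> fs; have : intg (fun x => f x * cst 1 x).
  apply: sqint_mul => //; apply: (@sqint_bounded _ 1) => // x /=.
  by rewrite normr1.
by congr (integrable _ _ _); apply/funext => x /=; rewrite mulr1.
Qed.

Lemma sqint_submod_closed : submod_closed sqint.
Proof.
split; first by apply: (@sqint_bounded (cst 0) 0) => // x; rewrite normr0.
move=> a f g fs gs; have [mf f2] := (sqintP f).1 fs; have [mg g2] := (sqintP g).1 gs.
apply/sqintP; split.
  by apply: measurable_funD => //; exact: measurable_funM.
rewrite (_ : (fun x => _) = (fun x => a ^+ 2 * f x ^+ 2 +
    (2 * a * (f x * g x) + g x ^+ 2))).
  apply: EFin_integrableD; first exact: EFin_integrableZl.
  by apply: EFin_integrableD => //; apply: EFin_integrableZl; exact: sqint_mul.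
apply/funext => x; rewrite (_ : (a *: f + g) x = a * f x + g x)//; ring.
Qed.

HB.instance Definition _ := GRing.isSubmodClosed.Build R (T -> R) sqint
  sqint_submod_closed.

(* Representatives rather than classes, so [l2prod] is only semidefinite and
   almost everywhere equality is [ipeq l2prod]. *)
Record L2r := MkL2r { l2fun :> T -> R ; l2funP : l2fun \in sqint }.

HB.instance Definition _ := [isSub for l2fun].
HB.instance Definition _ := [Choice of L2r by <:].
HB.instance Definition _ := [SubChoice_isSubLmodule of L2r by <:].

Definition l2ip (f g : L2r) : R := \int[mu]_x (f x * g x).

Let l2ipDl (f g h : L2r) : l2ip (f + g) h = l2ip f h + l2ip g h.
Proof.
rewrite /l2ip -RintegralD//; [|exact: sqint_mul (l2funP _) (l2funP _)..].
by apply: eq_Rintegral => x _; rewrite -mulrDl.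
Qed.

Let l2ipZl c (f h : L2r) : l2ip (c *: f) h = c * l2ip f h.
Proof.
rewrite /l2ip -RintegralZl//; last exact: sqint_mul (l2funP _) (l2funP _).
by apply: eq_Rintegral => x _; rewrite mulrA.
Qed.

Let l2ipC (f g : L2r) : l2ip f g = l2ip g f.
Proof. by apply: eq_Rintegral => x _; rewrite mulrC. Qed.

Let l2ip_ge0 (f : L2r) : 0 <= l2ip f f.
Proof. by apply: Rintegral_ge0 => x _; rewrite -expr2 sqr_ge0. Qed.

Definition l2prod : semi_inner L2r := SemiInner l2ipDl l2ipZl l2ipC l2ip_ge0.

Lemma l2prodE (f g : L2r) : l2prod f g = \int[mu]_x (f x * g x).
Proof. by []. Qed.

Lemma EFin_l2prod (f g : L2r) : (l2prod f g)%:E = (\int[mu]_x (f x * g x)%:E)%E.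
Proof.
rewrite /= /l2ip /Rintegral fineK//.
by apply: integrable_fin_num => //; exact: sqint_mul (l2funP _) (l2funP _).
Qed.

Lemma l2prod_eq0 (f : L2r) : l2prod f f = 0 <-> {ae mu, forall x, f x = 0}.
Proof.
split.
  move=> f0; have := EFin_l2prod f f; rewrite f0 => /esym h.
  have mff : measurable_fun setT (fun x => (f x * f x)%:E).
    by apply/measurable_EFinP; apply: measurable_funM => //; exact: sqint_measurable (l2funP _).
  have := @ae_eq_integral_abs _ _ _ mu setT measurableT _ mff.
  have -> : (\int[mu]_x `|(f x * f x)%:E| = \int[mu]_x (f x * f x)%:E)%E.
    by apply: eq_integral => x _; rewrite gee0_abs// lee_fin -expr2 sqr_ge0.
  move=> [/(_ h) + _]; apply: filterS => x /(_ I) /eqP; rewrite eqe.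
  by rewrite -expr2 sqrf_eq0 => /eqP.
move=> f0; apply/EFin_inj; rewrite EFin_l2prod.
rewrite (ae_eq_integral (cst 0%E)) ?integral0//=.
- by apply/measurable_EFinP; apply: measurable_funM => //; exact: sqint_measurable (l2funP _).
- by apply: filterS f0 => x -> _; rewrite mul0r.
Qed.

Lemma l2_ae (f g : L2r) :
  ipeq l2prod f g <-> {ae mu, forall x, f x = g x}.
Proof.
split.
  move=> fg; have : l2prod (f - g) (f - g) = 0 by rewrite ipBl fg subrr.
  move=> /l2prod_eq0; apply: filterS => x /= /eqP; rewrite subr_eq0.
  by move=> /eqP.
move=> fg h; have h0 : l2prod (f - g) (f - g) = 0.
  by apply/l2prod_eq0; apply: filterS fg => x /= fgx; apply/eqP; rewrite subr_eq0 fgx.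
by apply/eqP; rewrite -subr_eq0 -ipBl ip_null.
Qed.

End square_integrable.

(** * Unitary groups and approximately invariant planes *)

Lemma is_derive1W (R : realType) (f1 f2 : R -> R) (t d1 d2 : R) :
  is_derive t 1 f1 d1 -> f1 =1 f2 -> d1 = d2 -> is_derive t 1 f2 d2.
Proof. by move=> h /funext <- <-. Qed.

Section filter_ip.
Context {R : realType} {V : lmodType R} (ip : semi_inner V).
Context {T : Type} (F : set_system T) {FF : Filter F}.

Lemma cvg_ip (x_ y_ : T -> V) x y :
  ipnorm ip (x_ t - x) @[t --> F] --> (0 : R) ->
  ipnorm ip (y_ t - y) @[t --> F] --> (0 : R) ->
  ip (x_ t) (y_ t) @[t --> F] --> ip x y.
Proof.
move=> hx hy; apply/subr_cvg0.
have h : ipnorm ip (x_ t - x) * ipnorm ip (y_ t - y) +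
   (ipnorm ip (x_ t - x) * ipnorm ip y + ipnorm ip x * ipnorm ip (y_ t - y))
   @[t --> F] --> (0 : R).
  rewrite [X in _ --> X](_ : _ = 0 * 0 + (0 * ipnorm ip y + ipnorm ip x * 0));
    last by rewrite !(mul0r, mulr0) !addr0.
  apply: cvgD; first exact: cvgM.
  by apply: cvgD; [exact: cvgMl|exact: cvgMr].
apply/cvgr0Pnorm_le => e e0; move/cvgr0Pnorm_le : h => /(_ _ e0).
apply: filterS => t; apply: le_trans.
rewrite (_ : ip (x_ t) (y_ t) - ip x y = ip (x_ t - x) (y_ t - y) +
    (ip (x_ t - x) y + ip x (y_ t - y))); last first.
  rewrite !(ipBl, ipBr); ring.
rewrite [leRHS]ger0_norm; last by rewrite !addr_ge0// mulr_ge0 ?ipnorm_ge0.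
rewrite (le_trans (ler_normD _ _))// lerD ?ipnorm_CS//.
by rewrite (le_trans (ler_normD _ _))// lerD ?ipnorm_CS.
Qed.

End filter_ip.

Section generator.
Context {R : realType} {V : lmodType R} (ip : semi_inner V).
Variable U : R -> V -> V.
Hypothesis UD : forall t x y, U t (x + y) = U t x + U t y.
Hypothesis UZ : forall t c x, U t (c *: x) = c *: U t x.
Hypothesis Uip : forall t x y, ip (U t x) (U t y) = ip x y.
Hypothesis Uadd : forall s t x, U (s + t) x = U s (U t x).

Lemma isometryB t x y : U t (x - y) = U t x - U t y.
Proof. by rewrite UD -scaleN1r UZ scaleN1r. Qed.

Lemma isometry_norm t x : ipnorm ip (U t x) = ipnorm ip x.
Proof. by rewrite /ipnorm Uip. Qed.

Definition is_generator (x x' : V) :=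
  ipnorm ip (h^-1 *: (U h x - x) - x') @[h --> 0^'] --> (0 : R).

Lemma is_generatorU t x x' : is_generator x x' -> is_generator (U t x) (U t x').
Proof.
rewrite /is_generator; apply: cvg_trans; apply: near_eq_cvg.
near=> h; rewrite -Uadd (addrC h t) Uadd -isometryB -UZ -isometryB.
by rewrite isometry_norm.
Unshelve. all: by end_near. Qed.

(** Differentiates the constant <U^h x, U^h y> at h = 0: the left side of [h1] is its difference
    quotient, written with the second-order term of the product rule, and is 0 for every h != 0. *)
Lemma generator_skew x x' y y' : is_generator x x' -> is_generator y y' ->
  ip x y' = - ip x' y.
Proof.
move=> gx gy; apply/eqP; rewrite -addr_eq0 addrC; apply/eqP.
have cz z : ipnorm ip (z - z) @[h --> (0 : R)^'] --> (0 : R).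
  by rewrite subrr /ipnorm ip0l sqrtr0; exact: cvg_cst.
have h1 : ip (h^-1 *: (U h x - x)) y + h * ip (h^-1 *: (U h x - x)) (h^-1 *: (U h y - y))
    + ip x (h^-1 *: (U h y - y)) @[h --> 0^'] --> ip x' y + 0 * ip x' y' + ip x y'.
  apply: cvgD; first apply: cvgD.
  - by apply: cvg_ip gx _; exact: cz.
  - apply: cvgM; first exact: cvg_within.
    exact: cvg_ip gx gy.
  - by apply: cvg_ip _ gy; exact: cz.
rewrite mul0r addr0 in h1; rewrite -(cvg_lim _ h1)//; apply: cvg_lim => //.
apply: cvg_near_cst; near=> h.
have h0 : h != 0 by near: h; exact: nbhs_dnbhs_neq.
by rewrite !(ipZl, ipZr) !(ipBl, ipBr) Uip; field.
Unshelve. all: by end_near. Qed.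

Lemma is_derive_ipU x y y' (t : R) : is_generator y y' ->
  is_derive t 1 (fun t => ip x (U t y)) (ip x (U t y')).
Proof.
move=> gy; have gUy := is_generatorU t gy.
have h1 : h^-1 *: (ip x (U (h *: 1 + t) y) - ip x (U t y)) @[h --> 0^'] --> ip x (U t y').
  have cx : ipnorm ip (x - x) @[h --> (0 : R)^'] --> (0 : R).
    by rewrite subrr /ipnorm ip0l sqrtr0; exact: cvg_cst.
  refine (cvg_trans _ (cvg_ip cx gUy)); apply: near_eq_cvg.
  near=> h; rewrite ipZr ipBr -Uadd.
  by rewrite /GRing.scale/= mulr1.
by apply: DeriveDef; [apply/cvg_ex; eexists; exact: h1|exact: cvg_lim].
Unshelve. all: by end_near. Qed.

(** * Evolution of the plane spanned by two eigenvectors *)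

Section two_plane.
(** Here phi' and psi' are V phi and V psi, G bounds their norms, c is the growth rate of the
    commutator of K and U^t, and q bounds the splitting nu - lambda. *)
Variables (K : V -> V) (phi psi phi' psi' : V) (lambda nu gamma c G q : R).
Hypothesis U0 : forall x, U 0 x = x.
Hypothesis Ksym : forall x y, ip (K x) y = ip x (K y).
Hypothesis Kphi : ipeq ip (K phi) (lambda *: phi).
Hypothesis Kpsi : ipeq ip (K psi) (nu *: psi).
Hypothesis phi1 : ip phi phi = 1.
Hypothesis psi1 : ip psi psi = 1.
Hypothesis phipsi : ip phi psi = 0.
Hypothesis gphi : is_generator phi phi'.
Hypothesis gpsi : is_generator psi psi'.
Hypothesis gamma_gt0 : 0 < gamma.
Hypothesis gap : forall f, ip f phi = 0 -> ip f psi = 0 ->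
  gamma * ipnorm ip f <= ipnorm ip (K f - nu *: f).
Hypothesis KU : forall (t : R) f, 0 <= t ->
  ipnorm ip (K (U t f) - U t (K f)) <= c * t * ipnorm ip f.
Hypothesis lambda_nu : nu - lambda <= q.
Hypothesis le_lambda_nu : lambda <= nu.
Hypothesis c_ge0 : 0 <= c.
Hypothesis phi'_le : ipnorm ip phi' <= G.
Hypothesis psi'_le : ipnorm ip psi' <= G.

Let omega := ip phi psi'.

Lemma omega_psi : omega = - ip psi phi'.
Proof. by rewrite /omega (generator_skew gphi gpsi) ipC. Qed.

Let skew0 x x' : is_generator x x' -> ip x x' = 0.
Proof.
move=> gx; have := generator_skew gx gx; rewrite (ipC ip x'); lra.
Qed.

Let res f := f - ip phi f *: phi - ip psi f *: psi.

Let res_phi f : ip (res f) phi = 0.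
Proof.
rewrite !ipBl !ipZl phi1 (ipC ip psi phi) phipsi (ipC ip f); ring.
Qed.

Let res_psi f : ip (res f) psi = 0.
Proof. rewrite !ipBl !ipZl psi1 phipsi (ipC ip f); ring. Qed.

(** K - nu kills psi and sends phi to (lambda - nu) phi, so (K - nu) f is (K - nu)(res f) plus a
    multiple of phi, and the two summands are orthogonal. *)
Let res_le f : ipnorm ip (K (res f) - nu *: res f) <= ipnorm ip (K f - nu *: f).
Proof.
rewrite -ler_sqr ?nnegrE ?ipnorm_ge0// !sqr_ipnorm.
set p := ((lambda - nu) * ip phi f) *: phi.
set D := K (res f) - nu *: res f.
have E z : ip (K f - nu *: f) z = ip (D + p) z.
  have -> : ip (D + p) z = ip (K (res f)) z - nu * ip (res f) z + ip p z.
    by rewrite ipDl ipBl ipZl.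
  rewrite Ksym /res !(ipBl, ipZl) -!Ksym Kphi Kpsi !ipZl; ring.
have Dp : ip D p = 0.
  rewrite ipZr; suff -> : ip D phi = 0 by rewrite mulr0.
  by rewrite ipBl ipZl res_phi Ksym ipC Kphi ipZl ipC res_phi; ring.
have -> : ip (K f - nu *: f) (K f - nu *: f) = ip D D + ip p p.
  by rewrite E ipC E ipDl [ip D _]ipDr [ip p _]ipDr (ipC ip p D) Dp addr0 add0r.
by rewrite lerDl ip_ge0.
Qed.

(** (K - nu) U^t f is the commutator of K and U^t at f plus U^t (K - nu) f = (l - nu) U^t f; the gap
    turns this into a bound on the residual. *)
Let Ueig_le (t : R) f l : 0 <= t -> ip f f = 1 -> ipeq ip (K f) (l *: f) ->
  gamma * ipnorm ip (res (U t f)) <= c * t + `|l - nu|.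
Proof.
move=> t0 f1 Kf; apply: le_trans (gap (res_phi _) (res_psi _)) _.
apply: le_trans (res_le _) _.
have -> : K (U t f) - nu *: U t f =
    (K (U t f) - U t (K f)) + U t (K f - nu *: f).
  by rewrite isometryB UZ addrA subrK.
have n1 : ipnorm ip f = 1 by rewrite /ipnorm f1 sqrtr1.
apply: le_trans (ipnormD _ _ _) _; apply: lerD.
  by apply: le_trans (KU _ t0) _; rewrite n1 mulr1.
rewrite isometry_norm.
suff -> : ipnorm ip (K f - nu *: f) = ipnorm ip ((l - nu) *: f).
  by rewrite ipnormZ n1 mulr1.
rewrite /ipnorm; congr Num.sqrt.
have E z : ip (K f - nu *: f) z = ip ((l - nu) *: f) z.
  by rewrite ipBl Kf !ipZl; ring.
by rewrite E ipC E.
Qed.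

(* For z = (phi + i psi) / sqrt 2, [b t] is the real part of
   e^(-i omega t) <z, U^t z>, so |U^t z - e^(i omega t) z|^2 = 2 - 2 b(t). *)
Let A t := (ip phi (U t phi) + ip psi (U t psi)) / 2.
Let B t := (ip phi (U t psi) - ip psi (U t phi)) / 2.
Let b t := cos (omega * t) * A t + sin (omega * t) * B t.
Let A' t := (ip phi (U t phi') + ip psi (U t psi')) / 2.
Let B' t := (ip phi (U t psi') - ip psi (U t phi')) / 2.
Let b' t := cos (omega * t) * (A' t + omega * B t) +
            sin (omega * t) * (B' t - omega * A t).

Let resE x f : ip x f =
  ip phi f * ip x phi + ip psi f * ip x psi + ip x (res f).
Proof. rewrite /res !ipBr !ipZr; ring. Qed.

(* Skew-adjointness cancels the components along phi and psi: only the
   residuals of U^t phi and U^t psi survive. *)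
Let A'E t : A' t + omega * B t =
  - (ip phi' (res (U t phi)) + ip psi' (res (U t psi))) / 2.
Proof.
rewrite /A' (generator_skew gphi (is_generatorU t gphi)).
rewrite (generator_skew gpsi (is_generatorU t gpsi)).
rewrite (resE phi' (U t phi)) (resE psi' (U t psi)) /B.
rewrite (ipC ip phi' phi) (ipC ip psi' psi) (skew0 gphi) (skew0 gpsi).
rewrite (ipC ip psi' phi) -/omega (_ : ip phi' psi = - omega); last first.
  by rewrite omega_psi opprK ipC.
by field.
Qed.

Let B'E t : B' t - omega * A t =
  - (ip phi' (res (U t psi)) - ip psi' (res (U t phi))) / 2.
Proof.
rewrite /B' (generator_skew gphi (is_generatorU t gpsi)).
rewrite (generator_skew gpsi (is_generatorU t gphi)).
rewrite (resE phi' (U t psi)) (resE psi' (U t phi)) /A.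
rewrite (ipC ip phi' phi) (ipC ip psi' psi) (skew0 gphi) (skew0 gpsi).
rewrite (ipC ip psi' phi) -/omega (_ : ip phi' psi = - omega); last first.
  by rewrite omega_psi opprK ipC.
by field.
Qed.

Let b'_ge (t : R) : 0 <= t -> - (G * (gamma^-1 * (2 * c * t + q))) <= b' t.
Proof.
move=> t0; rewrite /b' A'E B'E.
set r1 := res (U t phi); set r2 := res (U t psi).
have n1 : ipnorm ip r1 <= gamma^-1 * (c * t + (nu - lambda)).
  rewrite ler_pdivlMl//; have := Ueig_le t0 phi1 Kphi.
  by rewrite distrC ger0_norm// subr_ge0.
have n2 : ipnorm ip r2 <= gamma^-1 * (c * t).
  rewrite ler_pdivlMl//; have := Ueig_le t0 psi1 Kpsi.
  by rewrite subrr normr0 addr0.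
(* Both residuals pay for the commutator, but only that of phi pays for the splitting, since the gap
   is taken at nu. *)
have n12 : ipnorm ip r1 + ipnorm ip r2 <= gamma^-1 * (2 * c * t + q).
  apply: le_trans (lerD n1 n2) _; rewrite -mulrDr ler_pM2l ?invr_gt0//.
  by rewrite (_ : _ + c * t = 2 * c * t + (nu - lambda)) ?lerD2l//; ring.
have G0 : 0 <= G by apply: le_trans phi'_le; exact: ipnorm_ge0.
have CS x r : ipnorm ip x <= G -> `|ip x r| <= G * ipnorm ip r.
  by move=> xG; apply: le_trans (ipnorm_CS _ _ _) _; rewrite ler_wpM2r ?ipnorm_ge0.
have h11 := CS _ r1 phi'_le; have h12 := CS _ r2 phi'_le.
have h21 := CS _ r1 psi'_le; have h22 := CS _ r2 psi'_le.
apply: (@le_trans _ _ (- (G * (ipnorm ip r1 + ipnorm ip r2)))).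
  by rewrite lerN2 ler_wpM2l.
set cs := cos _; set sn := sin _.
have cs1 : `|cs| <= 1 by rewrite ler_norml cos_geN1 cos_le1.
have sn1 : `|sn| <= 1 by rewrite ler_norml sin_geN1 sin_le1.
(* The cosine and the sine term of b' are bounded separately, each by half of G (|r1| + |r2|). *)
have prod (s x e : R) : `|s| <= 1 -> `|x| <= e -> - e <= s * x.
  move=> s1 xe; have : `|s * x| <= e.
    by rewrite normrM -[e]mul1r ler_pM.
  by rewrite ler_norml => /andP[].
have h1 := prod _ (- (ip phi' r1 + ip psi' r2) / 2) (G * (ipnorm ip r1 + ipnorm ip r2) / 2) cs1.
have h2 := prod _ (- (ip phi' r2 - ip psi' r1) / 2) (G * (ipnorm ip r1 + ipnorm ip r2) / 2) sn1.
have h1' : `|- (ip phi' r1 + ip psi' r2) / 2| <= G * (ipnorm ip r1 + ipnorm ip r2) / 2.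
  rewrite normrM normrN ger0_norm ?invr_ge0// ler_pM2r ?invr_gt0//.
  by rewrite (le_trans (ler_normD _ _))// mulrDr lerD.
have h2' : `|- (ip phi' r2 - ip psi' r1) / 2| <= G * (ipnorm ip r1 + ipnorm ip r2) / 2.
  rewrite normrM normrN ger0_norm ?invr_ge0// ler_pM2r ?invr_gt0//.
  by rewrite (le_trans (ler_normB _ _))// addrC mulrDr lerD.
have := h1 h1'; have := h2 h2'; lra.
Qed.

Let is_derive_b (t : R) : is_derive t 1 b (b' t).
Proof.
have dA : is_derive t 1 A (A' t).
  apply: is_derive1W (is_deriveM (is_deriveD (is_derive_ipU phi t gphi)
    (is_derive_ipU psi t gpsi)) (is_derive_cst (2^-1 : R) t 1)) _ _ => //.
  by rewrite /GRing.scale/= mulr0 add0r mulrC.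
have dB : is_derive t 1 B (B' t).
  apply: is_derive1W (is_deriveM (is_deriveB (is_derive_ipU phi t gpsi)
    (is_derive_ipU psi t gphi)) (is_derive_cst (2^-1 : R) t 1)) _ _ => //.
  by rewrite /GRing.scale/= mulr0 add0r mulrC.
have dl : is_derive t 1 (fun t : R => omega * t) omega.
  apply: is_derive1W (is_deriveM (is_derive_cst omega t 1) (is_derive_id t 1)) _ _ => //.
  by rewrite /GRing.scale/= mulr0 addr0 mulr1.
have dc : is_derive t 1 (fun t => cos (omega * t)) (- sin (omega * t) * omega).
  exact: is_derive1W (is_derive1_comp (is_derive_cos (omega * t)) dl) _ _.
have ds : is_derive t 1 (fun t => sin (omega * t)) (cos (omega * t) * omega).
  exact: is_derive1W (is_derive1_comp (is_derive_sin (omega * t)) dl) _ _.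
apply: is_derive1W (is_deriveD (is_deriveM dc dA) (is_deriveM ds dB)) _ _ => //.
by rewrite /GRing.scale/= /b'; ring.
Qed.

(** The subtracted term S is the antiderivative of the bound in [b'_ge], so b + S has nonnegative
    derivative for t >= 0 and starts at 1. *)
Lemma b_ge (t : R) : 0 <= t -> 1 - G * (gamma^-1 * (c * t ^+ 2 + q * t)) <= b t.
Proof.
move=> t0.
pose S (t : R) := G * (gamma^-1 * (c * t ^+ 2 + q * t)).
have dS (s : R) : is_derive s 1 S (G * (gamma^-1 * (2 * c * s + q))).
  have d2 := is_deriveM (is_derive_cst c s 1) (is_deriveM (is_derive_id s 1) (is_derive_id s 1)).
  have d1 := is_deriveM (is_derive_cst q s 1) (is_derive_id s 1).
  apply: is_derive1W (is_deriveM (is_derive_cst (G * gamma^-1) s 1)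
    (is_deriveD d2 d1)) _ _.
    by move=> u; rewrite /S (_ : (_ * _) u = G * gamma^-1 * (c * (u * u) + q * u))//; ring.
  by rewrite !scaler0 !addr0 /GRing.scale/=; ring.
have dbS (s : R) : is_derive s 1 (b \+ S) (b' s + G * (gamma^-1 * (2 * c * s + q))).
  exact: is_deriveD.
have b0 : (b \+ S) 0 = 1.
  by rewrite /= /b /A /B /S !mulr0 cos0 sin0 !U0 phi1 psi1 expr2 !mulr0 addr0 !mulr0; field.
suff : (b \+ S) 0 <= (b \+ S) t by rewrite b0 /S /=; lra.
have [->//|tn0] := eqVneq t 0.
have tp : 0 < t by rewrite lt_neqAle eq_sym tn0.
have [s /andP[s0 st] E] : exists2 s, 0 < s < t & (b \+ S) t - (b \+ S) 0 =
    (b' s + G * (gamma^-1 * (2 * c * s + q))) * (t - 0).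
  have [|s] := @MVT R (b \+ S) (fun s => b' s + G * (gamma^-1 * (2 * c * s + q))) 0 t tp (fun s _ => dbS s).
    by apply: derivable_within_continuous => s _; exact: (@ex_derive _ _ _ _ _ _ _ (dbS s)).
  by rewrite in_itv/=; exists s.
rewrite -subr_ge0 E mulr_ge0 ?subr_ge0//.
by rewrite -lerBlDr sub0r; exact/b'_ge/ltW.
Qed.

(** The two vectors are sqrt 2 times the real and imaginary parts of U^t z - e^(i omega t) z, so the
    left side is 2 - 2 b(t). *)
Lemma two_plane_le (t : R) : 0 <= t ->
  (ip (U t phi - cos (omega * t) *: phi + sin (omega * t) *: psi)
      (U t phi - cos (omega * t) *: phi + sin (omega * t) *: psi) +
   ip (U t psi - cos (omega * t) *: psi - sin (omega * t) *: phi)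
      (U t psi - cos (omega * t) *: psi - sin (omega * t) *: phi)) / 2 <=
  2 * (G * (gamma^-1 * (c * t ^+ 2 + q * t))).
Proof.
move=> t0; have := b_ge t0; rewrite /b /A /B.
rewrite !(ipDl, ipBl, ipZl, ipDr, ipBr, ipZr, ipNl, ipNr) !Uip phi1 psi1 phipsi.
rewrite (ipC ip psi phi) phipsi.
rewrite (ipC ip (U t phi) phi) (ipC ip (U t psi) phi) (ipC ip (U t phi) psi)
  (ipC ip (U t psi) psi).
have := cos2Dsin2 (omega * t).
set cs := cos _; set sn := sin _; nra.
Qed.

End two_plane.
End generator.

(** * Operators with a continuous kernel *)

Section Rintegral_ae.
Context {d : measure_display} {T : measurableType d} {R : realType}.
Variable mu : {measure set T -> \bar R}.
Implicit Types f g : T -> R.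

Lemma ae_eq_Rintegral D f g : measurable D ->
  measurable_fun D f -> measurable_fun D g ->
  {ae mu, forall x, D x -> f x = g x} ->
  \int[mu]_(x in D) f x = \int[mu]_(x in D) g x.
Proof.
move=> mD mf mg fg; congr fine; apply: ae_eq_integral => //.
- exact/measurable_EFinP.
- exact/measurable_EFinP.
- by apply: filterS fg => x h Dx; rewrite h.
Qed.

Lemma ae_ge0_Rintegral D f : measurable D -> measurable_fun D f ->
  {ae mu, forall x, D x -> 0 <= f x} -> 0 <= \int[mu]_(x in D) f x.
Proof.
move=> mD mf f0; rewrite (@ae_eq_Rintegral _ _ (fun x => `|f x|))//.
- exact: Rintegral_ge0.
- exact: measurableT_comp.
- by apply: filterS f0 => x h /h f0; rewrite ger0_norm.
Qed.

Lemma ae_le_Rintegral D f g : measurable D ->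
  mu.-integrable D (EFin \o f) -> mu.-integrable D (EFin \o g) ->
  {ae mu, forall x, D x -> f x <= g x} ->
  \int[mu]_(x in D) f x <= \int[mu]_(x in D) g x.
Proof.
move=> mD fi gi fg; rewrite -subr_ge0 -RintegralB//; apply: ae_ge0_Rintegral => //.
  by apply: measurable_funB; apply/measurable_EFinP; apply: measurable_int; [exact: gi|exact: fi].
by apply: filterS fg => x h /h; rewrite subr_ge0.
Qed.

Lemma Rintegral_dominated_cvg D (f_ : nat -> T -> R) f g : measurable D ->
  (forall n, measurable_fun D (f_ n)) -> measurable_fun D f ->
  {ae mu, forall x, D x -> f_ n x @[n --> \oo] --> f x} ->
  mu.-integrable D (EFin \o g) ->
  {ae mu, forall x n, D x -> `|f_ n x| <= g x} ->
  \int[mu]_(x in D) f_ n x @[n --> \oo] --> \int[mu]_(x in D) f x.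
Proof.
move=> mD mf_ mf f_f gi f_g.
have hf : {ae mu, forall x, D x -> (f_ n x)%:E @[n --> \oo] --> (f x)%:E}.
  apply: filterS f_f => x h Dx; apply/fine_cvgP; split; first exact: nearW.
  exact: h.
have hg : {ae mu, forall x n, D x -> (`|(f_ n x)%:E| <= (g x)%:E)%E}.
  by apply: filterS f_g => x h n Dx; rewrite lee_fin; exact: h.
have mE n : measurable_fun D (fun x => (f_ n x)%:E) by exact/measurable_EFinP.
have mfE : measurable_fun D (fun x => (f x)%:E) by exact/measurable_EFinP.
have [fi _ h] := dominated_convergence mD mE mfE hf gi hg.
apply: fine_cvg; rewrite fineK; last exact: integrable_fin_num.
exact: h.
Qed.

End Rintegral_ae.

Section Rintegral_probability.
Context {d : measure_display} {T : measurableType d} {R : realType}.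
Variable mu : probability T R.
Local Notation intg f := (mu.-integrable setT (EFin \o f)).
Implicit Types f g : T -> R.

Lemma Rintegral_probability_cst (c : R) : \int[mu]_x c = c.
Proof. by rewrite Rintegral_cst//= probability_setT mulr1. Qed.

Lemma ae_normr_Rintegral_le f (c : R) : intg f ->
  {ae mu, forall x, `|f x| <= c} -> `|\int[mu]_x f x| <= c.
Proof.
move=> fi fc; apply: le_trans (le_normr_Rintegral measurableT fi) _.
rewrite -[leRHS]Rintegral_probability_cst; apply: ae_le_Rintegral => //.
- exact: integrable_norm.
- exact: finite_measure_integrable_cst.
- by apply: filterS fc => x h _.
Qed.

(** Cauchy-Schwarz against the constant 1, whose norm is 1 for a probability measure. *)
Lemma Rintegral_norm_le_ipnorm (f : L2r mu) :
  \int[mu]_x `|f x| <= ipnorm (l2prod mu) f.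
Proof.
have ms := sqint_measurable (l2funP f).
have m1 : (cst 1 : T -> R) \in sqint mu.
  by apply: (@sqint_bounded _ _ _ mu _ 1) => // x; rewrite normr1.
have mf : (fun x => `|f x|) \in sqint mu.
  apply/sqintP; split; first exact: measurableT_comp.
  rewrite (_ : (fun x => _) = (fun x => f x ^+ 2)); first by have /sqintP[] := l2funP f.
  by apply/funext => x; rewrite real_normK ?num_real.
have := ler_norm (l2prod mu (MkL2r m1) (MkL2r mf)).
move=> /le_trans /(_ (ipnorm_CS _ _ _)).
rewrite {2}/ipnorm !l2prodE /=.
under eq_Rintegral do rewrite mul1r.
under [X in _ <= Num.sqrt X * _]eq_Rintegral do rewrite mul1r.
rewrite Rintegral_probability_cst sqrtr1 mul1r /ipnorm !l2prodE/=.
by under [X in _ <= Num.sqrt X -> _]eq_Rintegral do rewrite -expr2 real_normK ?num_real// expr2.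
Qed.

End Rintegral_probability.

Section borel_metric.
Context {R : realType} {d : measure_display} {Omega : measurableMetricType R d}.
Hypothesis hborel : borel Omega.

Lemma open_borel (A : set Omega) : open A -> measurable A.
Proof. by move=> oA; rewrite hborel; exact: sub_sigma_algebra. Qed.

Lemma closed_borel (A : set Omega) : closed A -> measurable A.
Proof.
by move=> cA; rewrite -(setCK A); apply: measurableC; apply: open_borel; exact: closed_openC.
Qed.

Lemma continuous_borel_fun (f : Omega -> R) : continuous f -> measurable_fun setT f.
Proof.
move=> /continuousP cf; apply: (measurability _ (RGenOpens.measurableE R)).
move=> _ [_ [a [b ->] <-]]; rewrite setTI; apply: open_borel; apply: cf.
exact: interval_open.
Qed.

Lemma continuous_borel_map (f : Omega -> Omega) : continuous f -> measurable_fun setT f.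
Proof.
move=> /continuousP cf; apply: (measurability _ hborel).
by move=> _ [A oA <-]; rewrite setTI; apply: open_borel; exact: cf.
Qed.

End borel_metric.

(** * The integral operator of a bounded continuous kernel, and its symmetry *)

Section continuous_kernel.
Context {R : realType} {d : measure_display} {Omega : measurableMetricType R d}.
Variable mu : probability Omega R.
Variables (X : set Omega) (k : Omega -> Omega -> R) (b : R).
Hypothesis hborel : borel Omega.
Hypothesis Xc : compact X.
Hypothesis muX : mu (~` X) = 0%E.
Hypothesis k_cont : continuous (fun p : Omega * Omega => k p.1 p.2).
Hypothesis k_sym : forall x y, k x y = k y x.
Hypothesis k_le : forall x y, `|k x y| <= b.
Local Notation intg f := (mu.-integrable setT (EFin \o f)).
Local Notation L2 := (L2r mu).
Local Notation ip := (l2prod mu).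

Lemma compact_metric_closed : closed X.
Proof. by apply: compact_closed => //; exact: metric_hausdorff. Qed.

Lemma ae_support : {ae mu, forall x, X x}.
Proof.
exists (~` X); split => //.
by apply: measurableC; apply: closed_borel => //; exact: compact_metric_closed.
Qed.

Lemma k_contr y : continuous (k y).
Proof.
move=> x; apply: (@continuous_comp _ _ _ (fun x => (y, x)) (fun p : Omega * Omega => k p.1 p.2)).
  by apply: cvg_pair => //; exact: cvg_cst.
exact: k_cont.
Qed.

(** The tube lemma: compactness of X makes continuity in the first argument uniform over x in X. *)
Lemma k_near y0 (e : R) : 0 < e ->
  \forall y \near y0, forall x, X x -> `|k y x - k y0 x| <= e.
Proof.
move=> e0; apply: (compact_near_coveringP _).1 Xc _ _ _ _ _ => x Xx.
have e2 : 0 < e / 2 by rewrite divr_gt0.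
have /cvgrPdist_le /(_ _ e2) h := @k_cont (y0, x).
have /cvgrPdist_le /(_ _ e2) h0 := @k_contr y0 x.
case: h => -[A B] /= [Ay Bx] AB.
exists (B `&` [set x' | `|k y0 x - k y0 x'| <= e / 2], A) => /=.
  by split => //; apply: filterI.
move=> [x' y] /= [[Bx' h1] Ay']; have := AB (y, x') (conj Ay' Bx') => /= h2.
rewrite (splitr e) (_ : k y x' - k y0 x' = (k y0 x - k y0 x') - (k y0 x - k y x')); last by ring.
by rewrite (le_trans (ler_normB _ _))// lerD.
Qed.

Lemma k_sqint y : k y \in sqint mu.
Proof.
by apply: (@sqint_bounded _ _ _ mu _ b) => //; apply: continuous_borel_fun => //; exact: k_contr.
Qed.

Definition kfun y : L2 := MkL2r (k_sqint y).

Definition kop (f : Omega -> R) y : R := \int[mu]_x (k y x * f x).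

Lemma kopE (f : L2) y : kop f y = ip (kfun y) f.
Proof. by []. Qed.

Lemma k_bound_ge0 : Omega -> 0 <= b.
Proof. by move=> y; exact: le_trans (normr_ge0 _) (k_le y y). Qed.

Lemma kfun_dist_le (y y0 : Omega) (e : R) : 0 <= e ->
  (forall x, X x -> `|k y x - k y0 x| <= e) -> ipnorm ip (kfun y - kfun y0) <= e.
Proof.
move=> e0 h; rewrite -ler_sqr ?nnegrE ?ipnorm_ge0// sqr_ipnorm l2prodE.
apply: le_trans (ler_norm _) _; apply: ae_normr_Rintegral_le.
  exact: sqint_mul (l2funP _) (l2funP _).
apply: filterS ae_support => x Xx; rewrite normrM -expr2.
by rewrite ler_sqr ?nnegrE//; exact: h.
Qed.

Lemma kfun_norm_le y : ip (kfun y) (kfun y) <= b ^+ 2.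
Proof.
rewrite l2prodE; apply: le_trans (ler_norm _) _; apply: ae_normr_Rintegral_le.
  exact: sqint_mul (l2funP _) (l2funP _).
apply: aeW => x; rewrite normrM -expr2.
by rewrite ler_sqr ?nnegrE ?k_le// k_bound_ge0.
Qed.

Lemma cvg_kfun y0 : ipnorm ip (kfun y - kfun y0) @[y --> y0] --> (0 : R).
Proof.
apply/cvgr0Pnorm_le => e e0; apply: filterS (k_near y0 e0) => y h.
by rewrite ger0_norm ?ipnorm_ge0//; apply: kfun_dist_le => //; exact: ltW.
Qed.

Lemma kop_continuous (f : L2) : continuous (kop f).
Proof.
move=> y0; rewrite /continuous_at.
have -> : kop f y0 = ip (kfun y0) f by [].
apply: (@cvg_ip _ _ ip _ (nbhs y0) _ kfun (fun=> f)); first exact: cvg_kfun.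
by rewrite subrr /ipnorm ip0l sqrtr0; exact: cvg_cst.
Qed.

Lemma kop_le (f : L2) y : `|kop f y| <= b * ipnorm ip f.
Proof.
rewrite kopE; apply: le_trans (ipnorm_CS _ _ _) _.
rewrite ler_wpM2r ?ipnorm_ge0//.
by rewrite -ler_sqr ?nnegrE ?ipnorm_ge0 ?k_bound_ge0// sqr_ipnorm kfun_norm_le.
Qed.

Lemma kop_sqint (f : L2) : kop f \in sqint mu.
Proof.
apply: (@sqint_bounded _ _ _ mu _ (b * ipnorm ip f)); last exact: kop_le.
by apply: continuous_borel_fun => //; exact: kop_continuous.
Qed.

Definition kL2 (f : L2) : L2 := MkL2r (kop_sqint f).

(** Replaces k(x, y) by k(c, y), where c is the first point of l whose ball (its interior) contains
    x, and by 0 if there is none. Such a function is measurable for the product sigma-algebra, which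
    continuity of k alone does not guarantee for k when Omega is not separable. *)
Let near_net (l : seq Omega) (r : R) (p : Omega * Omega) : R :=
  foldr (fun (c : Omega) (v : R) => if p.1 \in ((ball c r)^° : set Omega) then k c p.2 else v) 0 l.

Let measurable_near_net l r : measurable_fun setT (near_net l r).
Proof.
elim: l => [|c l IH]; first exact: measurable_cst.
apply: measurable_fun_ifT => //=.
- apply: (@measurable_fun_bool _ _ _ _ true); rewrite setTI.
  rewrite (_ : _ @^-1` _ = fst @^-1` (ball c r)^°); last first.
    by apply/seteqP; split => p /= h; [exact: set_mem|exact: mem_set].
  rewrite -[X in measurable X]setTI; apply: measurable_fst => //.
  by apply: open_borel => //; exact: open_interior.
- apply: measurableT_comp => //; apply: continuous_borel_fun => //; exact: k_contr.
Qed.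

Let near_netP l r x y : (exists2 c, c \in l & (ball c r)^° x) ->
  exists2 c, ball c r x & near_net l r (x, y) = k c y.
Proof.
elim: l => [[] //|c l IH] [c' c'l c'x] /=.
have [/set_mem cx|cx] := boolP (x \in _).
  by exists c => //; exact: interior_subset.
apply: IH; exists c' => //; move: c'l; rewrite inE => /orP[/eqP c'c|//].
by move: cx; rewrite -c'c mem_set.
Qed.

Let exists_net (r : R) : 0 < r ->
  exists l : seq Omega, forall x, X x -> exists2 c, c \in l & (ball c r)^° x.
Proof.
move=> r0; have := Xc; rewrite compact_cover.
move=> /(_ Omega X (fun c => (ball c r)^°)) [].
- by move=> c _; exact: open_interior.
- by move=> x Xx; exists x => //; exact: nbhsx_ballx.
- move=> D' _ cov; exists (finmap.enum_fset D') => x /cov[c /= cD' cx].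
  by exists c.
Qed.

Let kX (p : Omega * Omega) := \1_X p.1 * k p.1 p.2.

(** Finite nets of radius 1 / (n + 1) exist for the compact X, hence the indicator in [kX]. For x in
    X the chosen centres tend to x, and continuity of k in its first argument gives pointwise
    convergence. *)
Let measurable_kX : measurable_fun setT kX.
Proof.
have mX : measurable X by apply: closed_borel => //; exact: compact_metric_closed.
have m1 : measurable_fun setT (fun p : Omega * Omega => \1_X p.1 : R).
  by apply: measurableT_comp => //; exact: measurable_indic.
have /choice[l hl] : forall n, exists l : seq Omega,
    forall x, X x -> exists2 c, c \in l & (ball c (n.+1%:R^-1 : R))^° x.
  by move=> n; apply: exists_net.
apply: (@measurable_fun_cvg _ _ _ _
  (fun n p => \1_X p.1 * near_net (l n) n.+1%:R^-1 p)) => //.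
  by move=> n; apply: measurable_funM => //; exact: measurable_near_net.
move=> [x y] _ /=; have [Xx|Xx] := pselect (X x); last first.
  rewrite /kX /= indicE memNset// mul0r.
  by rewrite (_ : (fun n => _) = cst 0) ?mul0r; [exact: cvg_cst|apply/funext => n; rewrite mul0r].
apply: cvgMr; apply/cvgrPdist_le => e e0.
have /cvgrPdist_le /(_ _ e0) /nbhs_ballP[r /= r0 hr] : k z y @[z --> x] --> k x y.
  under eq_fun do rewrite k_sym; rewrite k_sym; exact: k_contr.
have := @cvg_harmonic R; move=> /cvgrPdist_lt /(_ _ r0); apply: filterS => n /=.
rewrite sub0r normrN ger0_norm// => nr.
have [c cx ->] := near_netP y (hl n x Xx).
by apply: hr; apply: ball_sym; exact: le_ball (ltW nr) _ cx.
Qed.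

(** Fubini's theorem for kX(x, y) f(y) g(x), integrable because |kX| <= b and f and g are
    integrable. The complement of X is null, so the indicator does not change the iterated
    integrals. *)
Lemma kL2_sym (f g : L2) : ip (kL2 f) g = ip f (kL2 g).
Proof.
pose H (p : Omega * Omega) := (kX p * (f p.2 * g p.1))%:E.
have mf := sqint_measurable (l2funP f); have mg := sqint_measurable (l2funP g).
have mHr : measurable_fun setT (fun p => kX p * (f p.2 * g p.1)).
  apply: measurable_funM; first exact: measurable_kX.
  by apply: measurable_funM; apply: measurableT_comp.
have mH : measurable_fun setT H by exact/measurable_EFinP.
have fi := sqint_integrable (l2funP f); have gi := sqint_integrable (l2funP g).
have iH : (mu \x mu)%E.-integrable setT H.
  apply/integrable12ltyP => //.
  have iaf : (\int[mu]_y `|f y|%:E = (\int[mu]_y `|f y|)%:E)%E.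
    by rewrite fineK//; apply: integrable_fin_num => //; exact: integrable_norm fi.
  apply: (@le_lt_trans _ _ (\int[mu]_x ((b * \int[mu]_y `|f y|) * `|g x|)%:E)%E).
    apply: ge0_le_integral => //=.
    + by move=> x _; exact: integral_ge0.
    + by apply: (@measurable_fun_fubini_tonelli_F _ _ _ _ _ _ (fun p => `|H p|)%E) => //;
        exact: measurableT_comp.
    + by apply/measurable_EFinP; apply: measurable_funM => //; exact: measurableT_comp.
    + move=> x _; rewrite mulrAC EFinM -iaf -ge0_integralZl//; last 2 first.
      * by apply/measurable_EFinP; exact: measurableT_comp.
      * by rewrite lee_fin mulr_ge0// k_bound_ge0.
      apply: ge0_le_integral => //=.
      * apply/measurable_EFinP; apply: measurableT_comp => //.
        exact: (measurableT_comp mHr (pair1_measurable x)).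
      * by apply: emeasurable_funM => //; apply/measurable_EFinP; exact: measurableT_comp.
      * move=> y _; rewrite lee_fin !normrM -[X in _ <= X]mulrA [X in _ <= _ * X]mulrC.
        rewrite ler_wpM2r// ?mulr_ge0//.
        rewrite (le_trans _ (k_le x y))// ler_piMl// indicE.
        by case: (_ \in _); rewrite ?normr1 ?normr0.
  have := integrable_norm gi => /(EFin_integrableZl (b * \int[mu]_y `|f y|)).
  by move=> /(integrable_fin_num measurableT) /fin_numPlt/andP[].
have mX : measurable X by apply: closed_borel => //; exact: compact_metric_closed.
have := @Fubini _ _ _ _ _ mu mu H iH.
have iX x : X x -> \1_X x = 1 :> R by move=> Xx; rewrite indicE mem_set.
have E1 : (\int[mu]_x \int[mu]_y H (x, y) = (ip (kL2 f) g)%:E)%E.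
  rewrite EFin_l2prod; apply: ae_eq_integral => //.
  - exact: (measurable_fubini_F iH).
  - apply/measurable_EFinP; apply: measurable_funM => //.
    exact: sqint_measurable (l2funP _).
  - apply: filterS ae_support => x Xx _; rewrite /H /kX /= iX//.
    under eq_integral do rewrite mul1r mulrA EFinM.
    rewrite integralZr//; last exact: sqint_mul (k_sqint x) (l2funP f).
    rewrite EFinM; congr (_ * _)%E; rewrite /kop fineK//.
    by apply: integrable_fin_num => //; exact: sqint_mul (k_sqint x) (l2funP f).
have E2 : (\int[mu]_y \int[mu]_x H (x, y) = (ip f (kL2 g))%:E)%E.
  rewrite EFin_l2prod; apply: ae_eq_integral => //.
  - exact: (measurable_fubini_G iH).
  - apply/measurable_EFinP; apply: measurable_funM => //.
    exact: sqint_measurable (l2funP _).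
  - apply: filterS ae_support => y Xy _; rewrite /H /kX /=.
    transitivity (\int[mu]_x ((f y)%:E * (k y x * g x)%:E))%E.
      have myx : measurable_fun setT (k y) by exact: sqint_measurable (k_sqint y).
      have mI : measurable_fun setT (\1_X : Omega -> R) by exact: measurable_indic.
      apply: ae_eq_integral => //.
      + apply/measurable_EFinP; under eq_fun do rewrite (k_sym _ y).
        by do 2 apply: measurable_funM => //.
      + by apply: emeasurable_funM => //; apply/measurable_EFinP; exact: measurable_funM.
      + apply: filterS ae_support => x Xx _; rewrite iX// mul1r k_sym.
        by rewrite -EFinM; congr EFin; ring.
    rewrite integralZl//; last exact: sqint_mul (k_sqint y) (l2funP g).
    rewrite EFinM; congr (_ * _)%E; rewrite /kop fineK//.
    by apply: integrable_fin_num => //; exact: sqint_mul (k_sqint y) (l2funP g).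
by rewrite E1 E2 => -[].
Qed.

End continuous_kernel.

(** * The gap inequality for kernel operators on L^2 *)

Section kernel_spectrum.
Context {R : realType} {d : measure_display} {Omega : measurableMetricType R d}.
Variable mu : probability Omega R.
Variables (X : set Omega) (k : Omega -> Omega -> R) (b : R).
Hypothesis hborel : borel Omega.
Hypothesis Xc : compact X.
Hypothesis muX : mu (~` X) = 0%E.
Hypothesis k_cont : continuous (fun p : Omega * Omega => k p.1 p.2).
Hypothesis k_sym : forall x y, k x y = k y x.
Hypothesis k_le : forall x y, `|k x y| <= b.
Local Notation L2 := (L2r mu).
Local Notation ip := (l2prod mu).
Local Notation K := (kL2 hborel Xc muX k_cont k_le).
Local Notation kappa := (kfun mu hborel k_cont k_le).

Lemma kL2B (f g : L2) : K (f - g) = K f - K g.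
Proof.
apply/val_inj/funext => y /=.
rewrite -[LHS]/(ip (kappa y) (f - g)) ipBr.
by [].
Qed.

Lemma kL2_norm_le (f : L2) : ipnorm ip (K f) <= b * ipnorm ip f.
Proof.
rewrite -ler_sqr ?nnegrE ?ipnorm_ge0//; last first.
  have [y _] : [set: Omega] !=set0.
    apply/set0P/eqP => h; have := @probability_setT _ _ _ mu.
    by rewrite h measure0 => /eqP; rewrite eqe eq_sym oner_eq0.
  by rewrite mulr_ge0 ?ipnorm_ge0// (k_bound_ge0 k_le y).
rewrite sqr_ipnorm l2prodE; apply: le_trans (ler_norm _) _.
apply: ae_normr_Rintegral_le; first exact: sqint_mul (l2funP _) (l2funP _).
apply: aeW => y; rewrite normrM -expr2 ler_sqr ?nnegrE//.
  exact: kop_le.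
by rewrite mulr_ge0 ?ipnorm_ge0// (k_bound_ge0 k_le y).
Qed.

(** K is Lipschitz, so the L^2-continuity of the kernel sections survives iteration; the continuity,
    hence measurability, of <kappa y, K^n kappa y> follows. *)
Let cvg_iter n y0 : ipnorm ip (iter n K (kappa y) - iter n K (kappa y0))
  @[y --> y0] --> (0 : R).
Proof.
elim: n => [|n IH]; first exact: (cvg_kfun hborel Xc muX k_cont k_le).
have h : b * ipnorm ip (iter n K (kappa y) - iter n K (kappa y0)) @[y --> y0] --> (0 : R).
  by rewrite -(mulr0 b); apply: cvgMr.
apply/cvgr0Pnorm_le => e e0; move/cvgr0Pnorm_le : h => /(_ _ e0).
apply: filterS => y; apply: le_trans.
by rewrite !iterS -kL2B ger0_norm ?ipnorm_ge0// (le_trans (kL2_norm_le _))// ler_norm.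
Qed.

Let mkappaK n : measurable_fun setT (fun y => ip (kappa y) (iter n K (kappa y))).
Proof.
apply: continuous_borel_fun => // y0; apply: cvg_ip; last exact: cvg_iter.
exact: (cvg_kfun hborel Xc muX k_cont k_le).
Qed.

(** Since |(K f)(y)| <= b |f| for every y, K maps L^2-Cauchy sequences to uniformly Cauchy ones. The
    limit is built pointwise, and uniform convergence gives convergence in L^2. *)
Let Kcomplete (g : nat -> L2) :
  (forall e : R, 0 < e -> exists N, forall n m, (N <= n)%N -> (N <= m)%N ->
     ip (g n - g m) (g n - g m) <= e) ->
  exists G, ip (K (g n) - G) (K (g n) - G) @[n --> \oo] --> (0 : R).
Proof.
move=> gc.
have [y00 _] : [set: Omega] !=set0.
  apply/set0P/eqP => h; have := @probability_setT _ _ _ mu.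
  by rewrite h measure0 => /eqP; rewrite eqe eq_sym oner_eq0.
have b0 := k_bound_ge0 k_le y00.
have uc (e : R) : 0 < e -> exists N, forall n m, (N <= n)%N -> (N <= m)%N ->
    forall y, `|K (g n) y - K (g m) y| <= e.
  move=> e0; have b1 : 0 < b + 1 by rewrite ltr_wpDl.
  have [N hN] := gc _ (exprn_gt0 2 (divr_gt0 e0 b1)).
  exists N => n m Nn Nm y.
  rewrite -[_ - _]/((K (g n) - K (g m)) y) -kL2B.
  have H := kop_le hborel k_cont k_le (g n - g m) y; apply: le_trans H _.
  have : ipnorm ip (g n - g m) <= e / (b + 1).
    rewrite -ler_sqr ?nnegrE ?ipnorm_ge0 ?divr_ge0 ?(ltW e0) ?(ltW b1)//.
    by rewrite sqr_ipnorm hN.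
  rewrite ler_pdivlMr// => h; apply: le_trans h.
  by rewrite mulrC ler_wpM2l ?ipnorm_ge0// lerDl.
have cv y : cvg (K (g n) y @[n --> \oo]).
  apply/cauchy_cvgP/cauchy_exP => e e0.
  have [N hN] := uc _ (divr_gt0 e0 (ltr0Sn R 1)).
  exists (K (g N) y); exists N => // n Nn /=; rewrite -ball_normE /=.
  by rewrite (le_lt_trans (hN _ _ (leqnn N) Nn y))// ltr_pdivrMr// ltr_pMr// ltr1n.
pose G y := lim (K (g n) y @[n --> \oo]).
have GP (e : R) : 0 < e -> exists N, forall n, (N <= n)%N -> forall y, `|K (g n) y - G y| <= e.
  move=> e0; have [N hN] := uc _ e0; exists N => n Nn y.
  have h : `|K (g n) y - K (g m) y| @[m --> \oo] --> `|K (g n) y - G y|.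
    by apply: cvg_norm; apply: cvgB; [exact: cvg_cst|exact: cv].
  by apply: (cvgr_to_le h); exists N => // m Nm; apply: hN.
have mG : measurable_fun setT G.
  apply: (@measurable_fun_cvg _ _ _ _ (fun n y => K (g n) y)) => //.
  by move=> n; exact: sqint_measurable (l2funP _).
have [N0 hN0] := GP 1 ltr01.
have sG : G \in sqint mu.
  apply: (@sqint_bounded _ _ _ mu _ (b * ipnorm ip (g N0) + 1)) => // y.
  rewrite (_ : G y = K (g N0) y - (K (g N0) y - G y)); last by ring.
  rewrite (le_trans (ler_normB _ _))// lerD//; last exact: hN0.
  exact: (kop_le hborel k_cont k_le).
exists (MkL2r sG); apply/cvgr0Pnorm_le => e e0.
have [N hN] := GP (Num.sqrt e) ltac:(by rewrite sqrtr_gt0).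
exists N => // n Nn /=; apply: ae_normr_Rintegral_le.
  exact: sqint_mul (l2funP _) (l2funP _).
apply: aeW => y; rewrite normrM -expr2 -(sqr_sqrtr (ltW e0)).
by rewrite ler_sqr ?nnegrE ?sqrtr_ge0//; exact: hN.
Qed.

Lemma kL2_spectral_gap m (e : nat -> L2) u (nu gamma : R) : 0 < nu -> 0 <= gamma ->
  orthonormal ip m e ->
  (forall i, (i < m)%N -> ipeq ip (K (e i)) (u i *: e i)) ->
  (forall x v, ip x x = 1 -> ortho ip m e x -> ipeq ip (K x) (v *: x) ->
     0 <= v /\ gamma <= `|v - nu|) ->
  forall f, ortho ip m e f ->
    gamma * ipnorm ip f <= ipnorm ip (K f - nu *: f).
Proof.
move=> nu0 g0 oe Ke P f of_.
rewrite -ler_sqr ?nnegrE ?mulr_ge0 ?ipnorm_ge0// exprMn !sqr_ipnorm.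
apply: (@spectral_gap _ _ ip _ _ mu K kappa (b ^+ 2) _ _ _ _ mkappaK Kcomplete
  m e u nu gamma) => //.
- by move=> x y; exact: kL2_sym.
- move=> g; rewrite EFin_l2prod; apply: eq_integral => y _.
  by rewrite /= expr2.
- by move=> y; exact: kfun_norm_le.
- move=> g; exact: sqint_measurable (kop_sqint hborel Xc muX k_cont k_le g).
Qed.

End kernel_spectrum.

(** * Calculus on the manifold *)

Section within_differentials.
Context {R : realType}.

Lemma rV_coord_le (n : nat) (v : 'rV[R]_n) i : `|v ord0 i| <= `|v|.
Proof.
have /mapP[j Hj E] : `|v ord0 i| \in [seq `|v x.1 x.2| | x : 'I_1 * 'I_n].
  by apply/mapP; exists (ord0, i) => //=; rewrite mem_enum.
by rewrite E [leRHS]/Num.norm /= mx_normrE; apply/bigmax_geP; right => /=; exists j.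
Qed.

Lemma rV_norm_le (n : nat) (v : 'rV[R]_n) (c : R) : 0 <= c ->
  (forall i, `|v ord0 i| <= c) -> `|v| <= c.
Proof.
move=> c0 h; rewrite /Num.norm /= mx_normrE; apply/bigmax_leP; split => // -[i j] _ /=.
by rewrite ord1.
Qed.

Section lincomb.
Context {n : nat} {W : normedModType R}.
Implicit Types (J : 'I_n -> W) (v : 'rV[R]_n).

Lemma lincombD J v w : lincomb J (v + w) = lincomb J v + lincomb J w.
Proof.
by rewrite /lincomb -big_split/=; apply: eq_bigr => j _; rewrite mxE scalerDl.
Qed.

Lemma lincombZ J c v : lincomb J (c *: v) = c *: lincomb J v.
Proof.
by rewrite /lincomb scaler_sumr; apply: eq_bigr => j _; rewrite mxE scalerA.
Qed.

Lemma lincombN J v : lincomb J (- v) = - lincomb J v.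
Proof. by rewrite -scaleN1r lincombZ scaleN1r. Qed.

Lemma lincombB J v w : lincomb J (v - w) = lincomb J v - lincomb J w.
Proof. by rewrite lincombD lincombN. Qed.

Lemma lincomb0 J : lincomb J 0 = 0.
Proof. by rewrite -(scale0r 0) lincombZ scale0r. Qed.

Lemma lincomb_le J v : `|lincomb J v| <= (\sum_(j < n) `|J j|) * `|v|.
Proof.
rewrite /lincomb (le_trans (ler_norm_sum _ _ _))// mulr_suml ler_sum// => j _.
by rewrite normrZ mulrC ler_wpM2l// rV_coord_le.
Qed.

Lemma cvg_lincomb (T : Type) (F : set_system T) {FF : Filter F} J
    (v_ : T -> 'rV[R]_n) v :
  v_ t @[t --> F] --> v -> lincomb J (v_ t) @[t --> F] --> lincomb J v.
Proof.
move=> hv; apply/subr_cvg0.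
have h : (\sum_(j < n) `|J j|) * `|v_ t - v| @[t --> F] --> (0 : R).
  rewrite -[X in _ --> X](mulr0 (\sum_(j < n) `|J j|)); apply: cvgMr.
  have /cvg_norm : v_ t - v @[t --> F] --> (0 : 'rV[R]_n) by exact/subr_cvg0.
  by rewrite normr0.
apply/cvgr0Pnorm_le => e e0; move/cvgr0Pnorm_le : h => /(_ _ e0).
apply: filterS => t; apply: le_trans.
by rewrite -lincombB (le_trans (lincomb_le _ _))// ler_norm.
Qed.

End lincomb.

Lemma curve_cvg (n : nat) (c : R -> 'rV[R]_n) (u v : 'rV[R]_n) :
  s^-1 *: (c s - u) @[s --> 0^'+] --> v -> c s @[s --> 0^'+] --> u.
Proof.
move=> h; apply/subr_cvg0.
have h1 : s *: (s^-1 *: (c s - u)) @[s --> 0^'+] --> (0 : R) *: v.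
  by apply: cvgZ => //; apply: cvg_at_right_filter; exact: cvg_id.
rewrite scale0r in h1; apply: cvg_trans h1; apply: near_eq_cvg.
near=> s; rewrite scalerA mulfV ?scale1r//.
Unshelve. all: by end_near. Qed.

(** A chain rule for curves that have only a right derivative at 0: forward trajectories in M, and
    lines starting at a boundary point of a chart. *)
Lemma curve_diff (n : nat) (W : normedModType R) (A : set 'rV[R]_n)
    (f : 'rV[R]_n -> W) (u : 'rV[R]_n) J (c : R -> 'rV[R]_n) (v : 'rV[R]_n) :
  is_diff_within A f u J -> (\forall s \near 0^'+, A (c s)) ->
  s^-1 *: (c s - u) @[s --> 0^'+] --> v ->
  s^-1 *: (f (c s) - f u) @[s --> 0^'+] --> lincomb J v.
Proof.
move=> fJ Ac cv; have cu := curve_cvg cv.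
have L := cvg_lincomb (J := J) cv.
apply/subr_cvg0; rewrite -[X in _ --> X](addr0 0).
rewrite (_ : (fun s => _) = (fun s => (s^-1 *: (f (c s) - f u) - lincomb J (s^-1 *: (c s - u))) +
   (lincomb J (s^-1 *: (c s - u)) - lincomb J v))); last first.
  by apply/funext => s; rewrite addrA subrK.
apply: cvgD; last by apply/subr_cvg0; exact: L.
apply/cvgr0Pnorm_le => e e0.
have v1 : 0 < `|v| + 1 by rewrite ltr_wpDl.
have fJe := fJ _ (divr_gt0 e0 v1).
have hv : \forall s \near 0^'+, `|s^-1 *: (c s - u)| <= `|v| + 1.
  by apply: (cvgr_norm_le _ cv); rewrite ltrDl.
have hc : \forall s \near 0^'+, A (c s) -> `|f (c s) - f u - lincomb J (c s - u)| <= e / (`|v| + 1) * `|c s - u|.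
  exact: cu fJe.
near=> s.
have s0 : 0 < s by near: s; exact: nbhs_right_gt.
rewrite lincombZ -scalerBr normrZ gtr0_norm ?invr_gt0// ler_pdivrMl//.
have h1 : `|f (c s) - f u - lincomb J (c s - u)| <= e / (`|v| + 1) * `|c s - u|.
  by have : A (c s) by [near: s]; near: s.
apply: le_trans h1 _.
have h2 : `|s^-1 *: (c s - u)| <= `|v| + 1 by near: s.
rewrite normrZ gtr0_norm ?invr_gt0// ler_pdivrMl// in h2.
rewrite mulrAC ler_pdivrMr// -mulrA [leRHS]mulrC -mulrA ler_pM2l//.
by rewrite mulrC.
Unshelve. all: by end_near. Qed.

Definition inward (n : nat) (A : set 'rV[R]_n) (u v : 'rV[R]_n) :=
  \forall s \near 0^'+, A (u + s *: v).

Lemma line_cvg (n : nat) (u v : 'rV[R]_n) :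
  s^-1 *: (u + s *: v - u) @[s --> (0 : R)^'+] --> v.
Proof.
apply: cvg_near_cst; near=> s.
rewrite addrC addKr scalerA mulVf ?scale1r//.
Unshelve. all: by end_near. Qed.

Lemma half_space_inward (n : nat) (A U : set 'rV[R]_n) (u v : 'rV[R]_n) :
  open U -> A = U `&` @half_space R n -> A u -> @half_space R n v -> inward A u v.
Proof.
move=> oU -> [Uu hu] hv.
have h : u + s *: v @[s --> (0 : R)^'+] --> u.
  by apply: curve_cvg; exact: line_cvg.
near=> s; split.
  near: s; apply: h; exact: open_nbhs_nbhs.
move=> i i0; rewrite !mxE addr_ge0 ?hu// mulr_ge0 ?hv//.
Unshelve. all: by end_near. Qed.

(* At a point of the half-space, v or -v points inwards, whence the uniqueness
   of differentials along the half-space. *)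
Lemma half_space_or (n : nat) (v : 'rV[R]_n) :
  @half_space R n v \/ @half_space R n (- v).
Proof.
have [|/existsNP[i /not_implyP[i0 /negP]]] := pselect (@half_space R n v); first by left.
rewrite -ltNge => vi; right => j j0; rewrite mxE oppr_ge0 ltW//.
by rewrite (_ : j = i)//; apply: val_inj; rewrite /= j0 i0.
Qed.

Lemma lincomb_eq_half_space (n : nat) (W : normedModType R) (J : 'I_n -> W)
    (L : 'rV[R]_n -> W) :
  (forall v, L (- v) = - L v) ->
  (forall v, @half_space R n v -> lincomb J v = L v) ->
  forall v, lincomb J v = L v.
Proof.
move=> LN h v; have [|hv] := half_space_or v; first exact: h.
by rewrite -[v]opprK lincombN h// LN.
Qed.

Lemma is_diff_within_unique (n : nat) (W : normedModType R) (A U : set 'rV[R]_n)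
    (f : 'rV[R]_n -> W) (u : 'rV[R]_n) J1 J2 :
  open U -> A = U `&` @half_space R n -> A u ->
  is_diff_within A f u J1 -> is_diff_within A f u J2 ->
  forall v, lincomb J1 v = lincomb J2 v.
Proof.
move=> oU AE Au h1 h2; apply: lincomb_eq_half_space => [v|v hv].
  exact: lincombN.
have iv := half_space_inward oU AE Au hv.
have c1 := curve_diff h1 iv (@line_cvg _ u v).
have c2 := curve_diff h2 iv (@line_cvg _ u v).
exact: cvg_unique c1 c2.
Qed.

End within_differentials.

Lemma near_fst (X Y : topologicalType) (P : X -> Prop) (x : X) (y : Y) :
  (\forall x' \near x, P x') -> \forall p \near (x, y), P p.1.
Proof. by move=> h; exists (P, setT) => /= [|[x' y'] []//]; split=> //; exact: filterT. Qed.

Lemma near_snd (X Y : topologicalType) (P : Y -> Prop) (x : X) (y : Y) :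
  (\forall y' \near y, P y') -> \forall p \near (x, y), P p.2.
Proof. by move=> h; exists (setT, P) => /= [|[x' y'] []//]; split=> //; exact: filterT. Qed.

(** * Local bounds in charts *)

Section atlas_calculus.
Context {R : realType} {Omega : topologicalType} {M : set Omega} {n : nat}.
Variables (a : c1_atlas (R := R) M n) (g : riemannian_metric a).
Hypothesis Mc : compact M.
Notation dom := (@dom R Omega M n a).
Notation img := (@img R Omega M n a).
Notation chart := (@chart R Omega M n a).
Notation param := (@param R Omega M n a).
Notation gram := (@gram R Omega M n a g).

Lemma dom_sub i : dom i `<=` M.
Proof. by move=> x; have [U _ ->] := dom_open i => -[]. Qed.

Lemma param_M i u : img i u -> M (param i u).
Proof. by move=> iu; exact: dom_sub (param_dom iu). Qed.

Lemma dom_near i x : dom i x -> \forall y \near x, M y -> dom i y.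
Proof.
have [U oU ->] := dom_open i => -[Ux _].
have : \forall y \near x, U y by exact: open_nbhs_nbhs.
by apply: filterS => y.
Qed.

Lemma chart_cvg i x : dom i x ->
  chart i y @[y --> within M (nbhs x)] --> chart i x.
Proof.
move=> ix; have /subspace_continuousP /(_ x ix) h := @chart_continuous _ _ _ _ a i.
move=> A /h; rewrite /= !nbhs_simpl /within /=; apply: filter_app.
by apply: filterS (dom_near ix) => y h1 h2 /h1 /h2.
Qed.

Lemma param_cvg i u : img i u ->
  param i v @[v --> within (img i) (nbhs u)] --> param i u.
Proof.
by move=> iu; have /subspace_continuousP /(_ u iu) h := @param_continuous _ _ _ _ a i.
Qed.

(* [H (param i0 (c s)) z] is differentiable along curves [c] of the chart [i0],
   with a derivative controlled by the velocity of [c] locally uniformly. *)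
Definition curve_bounded (H : Omega -> Omega -> R) :=
  forall x0 z0 i0, dom i0 x0 -> M z0 -> exists C : R,
  \forall p \near (x0, z0), M p.1 -> M p.2 -> dom i0 p.1 /\
    forall (c : R -> 'rV[R]_n) (v : 'rV[R]_n),
      (\forall s \near (0 : R)^'+, img i0 (c s)) ->
      s^-1 *: (c s - chart i0 p.1) @[s --> (0 : R)^'+] --> v ->
      exists2 l : R, `|l| <= C * `|v| &
        s^-1 *: (H (param i0 (c s)) p.2 - H p.1 p.2) @[s --> (0 : R)^'+] --> l.

Lemma within_bounded (W : normedModType R) (m : nat) (A : set 'rV[R]_m) (F : 'rV[R]_m -> W) (u : 'rV[R]_m) :
  {within A, continuous F} -> A u ->
  \forall v \near u, A v -> `|F v| <= `|F u| + 1.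
Proof.
move=> /subspace_continuousP /(_ u) h Au.
have /(cvgr_norm_le _) := h Au; move=> /(_ (`|F u| + 1)).
by rewrite ltrDl ltr01 => /(_ isT).
Qed.

Lemma sum_within_bounded (W : normedModType R) (m k : nat) (A : set 'rV[R]_m)
    (F : 'rV[R]_m -> 'I_k -> W) (u : 'rV[R]_m) :
  (forall j, {within A, continuous (fun u => F u j)}) -> A u ->
  exists C : R, \forall v \near u, A v -> \sum_(j < k) `|F v j| <= C.
Proof.
move=> h Au; exists (\sum_(j < k) (`|F u j| + 1)).
have H : \forall v \near u, forall j, A v -> `|F v j| <= `|F u j| + 1.
  exact: (@filter_forall _ _ (fun j v => A v -> `|F v j| <= `|F u j| + 1)
    (nbhs u) _ (fun j => @within_bounded _ _ _ (fun u => F u j) _ (h j) Au)).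
by apply: filterS H => v Hv Av; rewrite ler_sum// => j _; exact: Hv.
Qed.

Lemma C1_M_curve_bounded (f : Omega -> R) : C1_M a f ->
  curve_bounded (fun x _ => f x).
Proof.
move=> fC x0 z0 i0 ix0 _; have [J [fJ cJ]] := fC i0.
have iu0 : img i0 (chart i0 x0) by exact: chart_img.
have [C hC] := sum_within_bounded cJ iu0.
exists C.
have h1 : \forall x \near x0, M x -> img i0 (chart i0 x) -> \sum_(j < n) `|J (chart i0 x) j| <= C.
  by have := chart_cvg ix0 hC; rewrite /= nbhs_simpl.
have h2 : \forall x \near x0, (M x -> dom i0 x) /\
    (M x -> img i0 (chart i0 x) -> \sum_(j < n) `|J (chart i0 x) j| <= C).
  by apply: filterS2 h1 (dom_near ix0) => x hx dx; split.
apply: filterS (near_fst z0 h2) => -[x z] /= [d1 d2] Mx Mz; split; first exact: d1.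
move=> c v ci cv; have ix := d1 Mx; have iu := chart_img ix.
exists (lincomb (J (chart i0 x)) v).
  by rewrite (le_trans (lincomb_le _ _))// ler_wpM2r// d2.
have := curve_diff (fJ _ iu) ci cv.
by rewrite /= chartK.
Qed.

Lemma row_mx_norm_le (p q : nat) (u : 'rV[R]_p) (w : 'rV[R]_q) (e : R) :
  `|u| <= e -> `|w| <= e -> `|row_mx u w| <= e.
Proof.
move=> ue we; apply: rV_norm_le => [|i]; first exact: le_trans ue.
rewrite mxE; case: splitP => j _.
  exact: le_trans (rV_coord_le u j) ue.
exact: le_trans (rV_coord_le w j) we.
Qed.

Lemma chart_near i x (e : R) : 0 < e -> dom i x ->
  \forall y \near x, M y -> `|chart i y - chart i x| <= e.
Proof.
move=> e0 ix; have /cvgrPdist_le /(_ _ e0) := chart_cvg ix.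
rewrite near_withinE; apply: filterS => y h My.
by rewrite distrC; exact: h.
Qed.

(** The curve is paired with the constant coordinate of the second point, in a fixed chart around
    z0. *)
Lemma C1_MM_curve_bounded (G : Omega * Omega -> R) : C1_MM a G ->
  curve_bounded (fun x z => G (x, z)).
Proof.
move=> GC x0 z0 i0 ix0 Mz0; have [j0 _ jz0] := dom_cover a Mz0.
have [J [GJ cJ]] := GC (i0, j0).
pose w x z := row_mx (chart i0 x) (chart j0 z).
have prodw x z : dom i0 x -> dom j0 z -> prod_img (i0, j0) (w x z).
  by move=> ix jz; split; rewrite /= ?row_mxKl ?row_mxKr; exact: chart_img.
have [C hC] := sum_within_bounded cJ (prodw _ _ ix0 jz0).
exists C.
have /nbhs_ballP[r /= r0 hr] := hC.
have r2 : 0 < r / 2 by rewrite divr_gt0.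
have h1 := near_fst z0 (chart_near r2 ix0).
have h2 := near_snd x0 (chart_near r2 jz0).
have h3 := near_fst z0 (dom_near ix0).
have h4 := near_snd x0 (dom_near jz0).
near=> p => Mp1 Mp2.
have ip : dom i0 p.1 by move: Mp1; near: p.
have jp : dom j0 p.2 by move: Mp2; near: p.
split => // c v ci cv.
have pw := prodw _ _ ip jp.
have pJ : \sum_(j < n + n) `|J (w p.1 p.2) j| <= C.
  apply: (hr (w p.1 p.2)) => //; rewrite -ball_normE /= distrC.
  rewrite opp_row_mx add_row_mx; apply: (@le_lt_trans _ _ (r / 2)).
    by apply: row_mx_norm_le; [move: Mp1|move: Mp2]; near: p.
  by rewrite ltr_pdivrMr// ltr_pMr// ltr1n.
exists (lincomb (J (w p.1 p.2)) (row_mx v 0)).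
  apply: le_trans (lincomb_le _ _) _; rewrite ler_pM ?sumr_ge0//.
  by apply: row_mx_norm_le => //; rewrite normr0.
have ci' : \forall s \near (0 : R)^'+, prod_img (i0, j0) (row_mx (c s) (chart j0 p.2)).
  by apply: filterS ci => s cs; split; rewrite /= ?row_mxKl ?row_mxKr//; exact: chart_img.
have cv' : s^-1 *: (row_mx (c s) (chart j0 p.2) - w p.1 p.2) @[s --> (0 : R)^'+] --> row_mx v 0.
  apply/subr_cvg0/cvgr0Pnorm_le => e e0.
  have /subr_cvg0/cvgr0Pnorm_le/(_ _ e0) := cv.
  apply: filterS => s hs; rewrite opp_row_mx add_row_mx subrr scale_row_mx scaler0.
  by rewrite opp_row_mx add_row_mx subrr; apply: row_mx_norm_le => //; rewrite normr0 ltW.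
have := curve_diff (GJ _ pw) ci' cv'.
rewrite /= /prod_param /= /w !row_mxKl !row_mxKr !chartK//.
by under eq_fun do rewrite row_mxKl row_mxKr chartK//.
Unshelve. all: by end_near. Qed.

Lemma qformE (G : 'M[R]_n) v :
  qform G v = \sum_(k < n) \sum_(l < n) v ord0 k * G k l * v ord0 l.
Proof.
rewrite /qform !mxE exchange_big /=; apply: eq_bigr => l _.
by rewrite !mxE mulr_suml.
Qed.

Lemma qformZ (G : 'M[R]_n) c v : qform G (c *: v) = c ^+ 2 * qform G v.
Proof.
rewrite !qformE mulr_sumr; apply: eq_bigr => k _; rewrite mulr_sumr.
by apply: eq_bigr => l _; rewrite !mxE; ring.
Qed.

Lemma qform0 (G : 'M[R]_n) : qform G 0 = 0.
Proof. by rewrite -(scale0r 0) qformZ expr0n/= mul0r. Qed.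

Lemma qformB_le (G H : 'M[R]_n) v (e : R) :
  (forall k l, `|G k l - H k l| <= e) ->
  `|qform G v - qform H v| <= e * n%:R ^+ 2 * `|v| ^+ 2.
Proof.
move=> h; rewrite !qformE -sumrB.
apply: (@le_trans _ _ (\sum_(k < n) \sum_(l < n) e * `|v| ^+ 2)).
  apply: le_trans (ler_norm_sum _ _ _) _; apply: ler_sum => k _.
  rewrite -sumrB; apply: le_trans (ler_norm_sum _ _ _) _; apply: ler_sum => l _.
  rewrite (_ : _ - _ = (G k l - H k l) * (v ord0 k * v ord0 l)); last by ring.
  rewrite normrM normrM expr2 ler_pM ?mulr_ge0//.
  by rewrite ler_pM// rV_coord_le.
rewrite !sumr_const !card_ord -[X in X <= _]mulr_natr -[X in X * _ <= _]mulr_natr.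
by rewrite le_eqVlt; apply/orP; left; apply/eqP; ring.
Qed.

Lemma gram_near i u (e : R) : 0 < e -> img i u ->
  \forall v \near u, img i v -> forall k l, `|gram i v k l - gram i u k l| <= e.
Proof.
move=> e0 iu.
have h (kl : 'I_n * 'I_n) : \forall v \near u, img i v ->
    `|gram i v kl.1 kl.2 - gram i u kl.1 kl.2| <= e.
  have /subspace_continuousP /(_ u iu) := @gram_continuous _ _ _ _ _ g i kl.1 kl.2.
  move=> /cvgrPdist_le /(_ _ e0).
  rewrite near_withinE; apply: filterS => v hv iv.
  by rewrite distrC; exact: hv.
have H : \forall v \near u, forall kl : 'I_n * 'I_n, img i v ->
    `|gram i v kl.1 kl.2 - gram i u kl.1 kl.2| <= e.
  exact: (@filter_forall _ _ (fun kl v => img i v ->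
    `|gram i v kl.1 kl.2 - gram i u kl.1 kl.2| <= e) (nbhs u) _ h).
by apply: filterS H => v hv iv k l; exact: (hv (k, l)).
Qed.

Lemma qform_continuous (G : 'M[R]_n) : continuous (qform G).
Proof.
have -> : qform G = (fun v => \sum_(k < n) \sum_(l < n) v ord0 k * G k l * v ord0 l).
  by apply/funext => v; rewrite qformE.
apply: continuous_big => [|k _]; first exact: add_continuous.
apply: continuous_big => [|l _ v]; first exact: add_continuous.
have cc i : {for v, continuous (fun v : 'rV[R]_n => v ord0 i)} by exact: coord_continuous.
by apply: (continuousM (continuousM (cc k) _) (cc l)); exact: cst_continuous.
Qed.

(** The form has a positive minimum on the compact unit sphere, and both sides are homogeneous of
    degree 2. The sphere is empty when n = 0. *)
Lemma gram_lower i u : img i u ->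
  exists2 c : R, 0 < c & forall v, `|v| ^+ 2 <= c * qform (gram i u) v.
Proof.
move=> iu; pose S := [set v : 'rV[R]_n | `|v| = 1].
have [S0|/set0P S0] := eqVneq S set0.
  exists 1 => // v; have [->|v0] := eqVneq v 0.
    by rewrite normr0 qform0 expr0n/= mulr0.
  exfalso; suff : S (`|v|^-1 *: v) by rewrite S0.
  by rewrite /S /= normrZ normfV normr_id mulVf// normr_eq0.
have Sc : compact S.
  apply: bounded_closed_compact.
    by exists 1; split => [|x x1 v /= ->]; [exact: num_real|exact: ltW].
  rewrite (_ : S = (fun v : 'rV[R]_n => `|v|) @^-1` [set 1]); last by [].
  apply: closed_comp; last exact: closed_eq.
  by move=> v _; exact: norm_continuous.
have cq : {within S, continuous (qform (gram i u))}.
  by apply: continuous_subspaceT; exact: qform_continuous.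
have [v0 /set_mem Sv0 hmin] := EVT_min_rV S0 Sc cq.
have q0 : 0 < qform (gram i u) v0.
  by apply: gram_pos => //; rewrite -normr_eq0 Sv0 oner_eq0.
exists (qform (gram i u) v0)^-1; first by rewrite invr_gt0.
move=> v; rewrite mulrC ler_pdivlMr//; have [->|vn0] := eqVneq v 0.
  by rewrite normr0 qform0 expr0n/= mul0r.
have vp : 0 < `|v| by rewrite normr_gt0.
have : qform (gram i u) v0 <= qform (gram i u) (`|v|^-1 *: v).
  apply: hmin; apply/mem_set; rewrite /S /= normrZ normfV normr_id mulVf//.
  by rewrite normr_eq0.
by rewrite qformZ exprVn ler_pdivlMl ?exprn_gt0.
Qed.

Lemma gram_lower_near i u : img i u ->
  exists2 c : R, 0 < c & \forall u' \near u, img i u' ->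
    forall v, `|v| ^+ 2 <= c * qform (gram i u') v.
Proof.
move=> iu; have [c c0 hc] := gram_lower iu; exists (2 * c); first by rewrite mulr_gt0.
(* By [qformB_le], entries within e change the form by at most e n^2 |v|^2. With e = 1 / (2 c N)
   this is at most half of the lower bound |v|^2 / c; the + 1 keeps N positive when n = 0. *)
pose N : R := n%:R ^+ 2 + 1.
have N0 : 0 < N by rewrite ltr_wpDl// exprn_ge0.
have e0 : 0 < (2 * c * N)^-1 by rewrite invr_gt0 !mulr_gt0.
apply: filterS (gram_near e0 iu) => u' hu' iu' v.
have := qformB_le v (hu' iu'); rewrite ler_norml => /andP[h _].
have h2 : (2 * c * N)^-1 * n%:R ^+ 2 * `|v| ^+ 2 <= (2 * c)^-1 * `|v| ^+ 2.
  rewrite ler_wpM2r ?exprn_ge0// invfM -mulrA ler_piMr ?invr_ge0 ?mulr_ge0 ?(ltW c0)//.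
  by rewrite mulrC ler_pdivrMr// mul1r /N lerDl.
have h3 := hc v.
have h4 : (2 * c)^-1 * `|v| ^+ 2 = `|v| ^+ 2 / (2 * c) by rewrite mulrC.
have h5 : qform (gram i u) v >= `|v| ^+ 2 / c by rewrite ler_pdivrMr// mulrC.
have h6 : `|v| ^+ 2 / c = 2 * (`|v| ^+ 2 / (2 * c)) by field; rewrite gt_eqF.
rewrite mulrC -ler_pdivrMr ?mulr_gt0//; lra.
Qed.

End atlas_calculus.

Section atlas_flow.
Context {R : realType} {Omega : topologicalType} {M : set Omega} {n : nat}.
Variables (a : c1_atlas (R := R) M n) (g : riemannian_metric a).
Hypothesis Mc : compact M.
Notation dom := (@dom R Omega M n a).
Notation img := (@img R Omega M n a).
Notation chart := (@chart R Omega M n a).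
Notation param := (@param R Omega M n a).
Notation gram := (@gram R Omega M n a g).

(** Compactness of M x M in near-covering form, with the bound itself as a parameter tending to +oo;
    monotonicity in the bound merges the local constants. One-variable statements use a dummy second
    point. *)
Lemma near_bound_compact (P : R -> Omega * Omega -> Prop) :
  (forall c c' p, c <= c' -> P c p -> P c' p) ->
  (forall x z, M x -> M z -> exists C : R,
     \forall p \near (x, z), M p.1 -> M p.2 -> P C p) ->
  exists C : R, forall x z, M x -> M z -> P C (x, z).
Proof.
move=> mono loc.
have MMc : compact (M `*` M) by exact: compact_setX.
have := (near_covering_withinP (M `*` M)).2 ((compact_near_coveringP _).1 MMc).
move=> /(_ R (pinfty_nbhs R) P) [].
  move=> [x z] /= [Mx Mz]; have [C hC] := loc _ _ Mx Mz.
  exists ([set p | M p.1 -> M p.2 -> P C p], [set C' | C <= C']).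
    by split => /=; [exact: hC|apply: nbhs_pinfty_ge; exact: num_real].
  by move=> [p C'] /= [h1 CC'] [Mp1 Mp2]; exact: mono CC' (h1 Mp1 Mp2).
move=> C0 [_ hC]; exists (C0 + 1) => x z Mx Mz.
by apply: hC => //; rewrite ltrDl.
Qed.

(** The atlas may be infinite and chart i is arbitrary, so no bound can be taken in chart i itself.
    The derivative along v is recomputed on the same line read in a fixed chart i0: [curve_bounded]
    controls it by the velocity there, the metric controls the velocity, and [gram_transition] makes
    the metric length the same in both charts. *)
Lemma diff_bounded H : curve_bounded a H -> exists C : R, forall x z i u J v,
  M z -> img i u -> param i u = x ->
  is_diff_within (img i) (fun u => H (param i u) z) u J ->
  qform (gram i u) v <= 1 -> `|lincomb J v| <= C.
Proof.
move=> HB.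
have [C hC] : exists C : R, forall x z, M x -> M z -> forall i u J v,
  img i u -> param i u = x ->
  is_diff_within (img i) (fun u => H (param i u) z) u J ->
  qform (gram i u) v <= 1 -> `|lincomb J v| <= C.
  apply: (near_bound_compact (P := fun C p => forall i u J v,
    img i u -> param i u = p.1 ->
    is_diff_within (img i) (fun u => H (param i u) p.2) u J ->
    qform (gram i u) v <= 1 -> `|lincomb J v| <= C)).
    by move=> c c' p cc' h i u J v iu ux hJ qv; exact: le_trans (h i u J v iu ux hJ qv) cc'.
  move=> x0 z0 Mx0 Mz0; have [i0 _ ix0] := dom_cover a Mx0.
  have [C hC] := HB _ _ _ ix0 Mz0.
  have [c c0 hc] := gram_lower_near g (chart_img ix0).
  have hc' : \forall x \near x0, M x -> img i0 (chart i0 x) ->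
      forall v, `|v| ^+ 2 <= c * qform (gram i0 (chart i0 x)) v.
    by have := chart_cvg ix0 hc; rewrite /= nbhs_simpl.
  exists (`|C| * Num.sqrt c).
  apply: filterS2 hC (near_fst z0 hc') => -[x z] /= hC {}hc' Mx Mz i u J.
  have [ix hcurve] := hC Mx Mz.
  (* A line in direction v is known to stay in the chart image only for v in the half-space;
     otherwise - v is in it, and the hypothesis and the bound are even in v. *)
  suff key v : half_space v -> img i u -> param i u = x ->
      is_diff_within (img i) (fun u => H (param i u) z) u J ->
      qform (gram i u) v <= 1 -> `|lincomb J v| <= `|C| * Num.sqrt c.
    move=> v iu ux hJ qv; have [hv|hv] := half_space_or v; first exact: key.
    rewrite -normrN -lincombN; apply: key => //.
    by rewrite -scaleN1r qformZ sqrrN expr1n mul1r.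
  move=> hv iu ux hJ qv.
  have [U oU imgE] := @img_open _ _ _ _ a i.
  have iv := half_space_inward oU imgE iu hv.
  have [Jt [Jtau _]] := @transition_C1 _ _ _ _ a i i0.
  have iu' : (img i `&` param i @^-1` dom i0) u by split => //=; rewrite ux.
  have line0 := @line_cvg _ _ u v.
  have iv0 : \forall s \near (0 : R)^'+, (img i `&` param i @^-1` dom i0) (u + s *: v).
    have cu := curve_cvg line0.
    have hp : \forall w \near u, img i w -> dom i0 (param i w).
      have ix' : dom i0 (param i u) by rewrite ux.
      have Hw : \forall w \near u, img i w -> M (param i w) -> dom i0 (param i w).
        by have := param_cvg iu (dom_near ix'); rewrite /= nbhs_simpl.
      by apply: filterS Hw => w h iw; apply: h => //; exact: param_M.
    have := cu _ hp; rewrite /= => hp'.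
    apply: filterS2 iv hp' => s h1 h2; split => //; exact: h2.
  have Jtu := Jtau u iu'.
  have cv' := curve_diff Jtu iv0 line0.
  rewrite /= ux in cv'.
  have ci' : \forall s \near (0 : R)^'+, img i0 (chart i0 (param i (u + s *: v))).
    by apply: filterS iv0 => s [_ h]; exact: chart_img.
  have [l ll hl] := hcurve _ _ ci' cv'.
  have hJl := curve_diff hJ iv line0.
  have -> : lincomb J v = l.
    apply: cvg_unique hJl _; first exact: norm_hausdorff.
    apply: cvg_trans hl; apply: near_eq_cvg; near=> s.
    have [_ ds] : (img i `&` param i @^-1` dom i0) (u + s *: v) by near: s.
    by rewrite /= chartK// ux.
  apply: le_trans ll _; apply: (@le_trans _ _ (`|C| * `|lincomb (Jt u) v|)).
    by rewrite ler_wpM2r// ler_norm.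
  rewrite ler_wpM2l// -ler_sqr ?nnegrE ?sqrtr_ge0// sqr_sqrtr ?(ltW c0)//.
  apply: le_trans (hc' Mx (chart_img ix) _) _.
  have -> : chart i0 x = chart i0 (param i u) by rewrite ux.
  rewrite -(gram_transition g v iu _ Jtu); last by rewrite ux.
  by rewrite ler_piMr// ltW.
exists C => x z i u J v Mz iu ux; apply: (hC x z) => //.
by rewrite -ux; exact: param_M.
Unshelve. all: by end_near. Qed.

(** * The derivative along the flow *)

Section flow.
Variable Phi : R -> Omega -> Omega.
Hypothesis hPhi : continuous_flow Phi.
Hypothesis hMfwd : forall (t : R) x, 0 <= t -> M x -> M (Phi t x).
Hypothesis hPhiC1 : C1_flow a Phi.

Lemma flow_cvg_right x : Phi t x @[t --> (0 : R)^'+] --> x.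
Proof.
have [P0 _ Pc] := hPhi; rewrite -[X in _ --> X]P0.
have h1 : (t : R) @[t --> (0 : R)^'+] --> (0 : R).
  by apply: cvg_at_right_filter; exact: cvg_id.
have h2 : x @[t --> (0 : R)^'+] --> x by exact: cvg_cst.
have H : (t, x) @[t --> (0 : R)^'+] --> ((0 : R), x) by refine (cvg_pair h1 h2).
by refine (continuous_cvg _ (Pc (0, x)) H).
Qed.

Lemma flow_dom_right i x : dom i x -> \forall t \near (0 : R)^'+, dom i (Phi t x).
Proof.
move=> ix; have := flow_cvg_right (dom_near ix); rewrite /= => h.
near=> t; have h1 : M (Phi t x) -> dom i (Phi t x) by near: t.
by apply: h1; apply: hMfwd; [near: t; exact: nbhs_right_ge|exact: dom_sub ix].
Unshelve. all: by end_near. Qed.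

(** The velocity is the time derivative of the flow read in the chart, taken along s -> (s, chart x)
    at s = 0; continuity of the partial derivatives bounds it locally. *)
Lemma velocity_near i0 x0 : dom i0 x0 -> exists C : R, \forall x \near x0, M x ->
  dom i0 x /\ exists2 V : 'rV[R]_n,
    s^-1 *: (chart i0 (Phi s x) - chart i0 x) @[s --> (0 : R)^'+] --> V &
    `|V| <= C.
Proof.
move=> ix0; have [J [JP cJ]] := hPhiC1 i0 i0.
have [P0 _ _] := hPhi.
pose w x := row_mx (0 : 'rV[R]_1) (chart i0 x).
set A := [set w : 'rV[R]_(1 + n) | _] in JP cJ.
have Aw x : dom i0 x -> A (w x).
  move=> ix; rewrite /A /= row_mxKl row_mxKr mxE; split => //; first exact: chart_img.
  by rewrite P0 chartK.
have [C hC] := sum_within_bounded cJ (Aw _ ix0).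
exists C; have /nbhs_ballP[r /= r0 hr] := hC.
have r2 : 0 < r / 2 by rewrite divr_gt0.
have h1 := chart_near r2 ix0.
have h2 := dom_near ix0.
near=> x => Mx.
have ix : dom i0 x by move: Mx; near: x.
split => //.
pose c (s : R) := row_mx (const_mx s : 'rV[R]_1) (chart i0 x).
have cA : \forall s \near (0 : R)^'+, A (c s).
  near=> s; rewrite /A /= row_mxKl row_mxKr mxE; split.
  - by near: s; exact: nbhs_right_ge.
  - exact: chart_img.
  - by rewrite chartK//; near: s; exact: flow_dom_right.
have cV : s^-1 *: (c s - w x) @[s --> (0 : R)^'+] --> row_mx (const_mx 1 : 'rV[R]_1) (0 : 'rV[R]_n).
  apply: cvg_near_cst; near=> s.
  have s0 : s != 0 by apply: lt0r_neq0; near: s; exact: nbhs_right_gt.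
  rewrite opp_row_mx add_row_mx subrr oppr0 addr0 scale_row_mx scaler0; congr row_mx.
  by apply/rowP => i; rewrite !mxE mulVf.
exists (lincomb (J (w x)) (row_mx (const_mx 1 : 'rV[R]_1) (0 : 'rV[R]_n))).
  have := curve_diff (JP _ (Aw _ ix)) cA cV.
  rewrite /c /w !row_mxKl !row_mxKr mxE P0 chartK//.
  by under eq_fun do rewrite row_mxKl row_mxKr mxE chartK//.
apply: le_trans (lincomb_le _ _) _.
have Cle : \sum_(j < 1 + n) `|J (w x) j| <= C.
  apply: (hr (w x)); last exact: Aw.
  rewrite -ball_normE /= opp_row_mx add_row_mx subrr; apply: (@le_lt_trans _ _ (r / 2)).
    apply: row_mx_norm_le; first by rewrite normr0 ltW.
    by rewrite distrC; move: Mx; near: x.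
  by rewrite ltr_pdivrMr// ltr_pMr// ltr1n.
apply: le_trans Cle; rewrite ler_piMr ?sumr_ge0//.
apply: row_mx_norm_le; last by rewrite normr0.
by apply: rV_norm_le => // i; rewrite mxE normr1.
Unshelve. all: by end_near. Qed.

(** The constant bounds the metric length of the velocity field over the compact M, so the
    derivative of f along it is at most that length times N. This makes the set in [dirder_norm]
    bounded, hence its [sup] a true supremum. *)
Lemma dirder_bounded : exists C : R, 0 <= C /\ forall f : Omega -> R, C1_M a f ->
  forall N : R, (forall i u v J, img i u -> qform (gram i u) v <= 1 ->
     is_diff_within (img i) (f \o param i) u J -> `|lincomb J v| <= N) ->
  forall x, M x -> `|dirder Phi f x| <= C * N /\
    (f (Phi t x) - f x) / t @[t --> (0 : R)^'+] --> dirder Phi f x.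
Proof.
have [C hC] : exists C : R, forall x z, M x -> M z -> exists i0, dom i0 x /\
  exists2 V : 'rV[R]_n,
    s^-1 *: (chart i0 (Phi s x) - chart i0 x) @[s --> (0 : R)^'+] --> V &
    qform (gram i0 (chart i0 x)) V <= C.
  apply: (near_bound_compact (P := fun C p => exists i0, dom i0 p.1 /\
  exists2 V : 'rV[R]_n,
    s^-1 *: (chart i0 (Phi s p.1) - chart i0 p.1) @[s --> (0 : R)^'+] --> V &
    qform (gram i0 (chart i0 p.1)) V <= C)).
    by move=> c c' p cc' [i0 [ip [V hV qV]]]; exists i0; split => //; exists V => //;
      exact: le_trans qV cc'.
  move=> x0 z0 Mx0 _; have [i0 _ ix0] := dom_cover a Mx0.
  have [C hC] := velocity_near ix0.
  have iu0 := chart_img ix0.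
  pose E := \sum_(k < n) \sum_(l < n) `|gram i0 (chart i0 x0) k l|.
  have hg : \forall x \near x0, M x -> img i0 (chart i0 x) -> forall k l,
      `|gram i0 (chart i0 x) k l - gram i0 (chart i0 x0) k l| <= 1.
    by have := chart_cvg ix0 (gram_near g ltr01 iu0); rewrite /= nbhs_simpl.
  (* E bounds the form at x0, where |V| <= C; the second term is [qformB_le] for Gram entries that
     have moved by at most 1. *)
  exists (E * C ^+ 2 + 1 * n%:R ^+ 2 * C ^+ 2).
  apply: filterS (near_fst z0 (filterI hC hg)) => -[x z] /= [{}hC {}hg] Mx Mz.
  have [ix [V hV VC]] := hC Mx; exists i0; split => //; exists V => //.
  have C0 : 0 <= C by exact: le_trans VC.
  have := qformB_le V (hg Mx (chart_img ix)); rewrite ler_norml => /andP[_].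
  rewrite lerBlDl => /le_trans; apply; apply: lerD; last first.
    by rewrite ler_wpM2l ?mulr_ge0 ?exprn_ge0// ler_sqr ?nnegrE.
  rewrite qformE mulr_suml; apply: ler_sum => k _; rewrite mulr_suml.
  apply: ler_sum => l _; apply: le_trans (ler_norm _) _.
  rewrite mulrAC mulrC !normrM ler_wpM2l// expr2.
  by rewrite ler_pM// (le_trans (rV_coord_le _ _)).
exists (Num.sqrt C); split; first exact: sqrtr_ge0.
move=> f fC N hN x Mx; have [i0 [ix [V hV qV]]] := hC x x Mx Mx.
have [J [fJ _]] := fC i0; have iu := chart_img ix.
have ci : \forall s \near (0 : R)^'+, img i0 (chart i0 (Phi s x)).
  by apply: filterS (flow_dom_right ix) => s; exact: chart_img.
have hd : (f (Phi t x) - f x) / t @[t --> (0 : R)^'+] --> lincomb (J (chart i0 x)) V.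
  apply: cvg_trans (curve_diff (fJ _ iu) ci hV); apply: near_eq_cvg.
  near=> s; rewrite /= !chartK//; first by rewrite mulrC.
  by near: s; exact: flow_dom_right.
have dE : dirder Phi f x = lincomb (J (chart i0 x)) V.
  by apply: cvg_lim => //; exact: norm_hausdorff.
rewrite dE; split => //.
have N0 : 0 <= N.
  have q0 : qform (gram i0 (chart i0 x)) 0 <= 1 by rewrite qform0.
  exact: le_trans (hN _ _ _ _ iu q0 (fJ _ iu)).
have [->|V0] := eqVneq V 0.
  by rewrite lincomb0 normr0 mulr_ge0// sqrtr_ge0.
set q := qform (gram i0 (chart i0 x)) V in qV.
have q0 : 0 < q by exact: gram_pos.
have sq0 : 0 < Num.sqrt q by rewrite sqrtr_gt0.
have h1 : `|lincomb (J (chart i0 x)) ((Num.sqrt q)^-1 *: V)| <= N.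
  apply: (hN _ _ _ _ iu _ (fJ _ iu)).
  by rewrite qformZ exprVn sqr_sqrtr ?(ltW q0)// mulVf// gt_eqF.
move: h1; rewrite lincombZ normrZ gtr0_norm ?invr_gt0// ler_pdivrMl// => h1.
by apply: le_trans h1 _; rewrite ler_wpM2r// ler_wsqrtr.
Unshelve. all: by end_near. Qed.

End flow.
End atlas_flow.

(** * Finiteness of the C^1 norms, and derivatives of the slices G(., y) *)

Section C1_norms.
Context {R : realType} {Omega : topologicalType} {M : set Omega} {n : nat}.
Variables (a : c1_atlas (R := R) M n) (g : riemannian_metric a).
Hypothesis Mc : compact M.
Notation dom := (@dom R Omega M n a).
Notation img := (@img R Omega M n a).
Notation chart := (@chart R Omega M n a).
Notation param := (@param R Omega M n a).
Notation gram := (@gram R Omega M n a g).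

Lemma lincomb_row_mx (p q : nat) (W : normedModType R) (J : 'I_(p + q) -> W)
    (v : 'rV[R]_p) (w : 'rV[R]_q) :
  lincomb J (row_mx v w) =
  lincomb (fun k => J (lshift q k)) v + lincomb (fun k => J (rshift p k)) w.
Proof.
rewrite /lincomb big_split_ord /=; congr (_ + _); apply: eq_bigr => k _.
  by rewrite row_mxEl.
by rewrite row_mxEr.
Qed.

Lemma is_diff_withinZ (m : nat) (A : set 'rV[R]_m) (f : 'rV[R]_m -> R) (u : 'rV[R]_m)
    J (c : R) : is_diff_within A f u J ->
  is_diff_within A (fun v => c * f v) u (fun k => c * J k).
Proof.
move=> h e e0; have c0 : 0 < `|c| + 1 by rewrite ltr_wpDl.
have H := h _ (divr_gt0 e0 c0); rewrite !near_withinE in H *.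
apply: filterS H => v hv Av.
have -> : lincomb (fun k => c * J k) (v - u) = c * lincomb J (v - u).
  by rewrite /lincomb mulr_sumr; apply: eq_bigr => k _; rewrite /GRing.scale/= mulrCA.
rewrite -!mulrBr normrM; apply: (@le_trans _ _ (`|c| * (e / (`|c| + 1) * `|v - u|))).
  by rewrite ler_wpM2l// hv.
rewrite mulrA ler_wpM2r// mulrCA ler_piMr ?(ltW e0)//.
by rewrite ler_pdivrMr// mul1r lerDl.
Qed.

Lemma C1_M_scale (f : Omega -> R) c : C1_M a f -> C1_M a (fun x => c * f x).
Proof.
move=> fC i; have [J [fJ cJ]] := fC i.
exists (fun u k => c * J u k); split; first by move=> u iu; exact: is_diff_withinZ (fJ u iu).
by move=> j x; apply: cvgMr; exact: cJ.
Qed.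

Lemma C1_M_bounded (f : Omega -> R) : C1_M a f ->
  has_ubound [set `|f x| | x in M].
Proof.
move=> fC; suff [C hC] : exists C : R, forall x z, M x -> M z -> `|f x| <= C.
  by exists C => _ [x Mx <-]; exact: (hC _ _ Mx Mx).
apply: (near_bound_compact Mc (P := fun C p => `|f p.1| <= C)).
  by move=> c c' p cc' h; exact: le_trans cc'.
move=> x0 z0 Mx0 _; have [i _ ix] := dom_cover a Mx0.
have [J [fJ _]] := fC i; have iu := chart_img ix.
have h1 := fJ _ iu _ ltr01.
have h2 : \forall x \near x0, M x -> img i (chart i x) ->
   `|f (param i (chart i x)) - f (param i (chart i x0)) - lincomb (J (chart i x0)) (chart i x - chart i x0)| <=
   1 * `|chart i x - chart i x0|.
  by have := chart_cvg ix h1; rewrite /= nbhs_simpl.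
have h3 := chart_near ltr01 ix.
exists (`|f x0| + (\sum_(k < n) `|J (chart i x0) k| + 1)).
apply: filterS3 (near_fst z0 h2) (near_fst z0 h3) (near_fst z0 (dom_near ix)).
move=> [x z] /= {}h2 {}h3 dx Mx _.
have {}dx := dx Mx; have := h2 Mx (chart_img dx); rewrite !chartK// mul1r => h.
have h5 := h3 Mx.
rewrite (_ : f x = f x0 + (lincomb (J (chart i x0)) (chart i x - chart i x0) +
   (f x - f x0 - lincomb (J (chart i x0)) (chart i x - chart i x0)))); last by ring.
rewrite (le_trans (ler_normD _ _))// lerD//.
rewrite (le_trans (ler_normD _ _))// lerD//; last exact: le_trans h h5.
by rewrite (le_trans (lincomb_le _ _))// ler_piMr// sumr_ge0.
Qed.

Definition diff_values (f : Omega -> R) := [set r : R | exists i u v J,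
  [/\ img i u, qform (gram i u) v <= 1,
      is_diff_within (img i) (f \o param i) u J & r = `|lincomb J v| ] ].

Lemma normC1_ME f : normC1_M g f = sup [set `|f x| | x in M] + sup (diff_values f).
Proof. by []. Qed.

Lemma diff_values_bounded (f : Omega -> R) : C1_M a f -> has_ubound (diff_values f).
Proof.
move=> fC; have [C hC] := diff_bounded g Mc (C1_M_curve_bounded fC).
exists C => _ [i [u [v [J [iu qv fJ ->]]]]].
by apply: (hC (param i u) (param i u) i u J v) => //; exact: param_M iu.
Qed.

Lemma sup_norm_ge0 (S : Type) (D : set S) (f : S -> R) :
  has_ubound [set `|f x| | x in D] -> 0 <= sup [set `|f x| | x in D].
Proof.
move=> ub; have [->|/set0P[x Dx]] := eqVneq D set0.
  by rewrite image_set0 sup0.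
apply: (@le_trans _ _ `|f x|) => //; apply: ub_le_sup => //.
by exists x.
Qed.

Lemma normC1_M_diff f i u v J : C1_M a f -> img i u -> qform (gram i u) v <= 1 ->
  is_diff_within (img i) (f \o param i) u J -> `|lincomb J v| <= normC1_M g f.
Proof.
move=> fC iu qv fJ; rewrite normC1_ME -[leLHS]add0r lerD//.
  by apply: sup_norm_ge0; exact: C1_M_bounded.
apply: ub_le_sup; first exact: diff_values_bounded.
by exists i, u, v, J; split.
Qed.

Section symmetric_function.
Variable G : Omega * Omega -> R.
Hypothesis Gc : continuous G.
Hypothesis GC1 : C1_MM a G.
Hypothesis Gsym : forall x y, G (x, y) = G (y, x).

Lemma is_diff_partiall i j (w : 'rV[R]_(n + n)) J : prod_img (i, j) w ->
  is_diff_within (prod_img (i, j)) (G \o prod_param (i, j)) w J ->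
  is_diff_within (img i) (fun u => G (param i u, param j (rsubmx w))) (lsubmx w)
    (fun k => J (lshift n k)).
Proof.
move=> [wi wj] h e e0; have /nbhs_ballP[r /= r0 hr] := h e e0.
apply/nbhs_ballP; exists r => //= u ur iu.
have wE : row_mx (lsubmx w) (rsubmx w) = w by exact: hsubmxK.
have hh : `|G (param i u, param j (rsubmx w)) - G (param i (lsubmx w), param j (rsubmx w)) -
    lincomb J (row_mx u (rsubmx w) - w)| <= e * `|row_mx u (rsubmx w) - w|.
  have := hr (row_mx u (rsubmx w)); rewrite /= /prod_param /= !row_mxKl !row_mxKr.
  apply; last by split; rewrite /= ?row_mxKl ?row_mxKr.
  rewrite -ball_normE /= -{1}wE opp_row_mx add_row_mx subrr.
  apply: (@le_lt_trans _ _ `|lsubmx w - u|).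
    by apply: row_mx_norm_le; rewrite ?normr0.
  by move: ur; rewrite -ball_normE.
have dE : row_mx u (rsubmx w) - w = row_mx (u - lsubmx w) 0.
  by rewrite -{2}wE opp_row_mx add_row_mx subrr.
rewrite dE lincomb_row_mx lincomb0 addr0 in hh.
apply: le_trans hh _; rewrite ler_wpM2l ?(ltW e0)//.
by apply: row_mx_norm_le; rewrite ?normr0.
Qed.

Lemma is_diff_partialr i j (w : 'rV[R]_(n + n)) J : prod_img (i, j) w ->
  is_diff_within (prod_img (i, j)) (G \o prod_param (i, j)) w J ->
  is_diff_within (img j) (fun u => G (param i (lsubmx w), param j u)) (rsubmx w)
    (fun k => J (rshift n k)).
Proof.
move=> [wi wj] h e e0; have /nbhs_ballP[r /= r0 hr] := h e e0.
apply/nbhs_ballP; exists r => //= u ur iu.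
have wE : row_mx (lsubmx w) (rsubmx w) = w by exact: hsubmxK.
have hh : `|G (param i (lsubmx w), param j u) - G (param i (lsubmx w), param j (rsubmx w)) -
    lincomb J (row_mx (lsubmx w) u - w)| <= e * `|row_mx (lsubmx w) u - w|.
  have := hr (row_mx (lsubmx w) u); rewrite /= /prod_param /= !row_mxKl !row_mxKr.
  apply; last by split; rewrite /= ?row_mxKl ?row_mxKr.
  rewrite -ball_normE /= -{1}wE opp_row_mx add_row_mx subrr.
  apply: (@le_lt_trans _ _ `|rsubmx w - u|).
    by apply: row_mx_norm_le; rewrite ?normr0.
  by move: ur; rewrite -ball_normE.
have dE : row_mx (lsubmx w) u - w = row_mx 0 (u - rsubmx w).
  by rewrite -{2}wE opp_row_mx add_row_mx subrr.
rewrite dE lincomb_row_mx lincomb0 add0r in hh.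
apply: le_trans hh _; rewrite ler_wpM2l ?(ltW e0)//.
by apply: row_mx_norm_le; rewrite ?normr0.
Qed.

Lemma C1_M_slice y : M y -> C1_M a (fun x => G (x, y)).
Proof.
move=> My i; have [j _ jy] := dom_cover a My.
have [J [GJ cJ]] := GC1 (i, j).
have pw u : img i u -> prod_img (i, j) (row_mx u (chart j y)).
  by move=> iu; split; rewrite /= ?row_mxKl ?row_mxKr//; exact: chart_img.
exists (fun u k => J (row_mx u (chart j y)) (lshift n k)); split.
  move=> u iu; have := is_diff_partiall (pw _ iu) (GJ _ (pw _ iu)).
  by rewrite row_mxKl row_mxKr chartK.
move=> k; apply/subspace_continuousP => u iu.
have /subspace_continuousP /(_ _ (pw u iu)) h := cJ (lshift n k).
apply/cvgrPdist_le => e e0; move/cvgrPdist_le : h => /(_ _ e0).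
rewrite !near_withinE => /nbhs_ballP[r /= r0 hr].
apply/nbhs_ballP; exists r => //= v uv iv; apply: (hr (row_mx v (chart j y))).
  rewrite -ball_normE /= opp_row_mx add_row_mx subrr.
  apply: (@le_lt_trans _ _ `|u - v|).
    by apply: row_mx_norm_le; rewrite ?normr0.
  by move: uv; rewrite -ball_normE.
exact: pw.
Qed.

Definition diff_valuesMM := [set r : R | exists ij w v J,
  [/\ prod_img ij w, qform (gram ij.1 (lsubmx w)) (lsubmx v) +
                   qform (gram ij.2 (rsubmx w)) (rsubmx v) <= 1,
      is_diff_within (prod_img ij) (G \o prod_param (a := a) ij) w J & r = `|lincomb J v| ] ].

Lemma normC1_MME :
  normC1_MM g G = sup [set `|G p| | p in M `*` M] + sup diff_valuesMM.
Proof. by []. Qed.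

Lemma qform_ge0 i u v : img i u -> 0 <= qform (gram i u) v.
Proof.
move=> iu; have [->|v0] := eqVneq v 0; first by rewrite qform0.
by rewrite ltW// gram_pos.
Qed.

(** A unit tangent vector of the product has two components of length at most 1. [diff_bounded]
    handles the first variable, and symmetry of G transfers the bound to the second. *)
Lemma diff_valuesMM_bounded : has_ubound diff_valuesMM.
Proof.
have [C hC] := diff_bounded g Mc (C1_MM_curve_bounded GC1).
exists (C + C) => _ [[i j] [w [v [J [/= wij qv GJ ->]]]]].
have [wi wj] := wij.
have q1 := qform_ge0 (lsubmx v) wi; have q2 := qform_ge0 (rsubmx v) wj.
rewrite -(hsubmxK v) lincomb_row_mx (le_trans (ler_normD _ _))// lerD//.
  apply: (hC _ (param j (rsubmx w)) i (lsubmx w) _ _ _ wi erefl).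
  - exact: param_M wj.
  - exact: (is_diff_partiall wij GJ).
  - rewrite /= in q1 q2 qv *; lra.
apply: (hC _ (param i (lsubmx w)) j (rsubmx w) _ _ _ wj erefl).
- exact: param_M wi.
- by under eq_fun do rewrite Gsym; exact: (is_diff_partialr wij GJ).
- rewrite /= in q1 q2 qv *; lra.
Qed.

Lemma sup_normMM_bounded : has_ubound [set `|G p| | p in M `*` M].
Proof.
have MMc : compact (M `*` M) by exact: compact_setX.
have [C [Cr hC]] := compact_bounded (continuous_compact (continuous_subspaceT Gc) MMc).
by exists (C + 1) => _ [p Mp <-]; apply: hC; [rewrite ltrDl|exists p].
Qed.

(** The tangent vector (v, 0) of M x M is the witness. J need not come from the differential of G,
    but differentials along the half-space are unique as linear maps. *)
Lemma slice_diff_le y i u v J : M y -> img i u -> qform (gram i u) v <= 1 ->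
  is_diff_within (img i) ((fun x => G (x, y)) \o param i) u J ->
  `|lincomb J v| <= sup diff_valuesMM.
Proof.
move=> My iu qv GJ; have [j _ jy] := dom_cover a My.
have [JJ [GJJ _]] := GC1 (i, j).
have pw : prod_img (i, j) (row_mx u (chart j y)).
  by split; rewrite /= ?row_mxKl ?row_mxKr//; exact: chart_img.
apply: ub_le_sup; first exact: diff_valuesMM_bounded.
exists (i, j), (row_mx u (chart j y)), (row_mx v 0), (JJ (row_mx u (chart j y))).
split => //=; first by rewrite !row_mxKl !row_mxKr qform0 addr0.
  exact: GJJ.
rewrite lincomb_row_mx lincomb0 addr0; congr `|_|.
have [U oU imgE] := @img_open _ _ _ _ a i.
apply: (is_diff_within_unique oU imgE iu GJ).
have := is_diff_partiall pw (GJJ _ pw).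
by rewrite row_mxKl row_mxKr chartK.
Qed.

Section flow.
Variable Phi : R -> Omega -> Omega.
Hypothesis hPhi : continuous_flow Phi.
Hypothesis hMfwd : forall (t : R) x, 0 <= t -> M x -> M (Phi t x).
Hypothesis hPhiC1 : C1_flow a Phi.

Lemma dirder_norm_ge f x : C1_M a f -> normC1_M g f <= 1 -> M x ->
  `|dirder Phi f x| <= dirder_norm g Phi.
Proof.
move=> fC f1 Mx; apply: ub_le_sup; last by exists f, x.
have [C [C0 hC]] := dirder_bounded g Mc hPhi hMfwd hPhiC1.
exists C => _ [f' [x' [fC' f1' Mx' ->]]].
have N1 i u v J : img i u -> qform (gram i u) v <= 1 ->
    is_diff_within (img i) (f' \o param i) u J -> `|lincomb J v| <= 1.
  by move=> iu qv fJ; apply: le_trans f1'; exact: normC1_M_diff iu qv fJ.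
by have [h _] := hC f' fC' 1 N1 x' Mx'; rewrite mulr1 in h.
Qed.

Lemma dirder_norm_ge0 : 0 <= dirder_norm g Phi.
Proof.
rewrite /dirder_norm; set S := (X in sup X).
have [->|/set0P[r Sr]] := eqVneq S set0; first by rewrite sup0.
have [f [x [fC f1 Mx rE]]] := Sr.
by apply: le_trans (dirder_norm_ge fC f1 Mx).
Qed.

Lemma normC1_MM_ge0 : 0 <= normC1_MM g G.
Proof.
rewrite normC1_MME addr_ge0//; first by apply: sup_norm_ge0; exact: sup_normMM_bounded.
have [->|/set0P[r Sr]] := eqVneq diff_valuesMM set0; first by rewrite sup0.
apply: (@le_trans _ _ r); first by have [ij [w [v [J [_ _ _ ->]]]]] := Sr.
by apply: ub_le_sup => //; exact: diff_valuesMM_bounded.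
Qed.

(** Dividing the slice by N puts it in the unit ball of C^1(M), where the operator norm of the
    directional derivative applies. *)
Lemma slice_derivative x y : M x -> M y -> exists2 l : R,
  `|l| <= dirder_norm g Phi * normC1_MM g G &
  (G (Phi t x, y) - G (x, y)) / t @[t --> (0 : R)^'+] --> l.
Proof.
move=> Mx My; set N := normC1_MM g G.
have [C [C0 hC]] := dirder_bounded g Mc hPhi hMfwd hPhiC1.
have fC := C1_M_slice My.
have [_ hd] := hC _ fC _ (fun i u v J iu qv => @slice_diff_le y i u v J My iu qv) x Mx.
exists (dirder Phi (fun x => G (x, y)) x) => //.
have s2 : 0 <= sup diff_valuesMM.
  have [i _ ix] := dom_cover a Mx; have [J [fJ _]] := fC i.
  have iu := chart_img ix.
  have := @slice_diff_le y i _ 0 _ My iu _ (fJ _ iu); rewrite qform0 ler01 => /(_ isT).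
  exact: le_trans.
have s1 x' : M x' -> `|G (x', y)| <= sup [set `|G p| | p in M `*` M].
  by move=> Mx'; apply: ub_le_sup; [exact: sup_normMM_bounded|exists (x', y)].
(* When N = 0 no normalization is possible, but then G vanishes on M x M and so does the
   derivative. *)
have := normC1_MM_ge0; rewrite -/N le_eqVlt => /orP[/eqP N0|N0].
  have G0 x' : M x' -> G (x', y) = 0.
    move=> Mx'; apply/eqP; rewrite -normr_le0 (le_trans (s1 _ Mx'))//.
    by rewrite N0 /N normC1_MME lerDl.
  suff -> : dirder Phi (fun x => G (x, y)) x = 0.
    by rewrite normr0 -N0 mulr0.
  apply: cvg_lim; first exact: norm_hausdorff.
  apply: cvg_near_cst; near=> t.
  by rewrite !G0 ?subrr ?mul0r//; apply: hMfwd => //; near: t; exact: nbhs_right_ge.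
have fCN := C1_M_scale N^-1 fC.
have hdN : (N^-1 * G (Phi t x, y) - N^-1 * G (x, y)) / t @[t --> (0 : R)^'+] -->
    N^-1 * dirder Phi (fun x => G (x, y)) x.
  rewrite (_ : (fun t => _) = (fun t => N^-1 * ((G (Phi t x, y) - G (x, y)) / t))).
    exact: cvgMr.
  by apply/funext => t; ring.
have dN : dirder Phi (fun x => N^-1 * G (x, y)) x = N^-1 * dirder Phi (fun x => G (x, y)) x.
  by apply: cvg_lim => //; exact: norm_hausdorff.
have := @dirder_norm_ge (fun x => N^-1 * G (x, y)) x fCN _ Mx.
rewrite dN normrM gtr0_norm ?invr_gt0// ler_pdivrMl// mulrC; apply.
rewrite normC1_ME.
have -> : 1 = N^-1 * sup [set `|G p| | p in M `*` M] + N^-1 * sup diff_valuesMM.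
  by rewrite -mulrDr -normC1_MME mulVf// gt_eqF.
apply: lerD.
  apply: ge_sup; first by exists `|N^-1 * G (x, y)|; exists x.
  move=> _ [x' Mx' <-]; rewrite normrM gtr0_norm ?invr_gt0//.
  by rewrite ler_pM2l ?invr_gt0// s1.
set S := diff_values _; have [->|/set0P S0] := eqVneq S set0.
  by rewrite sup0 mulr_ge0// invr_ge0 ltW.
apply: ge_sup => // _ [i [u [v [J [iu qv fJ ->]]]]].
rewrite ler_pdivlMl//.
have fJ' : is_diff_within (img i) ((fun x => G (x, y)) \o param i) u (fun k => N * J k).
  have := is_diff_withinZ N fJ; congr is_diff_within.
  by apply/funext => w /=; rewrite mulVKf// gt_eqF.
have := slice_diff_le My iu qv fJ'; apply: le_trans.
have -> : lincomb (fun k => N * J k) v = N * lincomb J v.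
  by rewrite /lincomb mulr_sumr; apply: eq_bigr => k _; rewrite /GRing.scale/= mulrCA.
by rewrite normrM gtr0_norm.
Unshelve. all: by end_near. Qed.

End flow.
End symmetric_function.
End C1_norms.

(** * Delay-averaged kernels *)

Section real_line.
Context {R : realType}.
Local Notation leb := (@lebesgue_measure R).
Implicit Types (u f : R -> R).

(** The mean value theorem needs two-sided derivatives. Instead, with slack e', let S be the set of
    r in [0, t] such that the bound holds on all of [0, r]. Continuity puts sup S in S, and the
    right derivative there carries the bound further unless sup S = t. *)
Lemma right_derivative_lipschitz f (L : R) : continuous f ->
  (forall t, 0 <= t -> exists2 l : R, `|l| <= L &
     (f (s + t) - f t) / s @[s --> (0 : R)^'+] --> l) ->
  forall t, 0 <= t -> `|f t - f 0| <= L * t.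
Proof.
move=> cf df t t0; apply/ler_addgt0Pr => e e0.
suff H e' : 0 < e' -> `|f t - f 0| <= (L + e') * t.
  have t1 : 0 < t + 1 by rewrite ltr_wpDl.
  apply: le_trans (H _ (divr_gt0 e0 t1)) _; rewrite mulrDl lerD2l.
  by rewrite mulrAC ler_pdivrMr// ler_wpM2l ?(ltW e0)// lerDl.
move=> {e0}e0.
pose S := [set r : R | 0 <= r <= t /\ forall s, 0 <= s <= r -> `|f s - f 0| <= (L + e') * s].
have S0 : S 0.
  split; first by rewrite lexx t0.
  by move=> s /le_anti <-; rewrite subrr normr0 mulr0.
have supS : has_sup S.
  by split; [exists 0|exists t => r [/andP[]]].
set c := sup S.
have c0 : 0 <= c by apply: sup_upper_bound.
have ct : c <= t by apply: ge_sup; [exists 0|move=> r [/andP[]]].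
have ltc s : 0 <= s -> s < c -> `|f s - f 0| <= (L + e') * s.
  move=> s0 sc; have cs : 0 < c - s by rewrite subr_gt0.
  have [r [_ hr] rs] := sup_adherent cs supS.
  by apply: hr; rewrite s0 ltW//; move: rs; rewrite -/c; lra.
have cc : `|f c - f 0| <= (L + e') * c.
  move: c0; rewrite le_eqVlt => /orP[/eqP <-|c0].
    by rewrite subrr normr0 mulr0.
  have h1 : `|f s - f 0| @[s --> c^'-] --> `|f c - f 0|.
    apply: cvg_norm; apply: cvgB; last exact: cvg_cst.
    by apply: cvg_at_left_filter; exact: cf.
  have h2 : (L + e') * s @[s --> c^'-] --> (L + e') * c.
    by apply: cvgMr; apply: cvg_at_left_filter; exact: cvg_id.
  apply: ler_cvg_to h1 h2 _; near=> s; apply: ltc => //.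
  by apply: ltW; near: s; exact: nbhs_left_gt.
have Sc : S c.
  split; first by rewrite c0 ct.
  move=> s /andP[s0]; rewrite le_eqVlt => /orP[/eqP -> //|]; exact: ltc.
move: ct; rewrite le_eqVlt => /orP[/eqP <- //|ct].
exfalso.
have [l lL hl] := df c c0.
have hl' : \forall s \near (0 : R)^'+, `|(f (s + c) - f c) / s| <= L + e'.
  by apply: (cvgr_norm_le _ hl); rewrite (le_lt_trans lL)// ltrDl.
have tc : 0 < t - c by rewrite subr_gt0.
have [r /= r0 hr] : exists2 r, 0 < r & forall s, 0 < s -> s < r ->
    `|(f (s + c) - f c) / s| <= L + e'.
  move: hl' => [r /= r0 hr]; exists r => // s s0 sr; apply: hr => //=.
  by rewrite sub0r normrN gtr0_norm.
pose r' := Num.min (r / 2) (t - c).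
have r'0 : 0 < r' by rewrite lt_min divr_gt0.
have r'r : r' < r by rewrite gt_min ltr_pdivrMr// ltr_pMr// ltr1n.
have r't : r' <= t - c by rewrite ge_min lexx orbT.
suff : S (c + r').
  by move=> /(sup_upper_bound supS); rewrite -/c gerDl leNgt r'0.
split; first by apply/andP; split; lra.
move=> s /andP[s0 sr]; have [sc|cs] := leP s c.
  by apply: (Sc.2); rewrite s0.
have sc0 : 0 < s - c by rewrite subr_gt0.
have := hr (s - c) sc0; rewrite subrK => /(_ _)/wrap[]; first by lra.
rewrite normrM normfV (gtr0_norm sc0) ler_pdivrMr// => h.
rewrite (_ : f s - f 0 = (f s - f c) + (f c - f 0)); last by ring.
by apply: le_trans (ler_normD _ _) _; move: h cc; lra.
Unshelve. all: by end_near. Qed.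

Lemma continuous_itv_integrable u a b : continuous u ->
  leb.-integrable `[a, b] (EFin \o u).
Proof.
move=> cu; apply: continuous_compact_integrable; first exact: segment_compact.
exact: continuous_subspaceT.
Qed.

Lemma Rintegral_itv_cat u a b c : continuous u -> a <= b -> b <= c ->
  \int[leb]_(x in `[a, c]) u x =
  \int[leb]_(x in `[a, b]) u x + \int[leb]_(x in `[b, c]) u x.
Proof.
move=> cu ab bc; have ic := continuous_itv_integrable a c cu.
have := @Rintegral_itvB _ u (BLeft a) (BRight c) b ic.
rewrite !bnd_simp => /(_ ab bc) h.
have := @Rintegral_itv_obnd_cbnd _ b (BRight c) u; rewrite -h => E.
rewrite -E; first by rewrite addrC subrK.
by apply: integrableS ic => //; apply: subset_itvr; rewrite bnd_simp.
Qed.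

Lemma Rintegral_shift u t T : continuous u -> 0 <= T ->
  \int[leb]_(s in `[0, T]) u (s + t) = \int[leb]_(s in `[t, T + t]) u s.
Proof.
move=> cu T0; rewrite /Rintegral; congr fine.
have dF (x : R) : is_derive x 1 (fun s : R => s + t) 1.
  by apply: is_derive1W (is_deriveD (is_derive_id x 1) (is_derive_cst t x 1)) _ _ => //; rewrite addr0.
have dF' : derive1 (fun s : R => s + t) = cst 1.
  by apply/funext => x; rewrite derive1E; exact: (@derive_val _ _ _ _ _ _ _ (dF x)).
have := @integration_by_substitution_increasing R (fun s => s + t) u 0 T T0.
rewrite add0r dF' => -> //.
- by apply: eq_integral => s _; rewrite /= fctE mulr1.
- by move=> x y _ _; rewrite ltrD2r.
- by move=> x _; exact: cvg_cst.
- exact: is_cvg_cst.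
- exact: is_cvg_cst.
- split.
  + by move=> x _; exact: (@ex_derive _ _ _ _ _ _ _ (dF x)).
  + by apply: cvg_at_right_filter; apply: cvgD => //; exact: cvg_cst.
  + by apply: cvg_at_left_filter; apply: cvgD => //; exact: cvg_cst.
- exact: continuous_subspaceT.
Qed.

Lemma Rintegral_itv_bound u (a b c : R) : continuous u -> a <= b ->
  (forall s, a <= s -> s <= b -> 0 <= u s <= c) ->
  0 <= \int[leb]_(s in `[a, b]) u s <= c * (b - a).
Proof.
move=> cu ab h; apply/andP; split.
  by apply: Rintegral_ge0 => s /=; rewrite in_itv/= => /andP[s1 s2]; have /andP[] := h s s1 s2.
have -> : c * (b - a) = \int[leb]_(s in `[a, b]) c.
  by rewrite Rintegral_cst//= lebesgue_measure_itv/= lte_fin; move: ab; rewrite le_eqVlt => /orP[/eqP ->|->//]; rewrite ltxx /= subrr mulr0.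
apply: le_Rintegral => //; first exact: continuous_itv_integrable.
  by apply: (continuous_itv_integrable a b (u := cst c)); exact: cst_continuous.
by move=> s /=; rewrite in_itv/= => /andP[s1 s2]; have /andP[] := h s s1 s2.
Qed.

(** Cutting [0, T + t] in two ways shows that the difference is the integral over [T, T + t] minus
    that over [0, t]. Both lie in [0, D t] because u >= 0, so the constant is D rather than 2 D. *)
Lemma Rintegral_window_le u (D t T : R) : continuous u -> 0 <= T -> 0 <= t ->
  (forall s, 0 <= s -> 0 <= u s <= D) ->
  `|\int[leb]_(s in `[0, T]) u (s + t) - \int[leb]_(s in `[0, T]) u s| <= D * t.
Proof.
move=> cu T0 t0 uD; rewrite Rintegral_shift//.
have tT : t <= T + t by rewrite lerDr.
have TT : T <= T + t by rewrite lerDl.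
have := Rintegral_itv_cat cu t0 tT; rewrite (Rintegral_itv_cat cu T0 TT) => E.
have /andP[h1 h2] := Rintegral_itv_bound cu t0 (fun s s0 _ => uD s s0).
have /andP[h3 h4] : 0 <= \int[leb]_(s in `[T, T + t]) u s <= D * (T + t - T).
  by apply: Rintegral_itv_bound => // s s1 _; apply: uD; exact: le_trans s1.
rewrite ler_norml; apply/andP; move: E h1 h2 h3 h4.
rewrite subr0 (_ : T + t - T = t); last by ring.
by split; lra.
Qed.

End real_line.

(** * The shape function on the half-line *)

Section shape_function.
Context {R : realType}.
Variables (h h' : R -> R).
Hypothesis hh : kernel_shape h h'.

Lemma shape_bounded_deriv : has_ubound [set `|h' r| | r in `[0, +oo[].
Proof.
have [_ _ _ _ [B hB]] := hh; exists B => _ [r r0 <-]; apply: hB.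
by move: r0; rewrite /= in_itv/= andbT.
Qed.

Lemma shape_bounded : has_ubound [set `|h r| | r in `[0, +oo[].
Proof.
have [_ [B hB] _ _ _] := hh; exists B => _ [r r0 <-]; apply: hB.
by move: r0; rewrite /= in_itv/= andbT.
Qed.

Lemma shape_le (r : R) : 0 <= r -> `|h r| <= normC1_halfline h h'.
Proof.
move=> r0; rewrite /normC1_halfline -[leLHS]addr0 lerD//.
  by apply: ub_le_sup; [exact: shape_bounded|exists r => //=; rewrite in_itv/= andbT].
by apply: sup_norm_ge0; exact: shape_bounded_deriv.
Qed.

Lemma shape_deriv_le (r : R) : 0 <= r -> `|h' r| <= normC1_halfline h h'.
Proof.
move=> r0; rewrite /normC1_halfline -[leLHS]add0r lerD//.
  by apply: sup_norm_ge0; exact: shape_bounded.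
by apply: ub_le_sup; [exact: shape_bounded_deriv|exists r => //=; rewrite in_itv/= andbT].
Qed.

Lemma shape_diff (r e : R) : 0 <= r -> 0 < e ->
  \forall s \near r, 0 <= s -> `|h s - h r - h' r * (s - r)| <= e * `|s - r|.
Proof.
move=> r0 e0; have [_ _ /(_ r r0) /cvgrPdist_le /(_ e e0) H _ _] := hh.
rewrite near_withinE in H; apply: filterS H => s hs s0.
have [->|sr] := eqVneq s r; first by rewrite !subrr mulr0 subr0 normr0 mulr0.
have sr0 : s - r != 0 by rewrite subr_eq0.
have := hs; rewrite /= in_itv/= andbT s0 => /(_ (conj isT (elimN eqP sr))).
rewrite distrC -(ler_pM2r (x := `|s - r|)) ?normr_gt0// -normrM.
by rewrite mulrBl divfK.
Qed.

Lemma shape_chain (f : R -> R) (l : R) : (forall t, 0 <= f t) ->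
  (f t - f 0) / t @[t --> (0 : R)^'+] --> l ->
  (h (f t) - h (f 0)) / t @[t --> (0 : R)^'+] --> h' (f 0) * l.
Proof.
move=> f0 hf.
have ff : f t @[t --> (0 : R)^'+] --> f 0.
  apply/subr_cvg0.
  have h1 : (f t - f 0) / t * t @[t --> (0 : R)^'+] --> l * 0.
    by apply: cvgM => //; apply: cvg_at_right_filter; exact: cvg_id.
  rewrite mulr0 in h1; apply: cvg_trans h1; apply: near_eq_cvg.
  near=> t; rewrite divfK//.
apply/subr_cvg0; rewrite (_ : (fun t => _) = (fun t =>
   ((h (f t) - h (f 0)) / t - h' (f 0) * ((f t - f 0) / t)) +
   (h' (f 0) * ((f t - f 0) / t) - h' (f 0) * l))); last first.
  by apply/funext => t; rewrite addrA subrK.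
rewrite -[X in _ --> X](addr0 0); apply: cvgD; last first.
  by apply/subr_cvg0; apply: cvgMr.
apply/cvgr0Pnorm_le => e e0.
have l1 : 0 < `|l| + 1 by rewrite ltr_wpDl.
have H1 : \forall t \near (0 : R)^'+, 0 <= f t -> `|h (f t) - h (f 0) - h' (f 0) * (f t - f 0)| <=
    e / (`|l| + 1) * `|f t - f 0|.
  exact: ff (shape_diff (f0 0) (divr_gt0 e0 l1)).
have H2 : \forall t \near (0 : R)^'+, `|(f t - f 0) / t| <= `|l| + 1.
  by apply: (cvgr_norm_le _ hf); rewrite ltrDl.
near=> t.
have t0 : 0 < t by near: t; exact: nbhs_right_gt.
have H1t : `|h (f t) - h (f 0) - h' (f 0) * (f t - f 0)| <= e / (`|l| + 1) * `|f t - f 0|.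
  have : 0 <= f t by []; near: t; exact: H1.
have H2t : `|(f t - f 0) / t| <= `|l| + 1 by near: t.
rewrite mulrA -mulrBl normrM; apply: (@le_trans _ _ (e / (`|l| + 1) * `|f t - f 0| * `|t^-1|)).
  by rewrite ler_wpM2r.
rewrite -mulrA -normrM; apply: (@le_trans _ _ (e / (`|l| + 1) * (`|l| + 1))).
  by rewrite ler_wpM2l// divr_ge0// ltW.
by rewrite divfK// gt_eqF.
Unshelve. all: by end_near. Qed.

(** The absolute value replaces h by a function continuous on the whole line without changing it on
    [0, +oo[, where its arguments lie. *)
Lemma shape_continuous : continuous (fun r : R => h `|r|).
Proof.
move=> r; apply/subr_cvg0/cvgr0Pnorm_le => e e0.
have r0 : 0 <= `|r| by [].
have H1 := norm_continuous (x := r) (shape_diff r0 ltr01).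
have c0 : 0 < `|h' `|r| | + 1 by rewrite ltr_wpDl.
have H2 : \forall s \near r, `| `|r| - `|s| | <= e / (`|h' `|r| | + 1).
  by have /cvgrPdist_le := norm_continuous (x := r); apply; rewrite divr_gt0.
near=> s.
have hs : `|h `|s| - h `|r| - h' `|r| * (`|s| - `|r|)| <= 1 * `| `|s| - `|r| |.
  have : 0 <= `|s| by []; near: s; exact: H1.
have ds : `| `|r| - `|s| | <= e / (`|h' `|r| | + 1) by near: s.
rewrite (_ : h `|s| - h `|r| = (h `|s| - h `|r| - h' `|r| * (`|s| - `|r|)) + h' `|r| * (`|s| - `|r|));
  last by ring.
rewrite (le_trans (ler_normD _ _))//.
rewrite distrC ler_pdivlMr// in ds; apply: le_trans ds.
by rewrite [leRHS]mulrDr mulr1 addrC lerD//; [rewrite normrM mulrC|rewrite mul1r in hs].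
Unshelve. all: by end_near. Qed.

Lemma shape_lipschitz (r s : R) : 0 <= r -> 0 <= s ->
  `|h r - h s| <= normC1_halfline h h' * `|r - s|.
Proof.
wlog rs : r s / r <= s.
  move=> H r0 s0; have [/H|/ltW /H] := leP r s; first exact.
  by rewrite distrC (distrC r); exact.
move=> r0 s0.
have sr0 : 0 <= s - r by rewrite subr_ge0.
have c1 : continuous (fun t => h `|r + t|).
  move=> t; apply: (@continuous_comp _ _ _ (fun t => r + t) (fun r : R => h `|r|)).
    by apply: cvgD; [exact: cvg_cst|exact: cvg_id].
  exact: shape_continuous.
have c2 t : 0 <= t -> exists2 l : R, `|l| <= normC1_halfline h h' &
    (h `|r + (s + t)| - h `|r + t|) / s @[s --> (0 : R)^'+] --> l.
  move=> t0; exists (h' (r + t)); first by apply: shape_deriv_le; exact: addr_ge0.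
  have rt0 : 0 <= r + t by exact: addr_ge0.
  have := @shape_chain (fun s => `|r + t + s|) 1 (fun=> normr_ge0 _).
  rewrite addr0 mulr1 (ger0_norm rt0).
  move=> H; rewrite (_ : (fun u => _) = (fun u => (h `|r + t + u| - h (r + t)) / u)).
    apply: H; apply: cvg_near_cst; near=> u.
    have u0 : 0 < u by near: u; exact: nbhs_right_gt.
    by rewrite ger0_norm ?addr_ge0 ?(ltW u0)// (addrC (r + t)) addrK mulfV// gt_eqF.
  by apply/funext => u; rewrite (addrC u t) addrA.
have := right_derivative_lipschitz c1 c2 sr0.
rewrite addr0 (_ : r + (s - r) = s); last by ring.
by rewrite (ger0_norm r0) (ger0_norm s0) (distrC r) (ger0_norm sr0) distrC.
Unshelve. all: by end_near. Qed.

End shape_function.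

(** * Averages of a function of two points along trajectories *)

Section delay_average.
Context {R : realType} {Omega : topologicalType}.
Variables (G : Omega * Omega -> R) (Phi : R -> Omega -> Omega) (T : R).
Hypothesis Gc : continuous G.
Hypothesis G_ge0 : forall p, 0 <= G p.
Hypothesis hPhi : continuous_flow Phi.
Hypothesis T_gt0 : 0 < T.
Local Notation leb := (@lebesgue_measure R).

Definition delay_average (x y : Omega) : R :=
  T^-1 * \int[leb]_(t in `[0, T]) G (Phi t x, Phi t y).

Lemma flow_comp s t x : Phi s (Phi t x) = Phi t (Phi s x).
Proof. by have [_ Padd _] := hPhi; rewrite -!Padd addrC. Qed.

Lemma trajectory_pair_cvg t0 (p0 : Omega * Omega) :
  G (Phi q.1 q.2.1, Phi q.1 q.2.2) @[q --> (t0, p0)] --> G (Phi t0 p0.1, Phi t0 p0.2).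
Proof.
have [_ _ Pc] := hPhi.
pose f (q : R * (Omega * Omega)) := Phi q.1 q.2.1.
pose g (q : R * (Omega * Omega)) := Phi q.1 q.2.2.
have c1 : f q @[q --> (t0, p0)] --> Phi t0 p0.1.
  have h : (q.1, q.2.1) @[q --> (t0, p0)] --> (t0, p0.1).
    have h1 : q.1 @[q --> (t0, p0)] --> t0 by exact: cvg_fst.
    have h2 : q.2.1 @[q --> (t0, p0)] --> p0.1.
      by apply: (@cvg_comp _ _ _ snd fst _ (nbhs p0)); [exact: cvg_snd|exact: cvg_fst].
    by refine (cvg_pair h1 h2).
  by refine (continuous_cvg _ (Pc (t0, p0.1)) h).
have c2 : g q @[q --> (t0, p0)] --> Phi t0 p0.2.
  have h : (q.1, q.2.2) @[q --> (t0, p0)] --> (t0, p0.2).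
    have h1 : q.1 @[q --> (t0, p0)] --> t0 by exact: cvg_fst.
    have h2 : q.2.2 @[q --> (t0, p0)] --> p0.2.
      by apply: (@cvg_comp _ _ _ snd snd _ (nbhs p0)); [exact: cvg_snd|exact: cvg_snd].
    by refine (cvg_pair h1 h2).
  by refine (continuous_cvg _ (Pc (t0, p0.2)) h).
have c12 : (f q, g q) @[q --> (t0, p0)] --> (Phi t0 p0.1, Phi t0 p0.2) by refine (cvg_pair c1 c2).
by refine (continuous_cvg _ (@Gc (Phi t0 p0.1, Phi t0 p0.2)) c12).
Qed.

Lemma trajectory_continuous x y : continuous (fun t => G (Phi t x, Phi t y)).
Proof.
move=> t0; have h : (t, (x, y)) @[t --> t0] --> (t0, (x, y)).
  have h1 : t @[t --> t0] --> t0 by exact: cvg_id.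
  have h2 : (x, y) @[t --> t0] --> (x, y) by exact: cvg_cst.
  by refine (cvg_pair h1 h2).
by refine (cvg_comp _ _ h (@trajectory_pair_cvg t0 (x, y))).
Qed.

Lemma delay_average_ge0 x y : 0 <= delay_average x y.
Proof.
by rewrite mulr_ge0 ?invr_ge0 ?(ltW T_gt0)//; apply: Rintegral_ge0.
Qed.

Lemma delay_averageB x y x' y' (c : R) :
  (forall s : R, 0 <= s <= T -> `|G (Phi s x, Phi s y) - G (Phi s x', Phi s y')| <= c) ->
  `|delay_average x y - delay_average x' y'| <= c.
Proof.
move=> h; rewrite /delay_average -mulrBr -RintegralB//; last 2 first.
- exact: continuous_itv_integrable (@trajectory_continuous _ _).
- exact: continuous_itv_integrable (@trajectory_continuous _ _).
rewrite normrM gtr0_norm ?invr_gt0// ler_pdivrMl//.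
have cd : continuous (fun s => G (Phi s x, Phi s y) - G (Phi s x', Phi s y')).
  by move=> s; apply: cvgB; exact: trajectory_continuous.
apply: le_trans (le_normr_Rintegral _ _) _ => //.
  exact: (continuous_itv_integrable 0 T cd).
have -> : T * c = c * (T - 0) by rewrite subr0 mulrC.
have cn : continuous (fun s => `|G (Phi s x, Phi s y) - G (Phi s x', Phi s y')|).
  by move=> s; apply: cvg_norm; exact: cd.
have /andP[_ //] := Rintegral_itv_bound cn (ltW T_gt0)
  (fun s s0 sT => (introT andP (conj (normr_ge0 _) (h s (introT andP (conj s0 sT)))))).
Qed.

Lemma delay_average_continuous :
  continuous (fun p : Omega * Omega => delay_average p.1 p.2).
Proof.
move=> p0; apply/cvgrPdist_le => e e0.
have Tc : compact `[(0 : R), T] by exact: segment_compact.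
have H : \forall p \near p0, forall s, `[(0 : R), T]%classic s ->
   `|G (Phi s p0.1, Phi s p0.2) - G (Phi s p.1, Phi s p.2)| <= e.
  refine ((compact_near_coveringP _).1 Tc _ (nbhs p0) (fun p s =>
    `|G (Phi s p0.1, Phi s p0.2) - G (Phi s p.1, Phi s p.2)| <= e) _ _) => s _.
  have e2 : 0 < e / 2 by rewrite divr_gt0.
  have /cvgrPdist_le /(_ _ e2) h1 := @trajectory_pair_cvg s p0.
  have /cvgrPdist_le /(_ _ e2) h2 := @trajectory_continuous p0.1 p0.2 s.
  have h2' : \forall q \near (s, p0),
      `|G (Phi s p0.1, Phi s p0.2) - G (Phi q.1 p0.1, Phi q.1 p0.2)| <= e / 2.
    exact: near_fst h2.
  apply: filterS2 h1 h2' => -[s' p] /= h1 h2'.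
  rewrite (splitr e) (_ : _ - _ =
     (G (Phi s p0.1, Phi s p0.2) - G (Phi s' p.1, Phi s' p.2)) -
     (G (Phi s p0.1, Phi s p0.2) - G (Phi s' p0.1, Phi s' p0.2))); last by ring.
  by rewrite (le_trans (ler_normB _ _))// lerD.
apply: filterS H => p hp; apply: delay_averageB => s sT.
by apply: hp; rewrite /= in_itv.
Qed.

(* The averages over [0, T] and [t, T + t] differ only on two windows of
   length t. *)
Lemma delay_average_window x y (D t : R) : 0 <= t ->
  (forall s : R, 0 <= s -> G (Phi s x, Phi s y) <= D) ->
  `|delay_average (Phi t x) (Phi t y) - delay_average x y| <= D * t / T.
Proof.
move=> t0 GD; have [_ Padd _] := hPhi.
rewrite /delay_average -mulrBr normrM gtr0_norm ?invr_gt0// mulrC ler_pM2r ?invr_gt0//.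
under eq_Rintegral do rewrite -!Padd.
apply: (@Rintegral_window_le _ (fun s => G (Phi s x, Phi s y))) => //.
- exact: trajectory_continuous.
- exact: ltW.
- by move=> s s0; rewrite G_ge0 GD.
Qed.

Lemma delay_average_lipschitz x y (L t : R) :
  (forall s : R, 0 <= s -> `|G (Phi t (Phi s x), Phi s y) - G (Phi s x, Phi s y)| <= L * t) ->
  `|delay_average (Phi t x) y - delay_average x y| <= L * t.
Proof.
move=> h; apply: delay_averageB => s /andP[s0 _].
by rewrite flow_comp h.
Qed.

(** Differentiation under the integral: along sequences t_n -> 0+ the difference quotients are
    dominated by the constant L. *)
Lemma delay_average_derivative x y (L : R) :
  (forall s t : R, 0 <= s -> 0 <= t ->
     `|G (Phi t (Phi s x), Phi s y) - G (Phi s x, Phi s y)| <= L * t) ->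
  (forall s : R, 0 <= s -> exists l : R,
     (G (Phi t (Phi s x), Phi s y) - G (Phi s x, Phi s y)) / t @[t --> (0 : R)^'+] --> l) ->
  exists l : R,
    (delay_average (Phi t x) y - delay_average x y) / t @[t --> (0 : R)^'+] --> l.
Proof.
move=> hL hd.
have /choice[l hl] : forall s : R, exists l : R, 0 <= s ->
    (G (Phi t (Phi s x), Phi s y) - G (Phi s x, Phi s y)) / t @[t --> (0 : R)^'+] --> l.
  move=> s; have [/hd[l hl]|s0] := leP 0 s; first by exists l.
  by exists 0.
exists (T^-1 * \int[leb]_(s in `[0, T]) l s); apply/cvg_at_rightP => t_ [t_gt0 t_0].
have cq n : continuous (fun s => (G (Phi s (Phi (t_ n) x), Phi s y) - G (Phi s x, Phi s y)) / t_ n).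
  by move=> s; apply: cvgMl; apply: cvgB; exact: trajectory_continuous.
have -> : (fun n => (delay_average (Phi (t_ n) x) y - delay_average x y) / t_ n) =
  (fun n => T^-1 * \int[leb]_(s in `[0, T])
     ((G (Phi s (Phi (t_ n) x), Phi s y) - G (Phi s x, Phi s y)) / t_ n)).
  apply/funext => n; rewrite /delay_average -mulrBr -mulrA; congr (_ * _).
  rewrite -RintegralB//; last 2 first.
  - exact: continuous_itv_integrable (@trajectory_continuous _ _).
  - exact: continuous_itv_integrable (@trajectory_continuous _ _).
  rewrite -RintegralZr//; apply: (continuous_itv_integrable (u := fun s =>
     G (Phi s (Phi (t_ n) x), Phi s y) - G (Phi s x, Phi s y))).
  by move=> s; apply: cvgB; exact: trajectory_continuous.
apply: cvgMr.
have mq n : measurable_fun `[0, T]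
    (fun s => (G (Phi s (Phi (t_ n) x), Phi s y) - G (Phi s x, Phi s y)) / t_ n).
  by apply: measurable_funTS; apply: continuous_measurable_fun; exact: cq.
have ql s : `[0, T]%classic s ->
    (G (Phi s (Phi (t_ n) x), Phi s y) - G (Phi s x, Phi s y)) / t_ n @[n --> \oo] --> l s.
  rewrite /= in_itv/= => /andP[s0 _].
  have /cvg_at_rightP := hl s s0 => /(_ t_ (conj t_gt0 t_0)).
  by under eq_fun do rewrite -flow_comp.
apply: (@Rintegral_dominated_cvg _ _ _ leb `[0, T] _ l (cst L)) => //.
- exact: (@measurable_fun_cvg _ _ _ `[0, T]%classic (fun n s =>
    (G (Phi s (Phi (t_ n) x), Phi s y) - G (Phi s x, Phi s y)) / t_ n) l mq ql).
- exact: aeW.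
- by apply: (continuous_itv_integrable 0 T (u := cst L)); exact: cst_continuous.
- apply: aeW => s n; rewrite /= in_itv/= => /andP[s0 _].
  by rewrite normrM normfV (gtr0_norm (t_gt0 n)) ler_pdivrMr// flow_comp hL// ltW.
Qed.

End delay_average.

(** * Koopman operators *)

Section right_generator.
Context {R : realType} {V : lmodType R} (ip : semi_inner V).
Variable U : R -> V -> V.
Hypothesis UD : forall t x y, U t (x + y) = U t x + U t y.
Hypothesis UZ : forall t c x, U t (c *: x) = c *: U t x.
Hypothesis Uip : forall t x y, ip (U t x) (U t y) = ip x y.
Hypothesis Uadd : forall s t x, U (s + t) x = U s (U t x).
Hypothesis U0 : forall x, U 0 x = x.

(* The backward difference quotient is the image under U^{-t} of the forward
   one, so it converges once U^t is strongly continuous at x'. *)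
Lemma is_generator_right x x' :
  ipnorm ip (t^-1 *: (U t x - x) - x') @[t --> (0 : R)^'+] --> (0 : R) ->
  is_generator ip U x x'.
Proof.
pose q t := t^-1 *: (U t x - x) => hr.
have Un t y : ipnorm ip (U t y) = ipnorm ip y by exact: isometry_norm.
have UB t y z : U t (y - z) = U t y - U t z by exact: isometryB.
have qr (e : R) : 0 < e -> exists2 r, 0 < r & forall t, 0 < t -> t < r ->
    ipnorm ip (q t - x') <= e.
  move=> e0; have /cvgr0Pnorm_le /(_ _ e0) [r /= r0 h] := hr.
  exists r => // t t0 tr; have := h t; rewrite /= sub0r normrN gtr0_norm// => /(_ tr t0).
  by rewrite ger0_norm// ipnorm_ge0.
have Ut (e : R) : 0 < e -> exists2 r, 0 < r & forall t, 0 < t -> t < r ->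
    ipnorm ip (U t x' - x') <= e.
  move=> e0; have e4 : 0 < e / 4 by rewrite divr_gt0.
  have [r1 r10 h1] := qr _ e4; have [r2 r20 h2] := qr 1 ltr01.
  pose s := r1 / 2; have s0 : 0 < s by rewrite divr_gt0.
  have sr : s < r1 by rewrite ltr_pdivrMr// ltr_pMr// ltr1n.
  pose B := ipnorm ip x' + 1; have B0 : 0 < B by rewrite ltr_wpDl// ipnorm_ge0.
  pose r3 := e * s / (4 * B); have r30 : 0 < r3 by rewrite !(divr_gt0, mulr_gt0).
  exists (Num.min r2 r3); first by rewrite lt_min r20.
  move=> t t0; rewrite lt_min => /andP[tr2 tr3].
  have qt : ipnorm ip (U t x - x) <= t * B.
    rewrite (_ : U t x - x = t *: q t); last first.
      by rewrite scalerA mulfV ?scale1r// gt_eqF.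
    rewrite ipnormZ gtr0_norm// ler_pM2l//.
    rewrite -[q t](subrK x') (le_trans (ipnormD _ _ _))// addrC lerD// ?h2//.
  have Uq : ipnorm ip (U t (q s) - q s) <= 2 * (s^-1 * (t * B)).
    rewrite /q UZ -scalerBr ipnormZ gtr0_norm ?invr_gt0// mulrCA ler_pM2l ?invr_gt0//.
    rewrite UB (_ : _ - _ = U s (U t x - x) - (U t x - x)); last first.
      rewrite !UB -!Uadd (addrC t s) !opprB addrACA [RHS]addrACA.
      by congr (_ + _); exact: addrC.
    rewrite (le_trans (ipnormB _ _ _))// Un; lra.
  rewrite (_ : U t x' - x' = (U t (q s) - q s) + ((q s - x') - U t (q s - x'))); last first.
    rewrite UB opprB -[q s - x' + _]addrA subrKA addrCA [U t (q s) + _]addrCA.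
    by rewrite subrr addr0 addrC.
  rewrite (le_trans (ipnormD _ _ _))//.
  have h3 : ipnorm ip (q s - x' - U t (q s - x')) <= e / 4 + e / 4.
    by rewrite (le_trans (ipnormB _ _ _))// Un lerD// h1.
  have h4 : 2 * (s^-1 * (t * B)) <= e / 2.
    rewrite mulrCA ler_pdivrMl//; move: tr3; rewrite /r3 ltr_pdivlMr ?mulr_gt0// => /ltW.
    lra.
  move: Uq h3 h4; lra.
apply/cvgr0Pnorm_le => e e0.
have e2 : 0 < e / 2 by rewrite divr_gt0.
have [r1 r10 h1] := qr _ e2; have [r2 r20 h2] := Ut _ e2.
exists (Num.min r1 r2); first by rewrite /= lt_min r10.
move=> t /=; rewrite sub0r normrN lt_min => /andP[tr1 tr2] tn0.
rewrite ger0_norm ?ipnorm_ge0//.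
have [t0|t0] := ltP 0 t.
  apply: (@le_trans _ _ (e / 2)); first by apply: h1; rewrite // -(gtr0_norm t0).
  by rewrite ler_pdivrMr// ler_peMr ?(ltW e0)// ler1n.
have t0' : 0 < - t by rewrite oppr_gt0 lt_neqAle tn0 t0.
rewrite ler0_norm// in tr1 tr2.
rewrite -(Un (- t)) UB UZ UB -Uadd addNr U0.
rewrite (_ : t^-1 *: _ = q (- t)); last by rewrite /q invrN scaleNr -scalerN opprB.
rewrite (_ : q (- t) - _ = (q (- t) - x') - (U (- t) x' - x')); last first.
  by rewrite opprB addrA subrK.
rewrite (le_trans (ipnormB _ _ _))// (splitr e) lerD//; [exact: h1|exact: h2].
Qed.

End right_generator.

Lemma exists_limit_fun d (T : measurableType d) (R : realType) (X : set T)
    (f_ : nat -> T -> R) : measurable X -> (forall n, measurable_fun setT (f_ n)) ->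
  (forall x, X x -> exists l : R, f_ n x @[n --> \oo] --> l) ->
  exists f : T -> R, [/\ measurable_fun setT f,
    forall x, X x -> f_ n x @[n --> \oo] --> f x & forall x, ~ X x -> f x = 0].
Proof.
move=> mX mf h.
have /choice[f hf] : forall x, exists l : R, (X x -> f_ n x @[n --> \oo] --> l) /\
    (~ X x -> l = 0).
  move=> x; have [Xx|Xx] := pselect (X x); last by exists 0; split.
  by have [l hl] := h x Xx; exists l; split.
exists f; split => [|x|x]; [|exact: (hf x).1|exact: (hf x).2].
apply: (@measurable_fun_cvg _ _ _ setT (fun n x => \1_X x * f_ n x)).
  by move=> n; apply: measurable_funM => //; exact: measurable_indic.
move=> x _; have [Xx|Xx] := pselect (X x).
  have iX : \1_X x = 1 :> R by rewrite indicE mem_set.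
  by under eq_fun do rewrite iX mul1r; exact: (hf x).1.
have iX : \1_X x = 0 :> R by rewrite indicE memNset.
by under eq_fun do rewrite iX mul0r; rewrite (hf x).2//; exact: cvg_cst.
Qed.

Section koopman_operator.
Context {R : realType} {d : measure_display} {T : measurableType d}.
Variable mu : probability T R.
Variable P : T -> T.
Hypothesis mP : measurable_fun setT P.
Hypothesis invP : forall A, measurable A -> mu (P @^-1` A) = mu A.

Lemma ge0_integral_invariant (f : T -> \bar R) : measurable_fun setT f ->
  (forall x, (0 <= f x)%E) -> (\int[mu]_x f (P x) = \int[mu]_x f x)%E.
Proof.
move=> mf f0; rewrite -[LHS](@ge0_integral_pushforward _ _ _ _ _ P mP mu setT f)//.
by apply: eq_measure_integral => A mA _; exact: invP.
Qed.

Lemma integrable_invariant (f : T -> \bar R) :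
  mu.-integrable setT f -> mu.-integrable setT (f \o P).
Proof.
move=> /integrableP[mf fi]; apply/integrableP; split; first exact: measurableT_comp.
rewrite (_ : (\int[mu]_x _)%E = (\int[mu]_x `|f x|)%E)//.
by apply: (ge0_integral_invariant (f := fun x => `|f x|%E)) => //; exact: measurableT_comp.
Qed.

Lemma Rintegral_invariant (f : T -> R) : mu.-integrable setT (EFin \o f) ->
  \int[mu]_x f (P x) = \int[mu]_x f x.
Proof.
move=> fi; rewrite /Rintegral; congr fine.
have [mf _] := integrableP _ _ _ fi.
rewrite -[LHS](@integral_pushforward _ _ _ _ _ P mP mu setT (EFin \o f) mf
  (integrable_invariant fi) measurableT).
by apply: eq_measure_integral => A mA _; exact: invP.
Qed.

Lemma ae_invariant (Q : T -> Prop) :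
  {ae mu, forall x, Q x} -> {ae mu, forall x, Q (P x)}.
Proof.
move=> [N [mN N0 QN]]; exists (P @^-1` N); split.
- by rewrite -[X in measurable X]setTI; exact: mP.
- by rewrite (invP mN).
- by move=> x /= nQ; exact: QN.
Qed.

Lemma koopman_sqint (f : T -> R) : f \in sqint mu -> f \o P \in sqint mu.
Proof.
move=> /sqintP[mf fi]; apply/sqintP; split; first exact: measurableT_comp.
exact: (integrable_invariant fi).
Qed.

Definition koopL2 (f : L2r mu) : L2r mu := MkL2r (koopman_sqint (l2funP f)).

Lemma koopL2D f g : koopL2 (f + g) = koopL2 f + koopL2 g.
Proof. exact/val_inj. Qed.

Lemma koopL2Z c f : koopL2 (c *: f) = c *: koopL2 f.
Proof. exact/val_inj. Qed.

Lemma koopL2_ip f g : l2prod mu (koopL2 f) (koopL2 g) = l2prod mu f g.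
Proof.
rewrite !l2prodE /=; apply: (Rintegral_invariant (f := fun x => f x * g x)).
exact: sqint_mul (l2funP f) (l2funP g).
Qed.

End koopman_operator.

(** * The delay kernel, its operator, and the generator on eigenfunctions *)

Section observed_flow.
Context {R : realType} {d : measure_display} {Omega : measurableMetricType R d}.
Hypothesis hborel : borel Omega.
Variables (Phi : R -> Omega -> Omega) (mu : probability Omega R).
Hypothesis hPhi : continuous_flow Phi.
Hypothesis hinv : invariant_measure mu Phi.
Variables (X M : set Omega).
Hypothesis hX : is_support mu X.
Hypothesis Xc : compact X.
Hypothesis hXM : X `<=` M.
Hypothesis Mc : compact M.
Variables (n : nat) (a : c1_atlas (R := R) M n) (g : riemannian_metric a).
Hypothesis hMfwd : forall (t : R) x, 0 <= t -> M x -> M (Phi t x).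
Hypothesis hPhiC1 : C1_flow a Phi.
Variables (Y : completeNormedModType R) (F : Omega -> Y).
Hypothesis hF : continuous F.
Hypothesis hd2C1 : C1_MM a (obs_dist2 F).
Variables (h h' : R -> R).
Hypothesis hh : kernel_shape h h'.
Variable T : R.
Hypothesis hT : 0 < T.

Local Notation G := (obs_dist2 F).
Local Notation k := (delay_kernel F Phi h T).
Local Notation Nh := (normC1_halfline h h').
Local Notation D := (sup_norm (X `*` X) (obs_dist2 F)).
Local Notation Lip := (dirder_norm g Phi * normC1_MM g (obs_dist2 F)).

Lemma obs_dist2_continuous : continuous G.
Proof.
move=> p; apply: (@continuous_comp _ _ _ (fun p => `|F p.1 - F p.2|) (fun r : R => r ^+ 2)).
  apply: cvg_norm; apply: cvgB.
    exact: (@continuous_comp _ _ _ fst F p cvg_fst (@hF p.1)).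
  exact: (@continuous_comp _ _ _ snd F p cvg_snd (@hF p.2)).
exact: exprn_continuous.
Qed.

Lemma obs_dist2_ge0 p : 0 <= G p.
Proof. exact: exprn_ge0. Qed.

Lemma obs_dist2_sym x y : G (x, y) = G (y, x).
Proof. by rewrite /obs_dist2 /= distrC. Qed.

Lemma flow_continuous t : continuous (Phi t).
Proof.
have [_ _ Pc] := hPhi; move=> x.
have h1 : t @[y --> x] --> t by exact: cvg_cst.
have h2 : y @[y --> x] --> x by exact: cvg_id.
have h12 : (t, y) @[y --> x] --> (t, x) by refine (cvg_pair h1 h2).
by refine (continuous_cvg _ (Pc (t, x)) h12).
Qed.

Lemma flow_measurable t : measurable_fun setT (Phi t).
Proof. by apply: continuous_borel_map => //; exact: flow_continuous. Qed.

Lemma flow_preserves t A : measurable A -> mu (Phi t @^-1` A) = mu A.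
Proof. exact: hinv. Qed.

Lemma support_null : mu (~` X) = 0%E.
Proof. by have [_ ? _] := hX. Qed.

Lemma support_measurable : measurable X.
Proof. by apply: closed_borel => //; have [? _ _] := hX. Qed.

(** The preimage of X under [Phi t] is closed and of full measure, so it contains X by minimality of
    the support. *)
Lemma support_invariant t x : X x -> X (Phi t x).
Proof.
have [clX X0 Xmin] := hX; apply: (Xmin (Phi t @^-1` X)).
  by apply: closed_comp => // y _; exact: flow_continuous.
have H := flow_preserves t (measurableC support_measurable).
by rewrite -X0 -[RHS]H.
Qed.

Lemma ae_X : {ae mu, forall x, X x}.
Proof. exact: (ae_support hborel Xc support_null). Qed.

Lemma sup_norm_support x y : X x -> X y -> G (x, y) <= D.
Proof.
move=> Xx Xy; rewrite -(ger0_norm (obs_dist2_ge0 _)).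
apply: ub_le_sup; last by exists (x, y).
exact: (sup_normMM_bounded Xc obs_dist2_continuous).
Qed.

Lemma Lip_ge0 : 0 <= Lip.
Proof.
apply: mulr_ge0; first exact: dirder_norm_ge0.
exact: (normC1_MM_ge0 g Mc obs_dist2_continuous hd2C1 obs_dist2_sym).
Qed.

Lemma slice_lipschitz x y t : M x -> M y -> 0 <= t ->
  `|G (Phi t x, y) - G (x, y)| <= Lip * t.
Proof.
move=> Mx My t0; have [P0 Padd Pc] := hPhi.
have := @right_derivative_lipschitz R (fun t => G (Phi t x, y)) Lip _ _ t t0.
rewrite P0; apply.
  move=> s; have h1 : s' @[s' --> s] --> s by exact: cvg_id.
  have h2 : x @[s' --> s] --> x by exact: cvg_cst.
  have h12 : (s', x) @[s' --> s] --> (s, x) by refine (cvg_pair h1 h2).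
  have h3 : Phi s' x @[s' --> s] --> Phi s x by refine (continuous_cvg _ (Pc (s, x)) h12).
  have h4 : y @[s' --> s] --> y by exact: cvg_cst.
  have h34 : (Phi s' x, y) @[s' --> s] --> (Phi s x, y) by refine (cvg_pair h3 h4).
  by refine (continuous_cvg _ (@obs_dist2_continuous (Phi s x, y)) h34).
move=> s s0; have Ms := hMfwd s0 Mx.
have [l lL hl] := slice_derivative g Mc obs_dist2_continuous hd2C1 obs_dist2_sym
  hPhi hMfwd hPhiC1 Ms My.
by exists l => //; under eq_fun do rewrite Padd.
Qed.

Lemma kernelE x y : k x y = h (delay_average G Phi T x y).
Proof. by []. Qed.

Lemma average_ge0 x y : 0 <= delay_average G Phi T x y.
Proof. by apply: delay_average_ge0 => //; exact: obs_dist2_ge0. Qed.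

Lemma kernel_sym x y : k x y = k y x.
Proof.
rewrite !kernelE /delay_average; congr (h (_ * _)); apply: eq_Rintegral => t _.
exact: obs_dist2_sym.
Qed.

Lemma kernel_le x y : `|k x y| <= Nh.
Proof. by apply: (shape_le hh); exact: average_ge0. Qed.

Lemma kernel_continuous : continuous (fun p : Omega * Omega => k p.1 p.2).
Proof.
have -> : (fun p : Omega * Omega => k p.1 p.2) =
    (fun p => h `|delay_average G Phi T p.1 p.2|).
  by apply/funext => p; rewrite ger0_norm ?average_ge0.
move=> p; apply: (@continuous_comp _ _ _ (fun p => delay_average G Phi T p.1 p.2)
  (fun r : R => h `|r|)).
  by apply: delay_average_continuous => //; exact: obs_dist2_continuous.
exact: (shape_continuous hh).
Qed.

Lemma Nh_ge0 : 0 <= Nh.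
Proof. by apply: le_trans (shape_le hh (lexx 0)). Qed.

Lemma kernel_window x y t : X x -> X y -> 0 <= t ->
  `|k (Phi t x) (Phi t y) - k x y| <= Nh * (D * t / T).
Proof.
move=> Xx Xy t0; apply: le_trans (shape_lipschitz hh _ _) _; [exact: average_ge0..|].
rewrite ler_wpM2l ?Nh_ge0//.
apply: delay_average_window => //; [exact: obs_dist2_continuous|exact: obs_dist2_ge0|].
by move=> s _; apply: sup_norm_support; exact: support_invariant.
Qed.

Lemma kernel_lipschitz x y t : X x -> X y -> 0 <= t ->
  `|k (Phi t x) y - k x y| <= Nh * (Lip * t).
Proof.
move=> Xx Xy t0; apply: le_trans (shape_lipschitz hh _ _) _; [exact: average_ge0..|].
rewrite ler_wpM2l ?Nh_ge0//.
apply: delay_average_lipschitz => //; [exact: obs_dist2_continuous|].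
by move=> s _; apply: slice_lipschitz => //; apply: hXM; exact: support_invariant.
Qed.

Lemma kernel_derivative x y : X x -> X y ->
  exists l : R, (k (Phi t x) y - k x y) / t @[t --> (0 : R)^'+] --> l.
Proof.
move=> Xx Xy; have [P0 _ _] := hPhi.
have [l hl] : exists l : R, (delay_average G Phi T (Phi t x) y -
    delay_average G Phi T x y) / t @[t --> (0 : R)^'+] --> l.
  apply: (delay_average_derivative T obs_dist2_continuous hPhi (L := Lip)) => //.
    by move=> s t _ t0; apply: slice_lipschitz => //; apply: hXM; exact: support_invariant.
  move=> s _; have Ms : M (Phi s x) by apply: hXM; exact: support_invariant.
  have My : M (Phi s y) by apply: hXM; exact: support_invariant.
  have [l _ hl] := slice_derivative g Mc obs_dist2_continuous hd2C1 obs_dist2_sym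
    hPhi hMfwd hPhiC1 Ms My.
  by exists l.
have := shape_chain hh (f := fun t => delay_average G Phi T (Phi t x) y) (l := l).
rewrite P0 => H; eexists; apply: H => //.
by move=> t; exact: average_ge0.
Qed.

Local Notation L2 := (L2r mu).
Local Notation ip := (l2prod mu).
Local Notation K := (kL2 hborel Xc support_null kernel_continuous kernel_le).
Local Notation U t := (koopL2 (flow_measurable t) (flow_preserves t)).

Lemma flow_koopD t f f' : U t (f + f') = U t f + U t f'.
Proof. exact: koopL2D. Qed.

Lemma flow_koopZ t c f : U t (c *: f) = c *: U t f.
Proof. exact: koopL2Z. Qed.

Lemma flow_koop_ip t f f' : ip (U t f) (U t f') = ip f f'.
Proof. exact: koopL2_ip. Qed.

Lemma flow_koop_add s t f : U (s + t) f = U s (U t f).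
Proof.
have [_ Padd _] := hPhi; apply/val_inj/funext => x /=.
by rewrite addrC Padd.
Qed.

Lemma flow_koop0 f : U 0 f = f.
Proof. by have [P0 _ _] := hPhi; apply/val_inj/funext => x /=; rewrite P0. Qed.

Lemma ipnorm_le_bound (f : L2) (c : R) : 0 <= c ->
  {ae mu, forall x, `|f x| <= c} -> ipnorm ip f <= c.
Proof.
move=> c0 h0; rewrite -ler_sqr ?nnegrE ?ipnorm_ge0// sqr_ipnorm l2prodE.
apply: le_trans (ler_norm _) _; apply: ae_normr_Rintegral_le.
  exact: sqint_mul (l2funP _) (l2funP _).
apply: filterS h0 => x hx; rewrite normrM -expr2.
by rewrite ler_sqr ?nnegrE.
Qed.

(** Invariance of mu rewrites (K f)(Phi^t x) as the integral of k(Phi^t x, Phi^t y) f(Phi^t y). So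
    the commutator applies the kernel k(x, y) - k(Phi^t x, Phi^t y), small on X x X by
    [kernel_window], to U^t f. *)
Lemma koopman_commutator t f : 0 <= t ->
  ipnorm ip (K (U t f) - U t (K f)) <= Nh * D / T * t * ipnorm ip f.
Proof.
move=> t0.
have D0 : 0 <= D by apply: sup_norm_ge0; exact: (sup_normMM_bounded Xc obs_dist2_continuous).
have c0 : 0 <= Nh * D / T * t.
  by rewrite mulr_ge0// divr_ge0 ?(ltW hT)// mulr_ge0 ?Nh_ge0.
apply: ipnorm_le_bound; first by rewrite mulr_ge0// ipnorm_ge0.
apply: filterS ae_X => x Xx /=.
have E : kop mu k f (Phi t x) = \int[mu]_y (k (Phi t x) (Phi t y) * f (Phi t y)).
  rewrite /kop -(@Rintegral_invariant _ _ _ mu _ (flow_measurable t) (flow_preserves t)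
    (fun y => k (Phi t x) y * f y))//.
  exact: sqint_mul (k_sqint mu hborel kernel_continuous kernel_le _) (l2funP f).
have i1 : mu.-integrable setT (EFin \o (fun y => k x y * f (Phi t y))).
  exact: sqint_mul (k_sqint mu hborel kernel_continuous kernel_le _) (l2funP (U t f)).
have i2 : mu.-integrable setT (EFin \o (fun y => k (Phi t x) (Phi t y) * f (Phi t y))).
  exact: (integrable_invariant (flow_measurable t) (flow_preserves t)
    (sqint_mul (k_sqint mu hborel kernel_continuous kernel_le (Phi t x)) (l2funP f))).
rewrite -[X in `|X|]/(kop mu k (U t f) x - kop mu k f (Phi t x)) E /kop -RintegralB//.
rewrite -(isometry_norm flow_koop_ip t f).
have iUf := EFin_integrableZl (Nh * D / T * t)
  (integrable_norm (sqint_integrable (l2funP (U t f)))).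
apply: (@le_trans _ _ (\int[mu]_y (Nh * D / T * t * `|U t f y|))); last first.
  rewrite RintegralZl//; last exact: (integrable_norm (sqint_integrable (l2funP (U t f)))).
  by rewrite ler_wpM2l// Rintegral_norm_le_ipnorm.
have idiff : mu.-integrable setT (EFin \o (fun y =>
    k x y * f (Phi t y) - k (Phi t x) (Phi t y) * f (Phi t y))).
  exact: (integrableB measurableT i1 i2).
apply: le_trans (le_normr_Rintegral measurableT idiff) _.
apply: ae_le_Rintegral => //; first exact: (integrable_norm idiff).
apply: filterS ae_X => y Xy _ /=.
rewrite -mulrBl normrM ler_wpM2r// distrC.
by rewrite (le_trans (kernel_window Xx Xy t0))// !mulrA [leRHS]mulrAC.
Qed.
(** Measurability comes from the countable sequence 1 / (m + 1); since the right limit exists at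
    each point of X, the sequence finds it. *)
Lemma right_limit_fun (q : R -> Omega -> R) :
  (forall t : R, measurable_fun setT (q t)) ->
  (forall x, X x -> exists l : R, q t x @[t --> (0 : R)^'+] --> l) ->
  exists f : Omega -> R, [/\ measurable_fun setT f,
    forall x, X x -> q t x @[t --> (0 : R)^'+] --> f x & forall x, ~ X x -> f x = 0].
Proof.
move=> mq hq.
have hc : @harmonic R m @[m --> \oo] --> (0 : R) by exact: cvg_harmonic.
have h0 m : 0 < @harmonic R m by rewrite /harmonic /= invr_gt0.
have [x Xx|f [mf fl f0]] := @exists_limit_fun _ _ _ X (fun m => q (harmonic m))
    support_measurable (fun m => mq _).
  have [l hl] := hq x Xx; exists l.
  exact: (proj1 (cvg_at_rightP (fun t => q t x) 0 l) hl _ (conj h0 hc)).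
exists f; split => // x Xx; have [l hl] := hq x Xx.
have hl' := proj1 (cvg_at_rightP (fun t => q t x) 0 l) hl _ (conj h0 hc).
by rewrite (cvgn_real_unique (fl x Xx) hl').
Qed.

Lemma kernel_measurable x : measurable_fun setT (k x).
Proof. exact: sqint_measurable (k_sqint mu hborel kernel_continuous kernel_le x). Qed.

Lemma kopB (f : L2) x y :
  kop mu k f x - kop mu k f y = \int[mu]_u ((k x u - k y u) * f u).
Proof.
rewrite /kop -RintegralB//; [|exact: sqint_mul (k_sqint mu hborel kernel_continuous kernel_le _) (l2funP f)..].
by apply: eq_Rintegral => u _; rewrite mulrBl.
Qed.

Lemma kop_quotient (f : L2) x (t : R) :
  (kop mu k f (Phi t x) - kop mu k f x) / t =
  \int[mu]_y ((k (Phi t x) y - k x y) / t * f y).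
Proof.
rewrite kopB mulrC -RintegralZl//.
  by apply: eq_Rintegral => y _; rewrite mulrA; congr (_ * _); rewrite mulrC.
have := sqint_mul (l2funP (kfun mu hborel kernel_continuous kernel_le (Phi t x) -
  kfun mu hborel kernel_continuous kernel_le x)) (l2funP f).
exact.
Qed.

Lemma kernel_quotient_le x y (t : R) : X x -> X y -> 0 < t ->
  `|(k (Phi t x) y - k x y) / t| <= Nh * Lip.
Proof.
move=> Xx Xy t0; rewrite normrM (gtr0_norm (x := t^-1)) ?invr_gt0// ler_pdivrMr//.
by rewrite -mulrA kernel_lipschitz// ltW.
Qed.

Lemma NhLip_ge0 : 0 <= Nh * Lip.
Proof. by rewrite mulr_ge0// ?Nh_ge0// Lip_ge0. Qed.

Lemma kop_quotient_le (f : L2) x (t : R) : X x -> 0 < t ->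
  `|(kop mu k f (Phi t x) - kop mu k f x) / t| <= Nh * Lip * ipnorm ip f.
Proof.
move=> Xx t0; rewrite kop_quotient.
have iq : mu.-integrable setT (EFin \o (fun y => (k (Phi t x) y - k x y) / t * f y)).
  have := sqint_mul (l2funP (t^-1 *: (kfun mu hborel kernel_continuous kernel_le (Phi t x) -
    kfun mu hborel kernel_continuous kernel_le x))) (l2funP f).
  by congr (integrable _ _ _); apply/funext => y /=; congr (_ * _)%:E; exact: mulrC.
apply: le_trans (le_normr_Rintegral measurableT iq) _.
have ifn := integrable_norm (sqint_integrable (l2funP f)).
apply: (@le_trans _ _ (\int[mu]_y (Nh * Lip * `|f y|))).
  apply: ae_le_Rintegral => //; first exact: (integrable_norm iq).
    exact: (EFin_integrableZl (Nh * Lip) ifn).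
  apply: filterS ae_X => y Xy _ /=.
  by rewrite normrM ler_wpM2r// kernel_quotient_le.
by rewrite RintegralZl//; rewrite ler_wpM2l ?NhLip_ge0// Rintegral_norm_le_ipnorm.
Qed.

Lemma kop_derivative (f : L2) x : X x ->
  exists l : R, (kop mu k f (Phi t x) - kop mu k f x) / t @[t --> (0 : R)^'+] --> l.
Proof.
move=> Xx.
have [t|y|kd [mkd kdl _]] := @right_limit_fun (fun t y => (k (Phi t x) y - k x y) / t).
- by apply: measurable_funM => //; apply: measurable_funB; exact: kernel_measurable.
- exact: kernel_derivative.
exists (\int[mu]_y (kd y * f y)).
apply/cvg_at_rightP => u hu; have [u0 ul] := hu.
under eq_cvg do rewrite kop_quotient.
have mf : measurable_fun setT f by exact: sqint_measurable (l2funP f).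
apply: (@Rintegral_dominated_cvg _ _ _ _ _ _ _ (fun y => Nh * Lip * `|f y|)) => //.
- move=> m; apply: measurable_funM => //; apply: measurable_funM => //.
  by apply: measurable_funB; exact: kernel_measurable.
- exact: measurable_funM.
- apply: filterS ae_X => y Xy _; apply: cvgM; last exact: cvg_cst.
  exact: (proj1 (cvg_at_rightP (fun t => (k (Phi t x) y - k x y) / t) 0 _) (kdl y Xy) _ hu).
- exact: (EFin_integrableZl (Nh * Lip) (integrable_norm (sqint_integrable (l2funP f)))).
- apply: filterS ae_X => y Xy m _.
  by rewrite normrM ler_wpM2r// kernel_quotient_le.
Qed.

(** As a mere representative f may have no derivative along orbits, but K f / l has a right
    derivative at every point of X, bounded by Nh Lip / l times |f|. This function is V f, and the
    same bound gives dominated convergence in L^2. *)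
Lemma eigenfunction_generator (f : L2) (l : R) : 0 < l -> ipeq ip (K f) (l *: f) ->
  exists2 f' : L2, is_generator ip (fun t => U t) f f' &
    ipnorm ip f' <= Nh * Lip / l * ipnorm ip f.
Proof.
move=> l0 /l2_ae Kf.
pose q (t : R) x := l^-1 * ((kop mu k f (Phi t x) - kop mu k f x) / t).
have mkop : measurable_fun setT (kop mu k f).
  exact: sqint_measurable (kop_sqint hborel Xc support_null kernel_continuous kernel_le f).
have mq t : measurable_fun setT (q t).
  apply: measurable_funM; first exact: measurable_cst.
  apply: measurable_funM; last exact: measurable_cst.
  apply: measurable_funB; last exact: mkop.
  exact: measurableT_comp mkop (flow_measurable t).
have qB x t : X x -> 0 < t -> `|q t x| <= Nh * Lip / l * ipnorm ip f.
  move=> Xx t0; rewrite /q normrM gtr0_norm ?invr_gt0// mulrC mulrAC ler_pM2r ?invr_gt0//.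
  exact: kop_quotient_le.
have B0 : 0 <= Nh * Lip / l * ipnorm ip f.
  by rewrite mulr_ge0 ?ipnorm_ge0// divr_ge0 ?NhLip_ge0// ltW.
have [//|x Xx|f' [mf' f'l f'0]] := @right_limit_fun q.
  have [v hv] := kop_derivative f Xx; exists (l^-1 * v).
  by apply: cvgM => //; exact: cvg_cst.
have f'B x : `|f' x| <= Nh * Lip / l * ipnorm ip f.
  have [Xx|nXx] := pselect (X x); last by rewrite f'0// normr0.
  have h1 : `|q t x| @[t --> (0 : R)^'+] --> `|f' x| by apply: cvg_norm; exact: f'l.
  rewrite -(cvg_lim (@Rhausdorff R) h1).
  apply: limr_le; first by apply/cvg_ex; eexists; exact: h1.
  by near=> t; apply: qB.
have f's : f' \in sqint mu by exact: sqint_bounded mf' f'B.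
exists (MkL2r f's); last by apply: ipnorm_le_bound => //; exact: aeW.
apply: is_generator_right.
- by move=> t x y; exact: flow_koopD.
- by move=> t c x; exact: flow_koopZ.
- by move=> t x y; exact: flow_koop_ip.
- by move=> s t x; exact: flow_koop_add.
- by move=> x; exact: flow_koop0.
apply/cvg_at_rightP => u hu; have [u0 ul] := hu.
rewrite -(@sqrtr0 R).
apply: (@continuous_cvg _ _ _ _ _ _ Num.sqrt); first exact: sqrt_continuous.
have -> : (0 : R) = \int[mu]_(x in setT) (cst (0 : R) x) by rewrite Rintegral_probability_cst.
have E m : ip ((u m)^-1 *: (U (u m) f - f) - MkL2r f's) ((u m)^-1 *: (U (u m) f - f) - MkL2r f's) =
    \int[mu]_x ((q (u m) x - f' x) ^+ 2).
  rewrite l2prodE; apply: ae_eq_Rintegral => //.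
  - by apply: measurable_funM; exact: sqint_measurable (l2funP _).
  - by apply: measurable_funX; exact: measurable_funB.
  (* The quotient involves f at x and at Phi x, so the almost everywhere equation K f = l f is
     needed at both points. *)
  have Kf' := ae_invariant (flow_measurable (u m)) (flow_preserves (u m)) Kf.
  apply: filterS2 Kf Kf' => x Kx KPx _ /=.
  rewrite -expr2; congr ((_ - _) ^+ 2).
  rewrite -[RHS]/(l^-1 * ((K f (Phi (u m) x) - K f x) / u m)) KPx Kx.
  rewrite -[LHS]/((u m)^-1 * (f (Phi (u m) x) - f x)).
  rewrite -[(l *: f) (Phi (u m) x)]/(l * f (Phi (u m) x)) -[(l *: f) x]/(l * f x).
  by rewrite -mulrBr -mulrA mulKf ?gt_eqF// mulrC.
under eq_cvg do rewrite E.
apply: (@Rintegral_dominated_cvg _ _ _ _ _ _ _ (cst ((Nh * Lip / l * ipnorm ip f *+ 2) ^+ 2))) => //.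
- by move=> m; apply: measurable_funX; exact: measurable_funB.
- apply: filterS ae_X => x Xx _.
  have h1 : q (u m) x @[m --> \oo] --> f' x by exact: (proj1 (cvg_at_rightP (fun t => q t x) 0 _) (f'l x Xx) _ hu).
  have h2 : q (u m) x - f' x @[m --> \oo] --> f' x - f' x by apply: cvgB => //; exact: cvg_cst.
  rewrite subrr in h2.
  have h3 : (q (u m) x - f' x) * (q (u m) x - f' x) @[m --> \oo] --> (0 : R) * 0.
    exact: cvgM.
  by rewrite mulr0 in h3.
- exact: finite_measure_integrable_cst.
- apply: filterS ae_X => x Xx m _; rewrite normrX ler_sqr ?nnegrE//; last exact: mulrn_wge0.
  by rewrite (le_trans (ler_normB _ _))// mulr2n lerD// qB.
Unshelve. all: by end_near.
Qed.

Lemma eigenpair_generators (f1 f2 : L2) (l1 l2 gm : R) : 0 < l1 -> l1 <= l2 ->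
  ipeq ip (K f1) (l1 *: f1) -> ipeq ip (K f2) (l2 *: f2) ->
  ip f1 f1 = 1 -> ip f2 f2 = 1 -> ip f1 f2 = 0 -> 0 < gm ->
  (forall x v, ip x x = 1 -> ip x f1 = 0 -> ip x f2 = 0 ->
     ipeq ip (K x) (v *: x) -> 0 <= v /\ gm <= `|v - l2|) ->
  exists f1' f2' : L2, [/\ is_generator ip (fun t => U t) f1 f1',
    is_generator ip (fun t => U t) f2 f2' &
    let w := ip f1 f2' in forall t : R, 0 <= t ->
    (ip (U t f1 - cos (w * t) *: f1 + sin (w * t) *: f2)
        (U t f1 - cos (w * t) *: f1 + sin (w * t) *: f2) +
     ip (U t f2 - cos (w * t) *: f2 - sin (w * t) *: f1)
        (U t f2 - cos (w * t) *: f2 - sin (w * t) *: f1)) / 2 <=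
    2 * (Nh * Lip / l1 * (gm^-1 * (Nh * D / T * t ^+ 2 + (l2 - l1) * t)))].
Proof.
move=> l10 l12 Kf1 Kf2 f11 f22 f12 gm0 gap.
have l20 : 0 < l2 by exact: lt_le_trans l12.
have [f1' g1 b1] := eigenfunction_generator l10 Kf1.
have [f2' g2 b2] := eigenfunction_generator l20 Kf2.
exists f1', f2'; split=> // w t t0.
have n1 : ipnorm ip f1 = 1 by rewrite /ipnorm f11 sqrtr1.
have n2 : ipnorm ip f2 = 1 by rewrite /ipnorm f22 sqrtr1.
rewrite n1 mulr1 in b1; rewrite n2 mulr1 in b2.
pose e i := if i == 0%N then f1 else f2.
pose u i := if i == 0%N then l1 else l2.
apply: (@two_plane_le _ _ ip (fun t => U t) _ _ _ _ K f1 f2 f1' f2' l1 l2) => //.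
- by move=> s x y; exact: flow_koopD.
- by move=> s c x; exact: flow_koopZ.
- by move=> s x y; exact: flow_koop_ip.
- by move=> s s' x; exact: flow_koop_add.
- by move=> x; exact: flow_koop0.
- by move=> x y; exact: (kL2_sym hborel Xc support_null kernel_continuous kernel_sym kernel_le).
- move=> f o1 o2.
  apply: (@kL2_spectral_gap _ _ _ _ _ _ _ _ _ _ _ kernel_sym _ 2 e u) => //.
  + exact: ltW.
  + case=> [|[|i]] [|[|j]]//= _ _; rewrite /e/= ?f11 ?f22 ?f12//.
    by rewrite -[RHS]f12; exact: (ipC ip f2 f1).
  + by case=> [|[|i]].
  + by move=> x v x1 ox; apply: gap => //; [exact: (ox 0%N)|exact: (ox 1%N)].
  + by case=> [|[|i]].
- by move=> s f s0; exact: koopman_commutator.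
(* A single G is required for both derivatives; the bound with the smaller eigenvalue l1 also covers
   f2. *)
- apply: le_trans b2 _; rewrite ler_wpM2l ?NhLip_ge0//.
  by rewrite lef_pV2.
Qed.

End observed_flow.

(** * Complex-valued functions *)

Section complex_L2.
Context {R : realType} {d : measure_display} {Omega : measurableMetricType R d}.
Variable mu : probability Omega R.
Local Notation L2r := (L2r mu).
Local Notation ip := (l2prod mu).
Implicit Types f g : L2r.

Definition cplx f g : Omega -> R[i] := fun x => f x +i* g x.

Lemma normc_sqr (a b : R) : Normc.normc (a +i* b) ^+ 2 = a ^+ 2 + b ^+ 2.
Proof. by rewrite /= sqr_sqrtr// addr_ge0 ?sqr_ge0. Qed.

Lemma L2_cplx f g : L2 mu (cplx f g).
Proof.
have [[mf fi] [mg gi]] := ((sqintP mu f).1 (l2funP f), (sqintP mu g).1 (l2funP g)).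
split; [exact: mf|exact: mg|].
have h := EFin_integrableD fi gi.
under eq_integral do rewrite normc_sqr.
have -> : (\int[mu]_x (f x ^+ 2 + g x ^+ 2)%:E = \int[mu]_x `|(f x ^+ 2 + g x ^+ 2)%:E|)%E.
  by apply: eq_integral => x _; rewrite gee0_abs// lee_fin addr_ge0 ?sqr_ge0.
by have /integrableP[_] := h.
Qed.

Lemma L2_cplxE w : L2 mu w -> exists f g, w = cplx f g.
Proof.
move=> [mr mi wi].
have h (p : Omega -> R) : measurable_fun setT p ->
    (forall x, p x ^+ 2 <= Normc.normc (w x) ^+ 2) -> p \in sqint mu.
  move=> mp pw; apply/sqintP; split=> //; apply/integrableP; split.
    by apply/measurable_EFinP; exact: measurable_funX.
  apply: le_lt_trans wi; apply: ge0_le_integral => //.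
  - by apply/measurable_EFinP; apply: measurableT_comp => //; exact: measurable_funX.
  - rewrite (_ : (fun x => _) = (fun x => (complex.Re (w x) ^+ 2 + complex.Im (w x) ^+ 2)%:E)).
      by apply/measurable_EFinP; apply: measurable_funD; exact: measurable_funX.
    by apply/funext => x; case: (w x) => u v; rewrite normc_sqr.
  - by move=> x _ /=; rewrite lee_fin ger0_norm ?sqr_ge0.
have hr : (fun x => complex.Re (w x)) \in sqint mu.
  by apply: h => // x; rewrite /=; case: (w x) => u v; rewrite normc_sqr lerDl sqr_ge0.
have hi : (fun x => complex.Im (w x)) \in sqint mu.
  by apply: h => // x; rewrite /=; case: (w x) => u v; rewrite normc_sqr lerDr sqr_ge0.
exists (MkL2r hr), (MkL2r hi); apply/funext => x; rewrite /cplx/=.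
by case: (w x).
Qed.

Lemma inner_cplx f g f' g' : inner mu (cplx f g) (cplx f' g') =
  (ip f f' + ip g g') +i* (ip f g' - ip g f').
Proof.
have i (p q : L2r) : mu.-integrable setT (EFin \o (fun x => p x * q x)).
  exact: sqint_mul (l2funP p) (l2funP q).
rewrite /inner /cintegral !l2prodE -RintegralD// -RintegralB//.
congr (_ +i* _); apply: eq_Rintegral => x _ /=; first by rewrite mulNr opprK.
by rewrite mulNr.
Qed.

Lemma L2norm_cplx f g : L2norm mu (cplx f g) = Num.sqrt (ip f f + ip g g).
Proof.
have i (p : L2r) : mu.-integrable setT (EFin \o (fun x => p x * p x)).
  exact: sqint_mul (l2funP p) (l2funP p).
rewrite /L2norm !l2prodE -RintegralD//; congr Num.sqrt.
by apply: eq_Rintegral => x _; rewrite normc_sqr !expr2.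
Qed.

Lemma aeq_cplx f g f' g' :
  aeq mu (cplx f g) (cplx f' g') <-> ipeq ip f f' /\ ipeq ip g g'.
Proof.
split=> [h|[/l2_ae hf /l2_ae hg]].
  by split; apply/l2_ae; apply: filterS h => x [].
by apply: filterS2 hf hg => x hf hg; rewrite /cplx hf hg.
Qed.

Lemma cplx0 : cplx 0 0 = cst 0.
Proof. by []. Qed.

Lemma aeq_cplx0 f g : aeq mu (cplx f g) (cst 0) <-> ip f f = 0 /\ ip g g = 0.
Proof.
rewrite -cplx0 aeq_cplx; split=> -[h1 h2].
  by rewrite h1 h2 !ip0l.
by split=> p; rewrite ip0l ip_null.
Qed.

Lemma scale_cplx (a b : R) f g :
  (fun x => (a +i* b) * cplx f g x) = cplx (a *: f - b *: g) (a *: g + b *: f).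
Proof. exact/funext. Qed.

Lemma real_scale_cplx (a : R) f g :
  (fun x => a%:C * cplx f g x) = cplx (a *: f) (a *: g).
Proof.
by rewrite scale_cplx !scale0r subr0 addr0.
Qed.

Lemma sum_cplx m (F G : 'I_m -> L2r) :
  (fun x => \sum_(i < m) cplx (F i) (G i) x) =
  cplx (\sum_(i < m) F i) (\sum_(i < m) G i).
Proof.
elim: m F G => [|m IH] F G; first by rewrite !big_ord0; apply/funext => x; rewrite big_ord0.
apply/funext => x; rewrite !big_ord_recr/=.
by rewrite [X in X + _](congr1 (fun p => p x) (IH _ _)).
Qed.

End complex_L2.

(** * Complex eigenspaces and multiplicities in terms of real eigenvectors *)

Section kernel_multiplicity.
Context {R : realType} {d : measure_display} {Omega : measurableMetricType R d}.
Variable mu : probability Omega R.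
Variables (k : Omega -> Omega -> R) (K : L2r mu -> L2r mu).
Local Notation L2r := (L2r mu).
Local Notation ip := (l2prod mu).
Hypothesis KE : forall (f : L2r) x, K f x = kop mu k f x.
Implicit Types f g : L2r.

Lemma integral_op_cplx f g y :
  integral_op mu k (cplx f g) y = kop mu k f y +i* kop mu k g y.
Proof.
congr (_ +i* _); apply: eq_Rintegral => x _ /=; first by rewrite mul0r subr0.
by rewrite mul0r addr0.
Qed.

Lemma eigenspace_cplx (u : R) f g : L2_eigenspace mu k u%:C (cplx f g) <->
  ipeq ip (K f) (u *: f) /\ ipeq ip (K g) (u *: g).
Proof.
rewrite -aeq_cplx -real_scale_cplx.
have E : integral_op mu k (cplx f g) = cplx (K f) (K g).
  by apply/funext => y; rewrite integral_op_cplx /cplx !KE.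
rewrite -E; split=> [[]//|h]; split=> //; exact: L2_cplx.
Qed.

Lemma eigenspace_real (u : R) f :
  L2_eigenspace mu k u%:C (cplx f 0) <-> ipeq ip (K f) (u *: f).
Proof.
rewrite eigenspace_cplx; split=> [[]//|h]; split=> // p.
have -> : K 0 = 0.
  apply/val_inj/funext => x; rewrite /= KE /kop.
  by under eq_Rintegral do rewrite mulr0; rewrite Rintegral_probability_cst.
by rewrite scaler0.
Qed.

Lemma point_spectrum_real (u : R) f :
  ip f f != 0 -> ipeq ip (K f) (u *: f) -> point_spectrum mu k u%:C.
Proof.
move=> f0 /eigenspace_real h; exists (cplx f 0) => //.
by rewrite aeq_cplx0 => -[/eqP]; rewrite (negbTE f0).
Qed.

(** The m + 1 vectors expand in m generators, so the coefficient matrix has a nonzero left kernel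
    vector v and the complex combination with coefficients v is null. The e i are real, so its real
    and imaginary parts are null separately, and orthonormality forces v = 0. *)
Lemma has_multiplicity_orthonormal (u : R) m (e : nat -> L2r) :
  has_multiplicity mu k u%:C m -> orthonormal ip m.+1 e ->
  ~ (forall i, (i < m.+1)%N -> ipeq ip (K (e i)) (u *: e i)).
Proof.
move=> [b [_ _ hb]] oe he.
have /choice[c hc] : forall i : 'I_m.+1, exists c : 'I_m -> R[i],
    aeq mu (cplx (e i) 0) (fun x => \sum_(j < m) c j * b j x).
  by move=> i; apply: hb; apply/eigenspace_real; exact: he.
pose C := \matrix_(i < m.+1, j < m) c i j.
have : kermx C != 0.
  by rewrite -mxrank_eq0 mxrank_ker subn_eq0 -ltnNge ltnS rank_leq_col.
move=> /rowV0Pn[v /sub_kermxP vC].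
apply/negP; rewrite negbK; apply/eqP.
pose re i := complex.Re (v ord0 i); pose im i := complex.Im (v ord0 i).
have h : aeq mu (cplx (\sum_(i < m.+1) re i *: e i) (\sum_(i < m.+1) im i *: e i)) (cst 0).
  rewrite -(sum_cplx (fun i => re i *: e i) (fun i => im i *: e i)).
  have H : {ae mu, forall x, forall i : 'I_m.+1, cplx (e i) 0 x = \sum_(j < m) c i j * b j x}.
    exact: filter_forall.
  apply: filterS H => x H.
  transitivity (\sum_(j < m) (v *m C) ord0 j * b j x); last first.
    by rewrite vC big1// => j _; rewrite mxE mul0r.
  under [RHS]eq_bigr do rewrite mxE mulr_suml.
  rewrite exchange_big/=; apply: eq_bigr => i _.
  under eq_bigr do rewrite mxE -mulrA.
  rewrite -mulr_sumr -H /re /im; case: (v ord0 i) => p q.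
  rewrite /cplx /=; apply/eqP; rewrite eq_complex /=.
  by rewrite !mulr0 subr0 add0r !eqxx.
have [hr hi] := (aeq_cplx0 _ _).1 h.
have co (r : 'I_m.+1 -> R) (j : 'I_m.+1) : ip (\sum_(i < m.+1) r i *: e i) (e j) = r j.
  rewrite ip_suml (bigD1 j)// ipZl oe// eqxx mulr1 big1 => [|i ij].
    exact: addr0.
  by rewrite ipZl oe// val_eqE (negbTE ij) mulr0.
have re0 j : re j = 0 by rewrite -co; exact: ip_null.
have im0 j : im j = 0 by rewrite -co; exact: ip_null.
apply/rowP => j; rewrite mxE; move: (re0 j) (im0 j); rewrite /re /im.
by case: (v ord0 j) => p q /= -> ->.
Qed.

End kernel_multiplicity.

Section complex_flow.
Context {R : realType} {d : measure_display} {Omega : measurableMetricType R d}.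
Variables (mu : probability Omega R) (Phi : R -> Omega -> Omega).
Hypothesis mP : forall t, measurable_fun setT (Phi t).
Hypothesis invP : forall t A, measurable A -> mu (Phi t @^-1` A) = mu A.
Local Notation ip := (l2prod mu).
Local Notation U t := (koopL2 (mP t) (@invP t)).

Lemma generator_graph_cplx (f g f' g' : L2r mu) :
  is_generator ip (fun t => U t) f f' -> is_generator ip (fun t => U t) g g' ->
  generator_graph mu Phi (cplx f g) (cplx f' g').
Proof.
move=> gf gg; split; [exact: L2_cplx|exact: L2_cplx|].
pose q (t : R) (p p' : L2r mu) := t^-1 *: (U t p - p) - p'.
have E t : (fun x => (t^-1)%:C * (koopman Phi t (cplx f g) x - cplx f g x) - cplx f' g' x) =
    cplx (q t f f') (q t g g').
  apply/funext => x; apply/eqP; rewrite eq_complex /= mul0r subr0 mul0r addr0.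
  by apply/andP.
under eq_cvg do rewrite E L2norm_cplx.
have sq (p p' : L2r mu) : is_generator ip (fun t => U t) p p' ->
    ip (q t p p') (q t p p') @[t --> (0 : R)^'] --> (0 : R).
  move=> h.
  have h2 : ipnorm ip (q t p p') * ipnorm ip (q t p p') @[t --> (0 : R)^'] --> (0 : R) * 0.
    exact: cvgM.
  by rewrite mulr0 in h2; under eq_cvg do rewrite -sqr_ipnorm expr2.
have h : ip (q t f f') (q t f f') + ip (q t g g') (q t g g') @[t --> (0 : R)^'] --> (0 : R) + 0.
  by apply: cvgD; exact: sq.
rewrite addr0 in h; have hs : Num.sqrt (ip (q t f f') (q t f f') + ip (q t g g') (q t g g'))
    @[t --> (0 : R)^'] --> Num.sqrt (0 : R).
  by refine (continuous_cvg _ (@sqrt_continuous R 0) h).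
by rewrite sqrtr0 in hs.
Qed.

End complex_flow.

Lemma continuous_complex (R : realType) (S : topologicalType) (f g : S -> R) :
  continuous f -> continuous g ->
  continuous ((fun x => f x +i* g x) : S -> (R[i] : numFieldType)).
Proof.
move=> fc gc x; apply/cvgrPdist_le => e e0.
have : 0 < complex.Re e /\ e = (complex.Re e)%:C.
  by move: e0; case: e => a b; rewrite ltcE /= => /andP[/eqP -> ->].
move=> [r0 ->]; set r := complex.Re e in r0 *.
have r2 : 0 < r / 2 by rewrite divr_gt0.
have /cvgrPdist_le/(_ _ r2) hf := fc x; have /cvgrPdist_le/(_ _ r2) hg := gc x.
apply: filterS2 hg hf => y hg hf.
rewrite (_ : _ - _ = (f x - f y)%:C + 'i%C * (g x - g y)%:C); last first.
  by apply/eqP; rewrite eq_complex /=; apply/andP; split; apply/eqP; ring.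
apply: le_trans (ler_normD _ _) _.
rewrite normrM !normc_def /= !expr0n /= !addr0 !sqrtr_sqr expr1n add0r sqrtr1 mul1r.
rewrite -rmorphD /= lecR; move: hf hg; lra.
Qed.

Lemma Rintegral_affine (R : realType) (a b t : R) : 0 <= t ->
  \int[lebesgue_measure]_(u in `[0, t]) (a * u + b) = a * t ^+ 2 / 2 + b * t.
Proof.
rewrite le_eqVlt => /predU1P[<-|t0].
  by rewrite set_itv1 Rintegral_set1 expr2 !mulr0 mul0r addr0.
pose P (u : R) := a / 2 * (u * u) + b * u.
have dP (u : R) : is_derive u 1 P (a * u + b).
  have d2 := is_deriveM (is_derive_cst (a / 2) u 1) (is_deriveM (is_derive_id u 1) (is_derive_id u 1)).
  have d1 := is_deriveM (is_derive_cst b u 1) (is_derive_id u 1).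
  apply: is_derive1W (is_deriveD d2 d1) _ _ => //.
  by rewrite !scaler0 !addr0 /GRing.scale/=; field.
have cP : continuous P by move=> u; apply: differentiable_continuous; apply/derivable1_diffP; exact: (@ex_derive _ _ _ _ _ _ _ (dP u)).
rewrite /Rintegral (@continuous_FTC2 _ _ P)//.
- by rewrite -EFinB /= /P; field.
- apply: continuous_subspaceT => u; apply: cvgD; last exact: cvg_cst.
  by apply: cvgM; [exact: cvg_cst|exact: cvg_id].
- split; last 2 first.
  + by apply: cvg_at_right_filter; exact: cP.
  + by apply: cvg_at_left_filter; exact: cP.
  by move=> u _; exact: (@ex_derive _ _ _ _ _ _ _ (dP u)).
- by move=> u _; rewrite derive1E; exact: (@derive_val _ _ _ _ _ _ _ (dP u)).
Qed.

(** Compares the error of [two_plane_le] with S at tau. Here r is 1 / sqrt 2, e is nu - lambda, so r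
    e is delta, and d' is delta / nu. Both sides carry the same factor 2 P; what is left follows
    from t <= tau, 1 <= 1 + d' and 1 <= 3 r. *)
Lemma two_plane_error_le (R : realType) (N L1 L2 D T lam gam e d' r t tau : R) :
  0 <= N -> 0 <= N * (L1 * L2) -> 0 <= D -> 0 < T -> 0 < lam -> 0 < gam ->
  0 <= e -> 0 <= d' -> 0 < r -> r * r = 2^-1 -> 0 <= t -> t <= tau ->
  2 * (N * (L1 * L2) / lam * (gam^-1 * (N * D / T * t ^+ 2 + e * t))) <=
  2 * N * L2 * L1 * (1 + d') / lam *
    (gam^-1 * (2 * N * D / T) * tau ^+ 2 / 2 + gam^-1 * (3 * (r * e)) * tau).
Proof.
move=> N0 P0 D0 T0 l0 g0 e0 d0 r0 rr t0 ttau.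
have tau0 : 0 <= tau by exact: le_trans ttau.
pose P := N * (L1 * L2) / lam / gam; pose Q := N * D / T.
have {}P0 : 0 <= P by rewrite !divr_ge0// ltW.
have Q0 : 0 <= Q by rewrite divr_ge0 ?mulr_ge0// ltW.
have -> : 2 * (N * (L1 * L2) / lam * (gam^-1 * (N * D / T * t ^+ 2 + e * t))) =
    2 * P * (Q * t ^+ 2 + e * t) by rewrite /P /Q; field; rewrite !gt_eqF.
have -> : 2 * N * L2 * L1 * (1 + d') / lam *
    (gam^-1 * (2 * N * D / T) * tau ^+ 2 / 2 + gam^-1 * (3 * (r * e)) * tau) =
    2 * P * ((1 + d') * (Q * tau ^+ 2 + 3 * r * e * tau)).
  by rewrite /P /Q; field; rewrite !gt_eqF.
clearbody P Q; rewrite ler_wpM2l ?mulr_ge0//.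
have r3 : 1 <= 3 * r by nra.
have h1 : Q * t ^+ 2 <= Q * tau ^+ 2 by rewrite ler_wpM2l// ler_sqr ?nnegrE.
have h2 : e * t <= 3 * r * e * tau.
  apply: ler_pM => //; apply: le_trans (_ : 1 * e <= _); first by rewrite mul1r.
  by rewrite ler_wpM2r.
apply: le_trans (lerD h1 h2) _; rewrite ler_peMl ?lerDl//.
by rewrite addr_ge0// !mulr_ge0 ?sqr_ge0// ltW.
Qed.

(** * The theorem, by reduction to the real parts and imaginary parts *)

Theorem corollary3
  (R : realType) (d : measure_display) (Omega : measurableMetricType R d)
  (hborel : borel Omega)
  (* flow and invariant measure *)
  (Phi : R -> Omega -> Omega) (hPhi : continuous_flow Phi)
  (mu : probability Omega R)
  (hinv : invariant_measure mu Phi) (herg : ergodic_measure mu Phi)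
  (X : set Omega) (hX : is_support mu X) (hXc : compact X)
  (* forward-invariant compact C^1 manifold *)
  (M : set Omega) (hXM : X `<=` M) (hMc : compact M)
  (n : nat) (a : c1_atlas (R := R) M n) (g : riemannian_metric a)
  (hMfwd : forall (t : R) x, 0 <= t -> M x -> M (Phi t x))
  (hPhiC1 : C1_flow a Phi)
  (* observation map *)
  (Y : completeNormedModType R) (F : Omega -> Y)
  (hF : continuous F) (hFC1 : C1_M a F)
  (hd2C1 : C1_MM a (obs_dist2 F))
  (* kernel *)
  (h h' : R -> R) (hh : kernel_shape h h')
  (T : R) (hT : 0 < T)
  (hKpos : forall u : R[i],
     point_spectrum mu (delay_kernel F Phi h T) u -> 0 <= u)
  (* eigenfunctions *)
  (phi psi : Omega -> R) (lambda nu : R)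
  (hphi : L2_eigenspace mu (delay_kernel F Phi h T) lambda%:C
            (fun x => (phi x)%:C))
  (hpsi : L2_eigenspace mu (delay_kernel F Phi h T) nu%:C
            (fun x => (psi x)%:C))
  (hphi1 : L2norm mu (fun x => (phi x)%:C) = 1)
  (hpsi1 : L2norm mu (fun x => (psi x)%:C) = 1)
  (horth : inner mu (fun x => (phi x)%:C) (fun x => (psi x)%:C) = 0)
  (hlambda : lambda != 0) (hnu : nu != 0) (hle : lambda <= nu)
  (hsimple : lambda != nu ->
     has_multiplicity mu (delay_kernel F Phi h T) lambda%:C 1 /\
     has_multiplicity mu (delay_kernel F Phi h T) nu%:C 1)
  (hdouble : lambda = nu ->
     has_multiplicity mu (delay_kernel F Phi h T) lambda%:C 2)
  (gamma : R)
  (hgamma : is_minimum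
     [set Num.min (Normc.normc (lambda%:C - u)) (Normc.normc (nu%:C - u))
       | u in point_spectrum mu (delay_kernel F Phi h T)
              `\` [set lambda%:C; nu%:C]]
     gamma) :
  let kT := delay_kernel F Phi h T in
  let phiC : Omega -> R[i] := fun x => (phi x)%:C in
  let psiC : Omega -> R[i] := fun x => (psi x)%:C in
  let z : Omega -> R[i] :=
    fun x => ((Num.sqrt 2)^-1)%:C * (phiC x + 'i%C * psiC x) in
  let delta := (Num.sqrt 2)^-1 * (nu - lambda) in
  let delta' := delta / nu in
  let C1 := 2 * normC1_halfline h h' * sup_norm (X `*` X) (obs_dist2 F) in
  let C2 := 2 * normC1_halfline h h' * normC1_MM g (obs_dist2 F) in
  let s_ := fun t : R => gamma^-1 * (C1 * t / T + 3 * delta) in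
  let S_ := fun t : R =>
    C2 * dirder_norm g Phi * (1 + delta') / lambda *
    \int[lebesgue_measure]_(u in `[0, t]) s_ u in
  let eps := fun t : R => s_ t + 3 * Num.sqrt (S_ t) in
  let zeta : Omega -> R[i] := fun y =>
    ((Num.sqrt 2)^-1)%:C *
    cintegral mu (fun x => (kT y x)%:C *
      (phiC x / lambda%:C + 'i%C * (psiC x / nu%:C))) in
  (exists (Vphi Vpsi Vz : Omega -> R[i]) (omega : R),
     [/\ generator_graph mu Phi phiC Vphi,
         generator_graph mu Phi psiC Vpsi &
         generator_graph mu Phi z Vz] /\
     [/\ omega%:C = ('i%C)^-1 * inner mu z Vz,
         omega%:C = inner mu phiC Vpsi &
         omega%:C = - inner mu psiC Vphi] /\
     (forall t : R, 0 <= t ->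
        approx_point_spectrum mu Phi t (eps t) (expi (omega * t)) /\
        approx_eigenpair mu Phi t (eps t) (expi (omega * t)) z) /\
     (forall tau t : R, 0 <= t <= tau ->
        approx_eigenpair mu Phi t (eps tau) (expi (omega * t)) z)) /\
  (continuous (zeta : Omega -> (R[i] : numFieldType)) /\ aeq mu zeta z).
Proof.
move=> kT phiC psiC z delta delta' C1 C2 s_ S_ eps zeta.
pose X0 := support_null hX.
pose kc := kernel_continuous hPhi hF hh hT.
pose kl := kernel_le Phi F hh hT.
pose K := kL2 hborel hXc X0 kc kl.
have KE (f : L2r mu) x : K f x = kop mu kT f x by [].
have [p1 [p2 Ep]] := L2_cplxE hphi.1.
have [q1 [q2 Eq]] := L2_cplxE hpsi.1.
have p20 : p2 = 0.
  by apply/val_inj/funext => x; have := congr1 (fun w => complex.Im (w x)) Ep.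
have q20 : q2 = 0.
  by apply/val_inj/funext => x; have := congr1 (fun w => complex.Im (w x)) Eq.
have {p20}phiE : phiC = cplx p1 0 by rewrite -p20 -Ep.
have {q20}psiE : psiC = cplx q1 0 by rewrite -q20 -Eq.
have {Ep} pE x : p1 x = phi x by have := congr1 (fun w => complex.Re (w x)) Ep.
have {Eq} qE x : q1 x = psi x by have := congr1 (fun w => complex.Re (w x)) Eq.
rewrite -/phiC phiE in hphi hphi1; rewrite -/psiC psiE in hpsi hpsi1.
rewrite -/phiC -/psiC phiE psiE in horth.
clearbody phiC psiC.
have Kp : ipeq (l2prod mu) (K p1) (lambda *: p1) by exact/(eigenspace_real KE).
have Kq : ipeq (l2prod mu) (K q1) (nu *: q1) by exact/(eigenspace_real KE).
have sqrt1 (r : R) : 0 <= r -> Num.sqrt r = 1 -> r = 1.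
  by move=> r0 r1; rewrite -(sqr_sqrtr r0) r1 expr1n.
have p11 : l2prod mu p1 p1 = 1.
  by apply: sqrt1; [exact: ip_ge0|rewrite -hphi1 L2norm_cplx ip0l addr0].
have q11 : l2prod mu q1 q1 = 1.
  by apply: sqrt1; [exact: ip_ge0|rewrite -hpsi1 L2norm_cplx ip0l addr0].
have pq : l2prod mu p1 q1 = 0.
  rewrite inner_cplx in horth.
  have : l2prod mu p1 q1 + l2prod mu 0 0 = 0 by exact: (congr1 (@complex.Re _) horth).
  by rewrite ip0l addr0.
have ev_ge0 (u : R) f : l2prod mu f f = 1 -> ipeq (l2prod mu) (K f) (u *: f) ->
    point_spectrum mu kT u%:C /\ 0 <= u.
  move=> f1 Kf; have pu : point_spectrum mu kT u%:C.
    by apply: (point_spectrum_real KE _ Kf); rewrite f1 oner_eq0.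
  by split=> //; have := hKpos _ pu; rewrite lecR.
have l0 : 0 < lambda by rewrite lt_neqAle eq_sym hlambda (ev_ge0 _ _ p11 Kp).2.
have n0 : 0 < nu by exact: lt_le_trans hle.
have normcE (r s : R) : Normc.normc (r%:C - s%:C) = `|r - s|.
  by rewrite /= subr0 expr0n /= addr0 sqrtr_sqr.
(* The minimum is attained, at an eigenvalue different from lambda and nu, so it is positive. *)
have g0 : 0 < gamma.
  case: (hgamma) => -[u [pu nu'] <-] _.
  have pos (w : R[i]) : w <> u -> 0 < Normc.normc (w - u).
    have normc_ge0 (v : R[i]) : 0 <= Normc.normc v by case: v => r s; exact: sqrtr_ge0.
    move=> wu; rewrite lt_neqAle normc_ge0 andbT eq_sym; apply/eqP => /Normc.eq0_normc/eqP.
    by rewrite subr_eq0 => /eqP.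
  by rewrite lt_min !pos// => E; apply: nu'; rewrite -E; [right|left].
(* If v were lambda or nu, then x together with p1 or q1 (with both, when lambda = nu) would give
   more orthonormal eigenvectors than the multiplicity allows. So v competes in the minimum defining
   gamma. *)
have gap x v : l2prod mu x x = 1 -> l2prod mu x p1 = 0 -> l2prod mu x q1 = 0 ->
    ipeq (l2prod mu) (K x) (v *: x) -> 0 <= v /\ gamma <= `|v - nu|.
  move=> x1 xp xq Kx; have [pv v0] := ev_ge0 _ _ x1 Kx; split=> //.
  have one_mult (f : L2r mu) (u : R) : l2prod mu f f = 1 -> l2prod mu x f = 0 ->
      ipeq (l2prod mu) (K f) (u *: f) -> has_multiplicity mu kT u%:C 1 -> v <> u.
    move=> f1 xf Kf hm vu; subst v.
    apply: (has_multiplicity_orthonormal KE (e := fun i => if i == 0%N then f else x) hm).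
      case=> [|[|i]] [|[|j]]//= _ _.
      by rewrite -[RHS]xf; exact: (ipC (l2prod mu) f x).
    by case=> [|[|i]].
  have vl : v <> lambda /\ v <> nu.
    have [ln|/[dup] ln /hsimple[m1 m2]] := eqVneq lambda nu; last first.
      by split; [exact: (one_mult _ _ p11 xp Kp m1)|exact: (one_mult _ _ q11 xq Kq m2)].
    have hm := hdouble ln; rewrite -ln; suff vl : v <> lambda by [].
    move=> vu; subst v; rewrite -ln in Kq.
    apply: (has_multiplicity_orthonormal KE
      (e := fun i => if i == 0%N then p1 else if i == 1%N then q1 else x) hm).
      case=> [|[|[|i]]] [|[|[|j]]]//= _ _.
      - by rewrite -[RHS]xp; exact: (ipC (l2prod mu) p1 x).
      - by rewrite -[RHS]pq; exact: (ipC (l2prod mu) q1 p1).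
      - by rewrite -[RHS]xq; exact: (ipC (l2prod mu) q1 x).
    by case=> [|[|[|i]]].
  rewrite distrC -normcE; case: (hgamma) => _ hmin.
  have ps : (point_spectrum mu kT `\` [set lambda%:C; nu%:C]) v%:C.
    by split=> // -[] /(congr1 (@complex.Re _)); [exact: vl.1|exact: vl.2].
  apply: le_trans (hmin _ (imageP _ ps)) _.
  by rewrite ge_min lexx orbT.
have [p1' [q1' [gp gq bound]]] := eigenpair_generators hinv hXM hMc g
  hMfwd hPhiC1 hd2C1 l0 hle Kp Kq p11 q11 pq g0 gap.
pose U t := koopL2 (flow_measurable hborel hPhi t) (@flow_preserves _ _ _ _ _ hinv t).
pose w := l2prod mu p1 q1'.
pose r2 : R := (Num.sqrt 2)^-1.
have r2_gt0 : 0 < r2 by rewrite invr_gt0 sqrtr_gt0.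
have r2_sqr : r2 * r2 = 2^-1 by rewrite -invfM -expr2 sqr_sqrtr.
have ZE (c : R) (f : L2r mu) x : (c *: f) x = c * f x :> R by [].
have BE (f f' : L2r mu) x : (f - f') x = f x - f' x :> R by [].
have DE (f f' : L2r mu) x : (f + f') x = f x + f' x :> R by [].
have OE x : (0 : L2r mu) x = 0 :> R by [].
have zE : z = cplx (r2 *: p1) (r2 *: q1).
  apply/funext => x; rewrite /z phiE psiE -/r2 /cplx !ZE OE; apply/eqP.
  rewrite eq_complex; apply/andP; split; apply/eqP; rewrite /=; ring.
have Uip t x y : l2prod mu (U t x) (U t y) = l2prod mu x y by exact: koopL2_ip.
have wp : l2prod mu q1 p1' = - w.
  by have := generator_skew Uip gp gq; rewrite (ipC (l2prod mu) q1) -/w; lra.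
have skew0 (f f' : L2r mu) : is_generator (l2prod mu) U f f' -> l2prod mu f f' = 0.
  by move=> gf; have := generator_skew Uip gf gf; rewrite (ipC (l2prod mu) f'); lra.
have gZ (f f' : L2r mu) : is_generator (l2prod mu) U f f' ->
    is_generator (l2prod mu) U (r2 *: f) (r2 *: f').
  move=> gf; have E u : ipnorm (l2prod mu) (u^-1 *: (U u (r2 *: f) - r2 *: f) - r2 *: f') =
      r2 * ipnorm (l2prod mu) (u^-1 *: (U u f - f) - f').
    have -> : U u (r2 *: f) = r2 *: U u f by exact: koopL2Z.
    by rewrite -scalerBr scalerA mulrC -scalerA -scalerBr ipnormZ gtr0_norm.
  have h2 : r2 * ipnorm (l2prod mu) (u^-1 *: (U u f - f) - f') @[u --> (0 : R)^'] --> r2 * 0.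
    by apply: cvgM => //; exact: cvg_cst.
  by rewrite mulr0 in h2; rewrite /is_generator; under eq_cvg do rewrite E.
have g00 : is_generator (l2prod mu) U 0 0.
  have E u : ipnorm (l2prod mu) (u^-1 *: (U u 0 - 0) - 0) = 0.
    have -> : U u 0 = 0 by exact/val_inj.
    by rewrite !subr0 scaler0 /ipnorm ip0l sqrtr0.
  by rewrite /is_generator; under eq_cvg do rewrite E; exact: cvg_cst.
have z1 : L2norm mu z = 1.
  rewrite zE L2norm_cplx !ipZl !ipZr p11 q11 !mulr1 !r2_sqr.
  by rewrite (_ : 2^-1 + 2^-1 = 1 :> R) ?sqrtr1//; field.
have S_E (t : R) : 0 <= t -> S_ t = C2 * dirder_norm g Phi * (1 + delta') / lambda *
    (gamma^-1 * (C1 / T) * t ^+ 2 / 2 + gamma^-1 * (3 * delta) * t).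
  move=> t0; rewrite /S_ -Rintegral_affine//; congr (_ * _).
  by apply: eq_Rintegral => u _; rewrite /s_; ring.
have pair tau t : 0 <= t <= tau -> approx_eigenpair mu Phi t (eps tau) (expi (w * t)) z.
  move=> /andP[t0 ttau]; split.
  - by rewrite zE; exact: L2_cplx.
  - rewrite zE aeq_cplx0 ipZl ipZr p11 mulr1 r2_sqr => -[] /eqP.
    by rewrite invr_eq0 pnatr_eq0.
  rewrite z1 mulr1.
  pose A := U t p1 - cos (w * t) *: p1 + sin (w * t) *: q1.
  pose B := U t q1 - cos (w * t) *: q1 - sin (w * t) *: p1.
  have -> : (fun x => koopman Phi t z x - expi (w * t) * z x) = cplx (r2 *: A) (r2 *: B).
    rewrite zE; apply/funext => x; rewrite /koopman /cplx /expi /A /B /comp.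
    rewrite !(ZE, BE, DE) -![U t _ x]/(l2fun _ (Phi t x)); apply/eqP.
    by rewrite eq_complex; apply/andP; split; apply/eqP; rewrite /=; ring.
  rewrite L2norm_cplx !ipZl !ipZr !mulrA !r2_sqr -mulrDr mulrC.
  have tau0 : 0 <= tau := le_trans t0 ttau.
  have D0 : 0 <= sup_norm (X `*` X) (obs_dist2 F).
    by apply: sup_norm_ge0; exact: (sup_normMM_bounded hXc (obs_dist2_continuous hF)).
  have N0 := Nh_ge0 hh.
  have P0 := NhLip_ge0 hPhi hMc g hMfwd hPhiC1 hF hd2C1 hh.
  have e0 : 0 <= nu - lambda by rewrite subr_ge0.
  have d0 : 0 <= delta' by rewrite divr_ge0 ?(ltW n0)// mulr_ge0// ltW.
  (* The distance is at most sqrt (S_ tau), which is below eps tau because s_ tau >= 0 and 1 <=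
     3. *)
  apply: le_trans (ler_wsqrtr (le_trans (bound t t0) (_ : _ <= S_ tau))) _.
    rewrite S_E//.
    exact: (two_plane_error_le N0 P0 D0 hT l0 g0 e0 d0 r2_gt0 r2_sqr t0 ttau).
  rewrite /eps ler_wpDl//.
    rewrite /s_ mulr_ge0 ?invr_ge0 ?(ltW g0)// addr_ge0//.
      by rewrite divr_ge0 ?(ltW hT)// !mulr_ge0.
    by rewrite !mulr_ge0// ltW.
  by rewrite ler_peMl ?sqrtr_ge0// ler1n.
have zetaE : zeta = cplx (r2 *: K (lambda^-1 *: p1)) (r2 *: K (nu^-1 *: q1)).
  apply/funext => y; rewrite /zeta -/r2.
  have -> : (fun x => (kT y x)%:C * (phiC x / lambda%:C + 'i%C * (psiC x / nu%:C))) =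
      (fun x => (kT y x)%:C * cplx (lambda^-1 *: p1) (nu^-1 *: q1) x).
    apply/funext => x; congr (_ * _); rewrite phiE psiE /cplx !ZE OE -!fmorphV.
    by apply/eqP; rewrite eq_complex; apply/andP; split; apply/eqP; rewrite /=; ring.
  rewrite -[cintegral _ _]/(integral_op mu kT (cplx (lambda^-1 *: p1) (nu^-1 *: q1)) y).
  rewrite integral_op_cplx /cplx !ZE !KE; apply/eqP.
  by rewrite eq_complex; apply/andP; split; apply/eqP; rewrite /=; ring.
have ks := kernel_sym Phi F h T.
(* Symmetry moves K to the other factor, so that u^-1 can be taken out and cancelled against the
   eigenvalue. *)
have Kinv u f : u != 0 -> ipeq (l2prod mu) (K f) (u *: f) ->
    ipeq (l2prod mu) (r2 *: K (u^-1 *: f)) (r2 *: f).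
  move=> u0 Kf f'; rewrite !ipZl; congr (_ * _).
  rewrite (kL2_sym hborel hXc X0 kc ks kl) ipZl -(kL2_sym hborel hXc X0 kc ks kl).
  by rewrite Kf ipZl mulKf.
split; last split.
- exists (cplx p1' 0), (cplx q1' 0), (cplx (r2 *: p1') (r2 *: q1')), w.
  split; [split|split; [split|split]].
  + by rewrite phiE; exact: (generator_graph_cplx gp g00).
  + by rewrite psiE; exact: (generator_graph_cplx gq g00).
  + by rewrite zE; exact: (generator_graph_cplx (gZ _ _ gp) (gZ _ _ gq)).
  (* The real part of <z, V z> vanishes by skew-adjointness, and the imaginary part is (w + w) /
     2. *)
  + rewrite zE inner_cplx !ipZl !ipZr (skew0 _ _ gp) (skew0 _ _ gq) wp -/w.
    move: (w) => v; rewrite !mulr0 addr0 !mulrN opprK !mulrA r2_sqr.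
    rewrite (_ : 0 +i* (2^-1 * v + 2^-1 * v) = 'i%C * v%:C) ?mulKf ?neq0Ci//.
    by apply/eqP; rewrite eq_complex /=; apply/andP; split; apply/eqP; field.
  + rewrite phiE inner_cplx !ip0l !ip0r -/w subr0 addr0//.
  + rewrite psiE inner_cplx !ip0l !ip0r wp subr0 addr0.
    by apply/eqP; rewrite eq_complex /= opprK oppr0 !eqxx.
  + move=> t t0; have h1 : approx_eigenpair mu Phi t (eps t) (expi (w * t)) z.
      by apply: pair; rewrite t0 lexx.
    by split=> //; exists z.
  + by move=> tau t; exact: pair.
- rewrite zetaE; apply: continuous_complex => y.
    by apply: cvgM; [exact: cvg_cst|exact: (kop_continuous hborel hXc X0 kc kl)].
  by apply: cvgM; [exact: cvg_cst|exact: (kop_continuous hborel hXc X0 kc kl)].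
- by rewrite zetaE zE; apply/aeq_cplx; split; exact: Kinv.
Qed.
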